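(* If $\Omega$ is a bounded domain in $\mathbb C^n$ and $0<p\le1$, then $A^p(\Omega)$ is not a Chebyshev set in $L^p(\Omega)$. In particular, the $p$-Bergman projection cannot be defined through the metric projection $f\mapsto\mathcal P_{A^p(\Omega)}(f)$ for $0<p\le1$ (i.e. the metric projection from $L^p(\Omega)$ to $A^p(\Omega)$ is not single-valued).
   Context: $L^p(\Omega)$ is the space of complex-valued functions with $\int_\Omega|f|^p<\infty$ (Lebesgue measure), with the metric $d(f,g)=\int_\Omega|f-g|^p$ for $0<p\le1$, and $A^p(\Omega)=L^p(\Omega)\cap\mathcal O(\Omega)$. For a metric space $(X,d)$ and $Y\subset X$, a point $y_0\in Y$ is a best approximation of $x\in X$ if $d(x,y_0)=\inf_{y\in Y}d(x,y)$; $\mathcal P_Y(x)$ denotes the set of all best approximations of $x$. $Y$ is called Chebyshev in $X$ if $\mathcal P_Y(x)$ is a singleton for every $x\in X$. *)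

(* Defs.v *)
From HB Require Import structures.
From mathcomp Require Import all_boot all_order all_algebra complex.
From mathcomp Require Import lra.
From mathcomp Require Import all_classical all_reals all_analysis.
From mathcomp Require Import measurable_realfun.

Set Implicit Arguments.
Unset Strict Implicit.
Unset Printing Implicit Defensive.

Import Order.TTheory GRing.Theory Num.Theory.
Import numFieldNormedType.Exports.
Import ComplexField.Normc.

Local Open Scope classical_set_scope.
Local Open Scope ring_scope.

Section Approximation.
Context {R : realType} {X : metricType R}.
Implicit Type (Y : set X) (x : X).

Definition best_approximations Y x : set X :=
  [set y | Y y /\ mdist x y = inf [set mdist x z | z in Y]].

Definition chebyshev_set Y := forall x, exists y, best_approximations Y x = [set y].

End Approximation.

(* R[i] itself carries no topology; giving it its numClosedFieldType structure
   makes R[i] and the row vectors over it normed spaces over R[i]. *)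
Definition Cplx (R : realType) : numClosedFieldType := R[i].

(* Borel sets of C^n; the topology is that of the sup norm. *)
HB.instance Definition _ (R : realType) (n : nat) :=
  Measurable.copy 'rV[Cplx R]_n (g_sigma_algebraType (@open 'rV[Cplx R]_n)).

Lemma open_measurable_Cn (R : realType) n (U : set 'rV[Cplx R]_n) :
  open U -> measurable U.
Proof. by move=> oU; exact: sub_sigma_algebra. Qed.

(* The library proves this too, but its canonical instance on (m1 \x m2) only
   applies to subprobabilities. *)
Lemma product_measure_sigma_finite d1 d2 (T1 : measurableType d1)
    (T2 : measurableType d2) (R : realType)
    (m1 : {sigma_finite_measure set T1 -> \bar R})
    (m2 : {sigma_finite_measure set T2 -> \bar R}) :
  sigma_finite setT (m1 \x m2)%E.
Proof.
have /sigma_finiteP[F [TF ndF Foo]] := sigma_finiteT m1.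
have /sigma_finiteP[G [TG ndG Goo]] := sigma_finiteT m2.
exists (fun n => F n `*` G n).
  rewrite -setXTT TF TG predeqE => -[x y]; split.
    move=> [/= [n _ Fnx] [k _ Gky]]; exists (maxn n k) => //; split.
    - by move: x Fnx; exact/subsetPset/ndF/leq_maxl.
    - by move: y Gky; exact/subsetPset/ndG/leq_maxr.
  by move=> [n _ []/= ? ?]; split; exists n.
move=> k; have [? ?] := Foo k; have [? ?] := Goo k.
split; first exact: measurableX.
by rewrite product_measure1E// lte_mul_pinfty// ge0_fin_numE.
Qed.

(* The n-fold product measure on n-tuples: mu \x (n-fold power) is transported
   along (x, t) |-> x :: t. *)
Section ProductPower.
Context {d} {T : measurableType d} {R : realType}.

Definition tcons n (x : T * n.-tuple T) : n.+1.-tuple T :=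
  [tuple of x.1 :: x.2].

Lemma measurable_tcons n : measurable_fun setT (@tcons n).
Proof. exact: measurable_cons. Qed.
Hint Extern 0 (measurable_fun _ (@tcons _)) =>
  solve [exact: measurable_tcons] : core.

Variable mu : {sigma_finite_measure set T -> \bar R}.

Section Step.
Variables (n : nat) (nu : {sigma_finite_measure set (n.-tuple T) -> \bar R}).

Definition tcons_measure : set (n.+1.-tuple T) -> \bar R :=
  pushforward (mu \x nu)%E (@tcons n).

Let tcons_measure0 : tcons_measure set0 = 0%E.
Proof. exact: measure0. Qed.

Let tcons_measure_ge0 A : (0 <= tcons_measure A)%E.
Proof. exact: measure_ge0. Qed.

Let tcons_measure_sigma_additive : semi_sigma_additive tcons_measure.
Proof. exact: measure_semi_sigma_additive. Qed.

HB.instance Definition _ := isMeasure.Build _ _ _ tcons_measure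
  tcons_measure0 tcons_measure_ge0 tcons_measure_sigma_additive.

Let tcons_measure_sigma_finite : sigma_finite setT tcons_measure.
Proof.
have [F FT Fm] := product_measure_sigma_finite mu nu.
pose g (t : n.+1.-tuple T) : T * n.-tuple T := (thead t, [tuple of behead t]).
have mg : measurable_fun setT g.
  apply: measurable_fun_pair; last exact: measurable_behead.
  exact: (measurable_tnth ord0).
have gK : cancel (@tcons n) g.
  by move=> [x t]; apply: (congr2 pair) => //; exact: val_inj.
exists (fun i => g @^-1` F i); first by rewrite -preimage_bigcup -FT.
move=> i; have [mF Foo] := Fm i; split.
  by rewrite -[X in measurable X]setTI; exact: mg.
rewrite /tcons_measure /pushforward -comp_preimage.
by rewrite (_ : g \o _ = idfun) // funeqE => x /=; rewrite gK.
Qed.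

HB.instance Definition _ := Measure_isSigmaFinite.Build _ _ _ tcons_measure
  tcons_measure_sigma_finite.

End Step.

Fixpoint product_power n : {sigma_finite_measure set (n.-tuple T) -> \bar R} :=
  if n is n'.+1 then tcons_measure (product_power n') else \d_[tuple].

End ProductPower.

Section LebesgueCn.
Context {R : realType}.

Definition area_measure : set (measurableTypeR R * measurableTypeR R) -> \bar R :=
  (lebesgue_measure \x lebesgue_measure)%E.

HB.instance Definition _ := Measure.on area_measure.
HB.instance Definition _ := Measure_isSigmaFinite.Build _ _ _ area_measure
  (product_measure_sigma_finite lebesgue_measure lebesgue_measure).

Variable n : nat.

Definition Cn_of_real (t : n.-tuple (measurableTypeR R * measurableTypeR R)) :
  'rV[Cplx R]_n := \row_j Complex (tnth t j).1 (tnth t j).2.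

Let sqrt_sumsq_le (a b : R) : Num.sqrt (a ^+ 2 + b ^+ 2) <= `|a| + `|b|.
Proof.
rewrite -[leRHS]ger0_norm ?addr_ge0// -sqrtr_sqr ler_wsqrtr// sqrrD.
by rewrite !real_normK ?num_real// lerD2r lerDl mulrn_wge0// mulr_ge0.
Qed.

Lemma measurable_Cn_of_real : measurable_fun setT Cn_of_real.
Proof.
apply: (measurability (@open 'rV[Cplx R]_n)) => // _ [U oU <-]; rewrite setTI.
pose Q := ({ffun 'I_n -> rat * rat} * nat)%type.
pose B (q : Q) := [set t : n.-tuple (measurableTypeR R * measurableTypeR R) |
  forall j, `|(tnth t j).1 - ratr (q.1 j).1| < q.2.+1%:R^-1 /\
            `|(tnth t j).2 - ratr (q.1 j).2| < q.2.+1%:R^-1].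
have mB q : measurable (B q).
  rewrite (_ : B q = \bigcap_(j in [set: 'I_n])
     ((fun t => (tnth t j).1) @^-1` (ball (ratr (q.1 j).1 : R) q.2.+1%:R^-1) `&`
      (fun t => (tnth t j).2) @^-1` (ball (ratr (q.1 j).2 : R) q.2.+1%:R^-1))).
    apply: fin_bigcap_measurable => // j _; apply: measurableI;
      rewrite -[X in measurable X]setTI.
    - apply: (measurableT_comp measurable_fst (measurable_tnth j)) => //.
      exact: measurable_ball.
    - apply: (measurableT_comp measurable_snd (measurable_tnth j)) => //.
      exact: measurable_ball.
  apply/seteqP; split => [t Bt j _|t Bt j].
    by have [? ?] := Bt j; split; rewrite /ball/= distrC.
  by have [? ?] := Bt j Logic.I; split; rewrite distrC.
pose V m := if unpickle m is Some q then
  (if `[< B q `<=` Cn_of_real @^-1` U >] then B q else set0) else set0.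
rewrite (_ : _ @^-1` _ = \bigcup_m V m).
  apply: bigcupT_measurable => m; rewrite /V.
  by case: unpickle => [q|//]; case: ifP.
apply/seteqP; split => [t Ut|t [m _]]; last first.
  by rewrite /V; case: unpickle => [q|//]; case: asboolP => // + Bt; exact.
have /nbhs_ballP[e /= e0 eU] : nbhs (Cn_of_real t) U by exact: open_nbhs_nbhs.
have {e0 eU} [r r0 rU] : exists2 r : R, 0 < r &
    forall s, (forall j, `|(tnth t j).1 - (tnth s j).1| +
      `|(tnth t j).2 - (tnth s j).2| < r) -> U (Cn_of_real s).
  case: e e0 eU => r i; rewrite ltcE /= => /andP[/eqP-> r0] eU.
  exists r => // s ts; apply: eU; split => [|i' j]; first by rewrite ltcR.
  rewrite /ball/= !mxE/= ltcR; apply: le_lt_trans (ts j).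
  exact: sqrt_sumsq_le.
have [k] : exists k, 0 + k.+1%:R^-1 < r / 4 by apply: ltr_add_invr; exact: divr_gt0.
rewrite add0r => kr.
have ratP (x : R) : exists q : rat, `|x - ratr q| < k.+1%:R^-1.
  have [q] : exists q, ratr q \in `]x - k.+1%:R^-1, x + k.+1%:R^-1[.
    by apply: rat_in_itvoo; rewrite ltrD2l gtrN// invr_gt0.
  by rewrite in_itv/= => qx; exists q; rewrite distrC ltr_distl.
have /choice[q1 q1P] : forall j, exists q, `|(tnth t j).1 - ratr q| < k.+1%:R^-1.
  by move=> j; exact: ratP.
have /choice[q2 q2P] : forall j, exists q, `|(tnth t j).2 - ratr q| < k.+1%:R^-1.
  by move=> j; exact: ratP.
pose q : Q := ([ffun j => (q1 j, q2 j)], k).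
exists (pickle q) => //; rewrite /V pickleK; case: asboolP => [_ j|[]].
  by rewrite /= ffunE.
move=> s Bs; apply: rU => j.
have := Bs j; rewrite /= ffunE/= => -[s1 s2].
have dist2 (x y z : R) : `|x - z| < k.+1%:R^-1 -> `|y - z| < k.+1%:R^-1 ->
    `|x - y| < r / 2.
  rewrite (distrC y) => xz zy; have := ler_distD z x y.
  move: kr xz zy; set K := k.+1%:R^-1; set u := `|x - z|; set v := `|z - y|.
  by move=> *; lra.
by rewrite [ltRHS]splitr ltrD//; [exact: dist2 s1|exact: dist2 s2].
Qed.
Hint Extern 0 (measurable_fun _ Cn_of_real) =>
  solve [exact: measurable_Cn_of_real] : core.

Definition lebesgue_Cn : set 'rV[Cplx R]_n -> \bar R :=
  pushforward (product_power area_measure n) Cn_of_real.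

Let lebesgue_Cn0 : lebesgue_Cn set0 = 0%E.
Proof. exact: measure0. Qed.

Let lebesgue_Cn_ge0 A : (0 <= lebesgue_Cn A)%E.
Proof. exact: measure_ge0. Qed.

Let lebesgue_Cn_sigma_additive : semi_sigma_additive lebesgue_Cn.
Proof. exact: measure_semi_sigma_additive. Qed.

HB.instance Definition _ := isMeasure.Build _ _ _ lebesgue_Cn
  lebesgue_Cn0 lebesgue_Cn_ge0 lebesgue_Cn_sigma_additive.

End LebesgueCn.
Arguments lebesgue_Cn {R n}.

Section LpSpace.
Context {d} {T : measurableType d} {R : realType}.
Variable mu : {measure set T -> \bar R}.

Definition cmeasurable_fun (D : set T) (f : T -> Cplx R) :=
  measurable_fun D (fun x => complex.Re (f x)) /\
  measurable_fun D (fun x => complex.Im (f x)).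

Definition int_pow (D : set T) (p : R) (f : T -> Cplx R) : \bar R :=
  (\int[mu]_(x in D) (normc (f x) `^ p)%:E)%E.

(* Functions are total on T, but only their restriction to D matters. *)
Record LpFun (D : set T) (p : R) := MkLpFun {
  LpFun_fun :> T -> Cplx R;
  LpFun_measurable : cmeasurable_fun D LpFun_fun;
  LpFun_finite : (int_pow D p LpFun_fun < +oo)%E }.

HB.instance Definition _ D p := gen_eqMixin (LpFun D p).
HB.instance Definition _ D p := gen_choiceMixin (LpFun D p).

Definition LpFun_eq D p (f g : LpFun D p) :=
  `[< \forall x \ae mu, D x -> f x = g x >].

Lemma LpFun_eq_refl D p : reflexive (@LpFun_eq D p).
Proof. by move=> f; apply/asboolP/aeW. Qed.

Lemma LpFun_eq_sym D p : symmetric (@LpFun_eq D p).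
Proof.
by move=> f g; apply/idP/idP => /asboolP h; apply/asboolP;
  apply: filterS h => x /[apply].
Qed.

Lemma LpFun_eq_trans D p : transitive (@LpFun_eq D p).
Proof.
move=> f g h /asboolP gf /asboolP fh; apply/asboolP.
by apply: filterS2 gf fh => x gf fh Dx; rewrite gf// fh.
Qed.

Canonical LpFun_equiv D p :=
  EquivRel (@LpFun_eq D p) (@LpFun_eq_refl D p) (@LpFun_eq_sym D p)
    (@LpFun_eq_trans D p).

Local Open Scope quotient_scope.

(* mD and p01 do not affect the carrier; the metric instance needs them. *)
Definition Lp (D : set T) (p : R) (mD : measurable D) (p01 : 0 < p <= 1) : Type :=
  {eq_quot @LpFun_eq D p}.

Section Metric.
Variables (D : set T) (p : R) (mD : measurable D) (p01 : 0 < p <= 1).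

HB.instance Definition _ := Choice.on (Lp mD p01).
HB.instance Definition _ := EqQuotient.on (Lp mD p01).

Definition Lp_dist (F G : Lp mD p01) : R :=
  fine (int_pow D p (fun x => repr F x - repr G x)).

Let p0 : 0 < p. Proof. by case/andP: p01. Qed.

Let normc_ge0 (z : Cplx R) : 0 <= normc z.
Proof. by case: z => a b; exact: sqrtr_ge0. Qed.

Let normcD (y z : Cplx R) : normc (y + z) <= normc y + normc z.
Proof. by have := ler_normD y z; rewrite /Num.norm/= -rmorphD/= lecR. Qed.

Let normcN (z : Cplx R) : normc (- z) = normc z.
Proof. by case: z => a b /=; rewrite !sqrrN. Qed.

Let powR_addle (a b : R) : 0 <= a -> 0 <= b -> (a + b) `^ p <= a `^ p + b `^ p.
Proof.
move=> a0 b0; have [ab0|ab0] := eqVneq (a + b) 0.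
  by rewrite ab0 powR0 ?gt_eqF// addr_ge0// powR_ge0.
have {}ab0 : 0 < a + b by rewrite lt_def ab0 addr_ge0.
have powR_ge (x : R) : 0 <= x <= a + b ->
    (a + b) `^ p * (x / (a + b)) <= x `^ p.
  move=> /andP[x0 xab]; have [->|xn0] := eqVneq x 0.
    by rewrite mul0r mulr0 powR_ge0.
  have y0 : 0 < x / (a + b) by rewrite divr_gt0// lt_def xn0.
  have {2}-> : x = (a + b) * (x / (a + b)) by rewrite mulrC divfK// gt_eqF.
  rewrite powRM ?(ltW ab0) ?(ltW y0)// ler_wpM2l ?powR_ge0//.
  by rewrite ger1_powR ?y0 ?ler_pdivrMr ?mul1r//; case/andP: p01.
apply: le_trans (lerD (powR_ge a _) (powR_ge b _)); last 2 first.
- by rewrite a0 lerDl.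
- by rewrite b0 lerDr.
by rewrite -mulrDr -mulrDl divff ?mulr1// gt_eqF.
Qed.

Let measurable_pow (f : T -> Cplx R) : cmeasurable_fun D f ->
  measurable_fun D (fun x => (normc (f x) `^ p)%:E).
Proof.
move=> [mRe mIm]; apply/measurable_EFinP.
apply: (measurableT_comp (measurable_powR p)).
rewrite (_ : (fun x => _) = fun x =>
  Num.sqrt (complex.Re (f x) ^+ 2 + complex.Im (f x) ^+ 2)); last first.
  by apply/funext => x; case: (f x).
apply: measurableT_comp; last by apply: measurable_funD; exact: measurable_funX.
by apply: continuous_measurable_fun; exact: sqrt_continuous.
Qed.

Let cmeasurable_sub (f g : LpFun D p) :
  cmeasurable_fun D (fun x => f x - g x).
Proof.
have [[mRf mIf] [mRg mIg]] := (LpFun_measurable f, LpFun_measurable g).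
split.
- rewrite (_ : (fun x => _) = fun x => complex.Re (f x) - complex.Re (g x)).
    exact: measurable_funB.
  by apply/funext => x; case: (f x) => a b; case: (g x).
- rewrite (_ : (fun x => _) = fun x => complex.Im (f x) - complex.Im (g x)).
    exact: measurable_funB.
  by apply/funext => x; case: (f x) => a b; case: (g x).
Qed.

Let int_pow_ge0 (f : T -> Cplx R) : (0 <= int_pow D p f)%E.
Proof. by apply: integral_ge0 => x _; rewrite lee_fin powR_ge0. Qed.

Let int_powD (f g h : T -> Cplx R) :
  cmeasurable_fun D f -> cmeasurable_fun D g -> cmeasurable_fun D h ->
  (forall x, normc (f x) <= normc (g x) + normc (h x)) ->
  (int_pow D p f <= int_pow D p g + int_pow D p h)%E.
Proof.
move=> mf mg mh fgh; rewrite /int_pow -ge0_integralD//; last 4 first.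
- by move=> x _; rewrite lee_fin powR_ge0.
- exact: measurable_pow.
- by move=> x _; rewrite lee_fin powR_ge0.
- exact: measurable_pow.
apply: ge0_le_integral => //.
- by move=> x _; rewrite lee_fin powR_ge0.
- exact: measurable_pow.
- by apply: emeasurable_funD; exact: measurable_pow.
move=> x _; rewrite -EFinD lee_fin.
apply: le_trans (powR_addle (normc_ge0 _) (normc_ge0 _)).
by apply: ge0_ler_powR (fgh x); rewrite ?nnegrE ?(ltW p0)// ?addr_ge0.
Qed.

Let int_pow_sub_fin (f g : LpFun D p) :
  int_pow D p (fun x => f x - g x) \is a fin_num.
Proof.
rewrite ge0_fin_numE//; apply: (@le_lt_trans _ _ (int_pow D p f + int_pow D p g)%E).
  apply: int_powD => [|||x]; [exact: cmeasurable_sub|exact: LpFun_measurable..|].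
  by rewrite -(normcN (g x)); exact: normcD.
by apply: lte_add_pinfty; exact: LpFun_finite.
Qed.

Let Lp_distxx F : Lp_dist F F = 0.
Proof.
rewrite /Lp_dist /int_pow integral0_eq// => x _.
by rewrite subrr normc0 powR0 ?gt_eqF.
Qed.

Let Lp_dist_eq0 F G : Lp_dist F G = 0 -> F = G.
Proof.
move=> /eqP; rewrite fine_eq0 ?int_pow_sub_fin// => /eqP FG0.
rewrite -[F]reprK -[G]reprK; apply/eqmodP/asboolP.
have := measurable_pow (cmeasurable_sub (repr F) (repr G)).
move=> /(ae_eq_integral_abs mu mD)[+ _].
under eq_integral do rewrite gee0_abs ?lee_fin ?powR_ge0//.
move=> /(_ FG0); apply: filterS => x /[apply] /= -[].
by move=> /powR_eq0_eq0/eq0_normc/eqP; rewrite subr_eq0 => /eqP.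
Qed.

Let Lp_dist_sym F G : Lp_dist F G = Lp_dist G F.
Proof.
rewrite /Lp_dist /int_pow; congr fine; apply: eq_integral => x _.
by rewrite -normcN opprB.
Qed.

Let Lp_dist_triangle G F H : Lp_dist F H <= Lp_dist F G + Lp_dist G H.
Proof.
rewrite /Lp_dist -fineD ?int_pow_sub_fin//; apply: fine_le.
- exact: int_pow_sub_fin.
- by rewrite (fin_numD (int_pow _ _ _)) !int_pow_sub_fin.
apply: int_powD => [|||x]; [exact: cmeasurable_sub..|].
by rewrite -(subrKA (repr G x)); exact: normcD.
Qed.

HB.instance Definition _ := isMetric.Build R (Lp mD p01)
  Lp_distxx Lp_dist_eq0 Lp_dist_sym Lp_dist_triangle.

End Metric.

End LpSpace.

Local Open Scope quotient_scope.

Section Bergman.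
Context {R : realType} {n : nat}.

(* differentiability over the field Cplx R, i.e. with a C-linear differential *)
Definition holomorphic_on (Omega : set 'rV[Cplx R]_n)
    (f : 'rV[Cplx R]_n -> Cplx R) :=
  forall z, Omega z -> differentiable f z.

Section Ap.
Variables (Omega : set 'rV[Cplx R]_n) (p : R).
Hypotheses (oOmega : open Omega) (p01 : 0 < p <= 1).

Local Notation LpOmega := (Lp lebesgue_Cn (open_measurable_Cn oOmega) p01).

Definition Ap : set LpOmega :=
  [set F | exists2 f : LpFun lebesgue_Cn Omega p,
     holomorphic_on Omega f & F = \pi_(LpOmega) f].

End Ap.

End Bergman.
Arguments Ap {R n Omega p} oOmega p01.

Notation LpOmega oOmega p01 :=
  (Lp lebesgue_Cn (open_measurable_Cn oOmega) p01).

(* Main.v *)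
Require Import Defs.
From mathcomp Require Import all_boot all_order all_algebra complex.
From mathcomp Require Import lra ring.
From mathcomp Require Import all_classical all_reals all_analysis.
From mathcomp Require Import measurable_realfun.

(** Suppose that [Omega] has a measurable subset [E] whose complement [F] in [Omega]
    has the same measure, and such that the integral of [normc g `^ p] over [F] is at
    most its integral over [E], for all holomorphic [g]. Let [f] be the indicator
    function of [E]. For holomorphic [g], the distance from [f] to [g] is the integral
    of [normc (1 - g) `^ p] over [E] plus that of [normc g `^ p] over [F]. Since
    [1 - g] is holomorphic, this is at least the integral over [F] of
    [normc (1 - g) `^ p + normc g `^ p], where the integrand is at least [1] because
    [p <= 1]. So the distance is at least the measure of [F], and the constants
    [0] and [1] attain this bound: [f] has two best approximations
    ([not_chebyshev_of_halves]).

    It remains to construct [E] ([balanced_open]). In the plane, split the disc of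
    radius [sqrt 2 * r] into the disc of radius [r] and an annulus of the same area.
    As [normc g `^ p] is subharmonic, its mean over circles increases with the radius,
    and the annulus has the larger integral ([disc_inequality]). In several variables,
    a product of such a disc with any set in the other coordinates is split in the same
    way, by Fubini's theorem ([balanced_tile]). Disjoint countable unions and null sets
    preserve the property. An open set of finite measure is, up to a null set, a
    disjoint union of polydiscs: those inscribed in the cells of a fine grid cover a
    fixed proportion of it and leave an open set, on which the construction is repeated
    ([packing_step]).

    The inequality on discs is proved without integral means. The sum [V] of
    [normc g `^ p] over [N] equally spaced rotations of a point has the same integral
    as [N] times [normc g `^ p], over a disc or an annulus. It nearly depends on
    the radius alone when [N] is large ([rotation_average_osc]), and it satisfies the
    maximum principle ([sum_maximum_principle]), hence nearly increases with the radius.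
    The maximum principle for such sums comes from that for one holomorphic function,
    a product of large powers of the summands, by the inequality of arithmetic and
    geometric means.

    The maximum modulus principle itself ([maximum_modulus_disc]) rests on a Cauchy
    estimate on squares with a constant other than [1]
    ([crude_cauchy_estimate]): applied to powers of a function, it becomes sharp. That
    estimate only uses that the integral of a holomorphic function around a square
    vanishes, which is Goursat's lemma, proved by bisection ([goursat]) from the
    Cauchy-Riemann equations. *)

Set Implicit Arguments.
Unset Strict Implicit.
Unset Printing Implicit Defensive.

Import Order.TTheory GRing.Theory Num.Theory.
Import numFieldNormedType.Exports.
Import ComplexField.Normc.

Local Open Scope classical_set_scope.
Local Open Scope ring_scope.

(** * Goursat's lemma on squares *)

Section Goursat.
Context {R : realType}.
Implicit Types (a b c s h x y : R) (f g : R -> R) (A B : R * R -> R).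

Local Notation mu := (@lebesgue_measure R).
Local Notation "'\int_' a ^ b f" := (\int[mu]_(t in `[a, b]) f t)
  (at level 10, a at level 9, b at level 9, f at level 9).

Lemma integrable_continuous_itv f a b :
  {in `[a, b], continuous f} -> mu.-integrable `[a, b] (EFin \o f).
Proof.
move=> cf; apply: continuous_compact_integrable; first exact: segment_compact.
by apply: continuous_in_subspaceT => x; rewrite inE => /cf.
Qed.

Lemma Rintegral_itv_split f a c b : a <= c <= b ->
  {in `[a, b], continuous f} -> \int_ a ^ b f = \int_ a ^ c f + \int_ c ^ b f.
Proof.
move=> /andP[ac cb] cf.
rewrite -(@Rintegral_itv_obnd_cbnd R c); last first.
  apply: integrableS (integrable_continuous_itv cf) => //.
  by apply: subset_itv; rewrite bnd_simp.
have := Rintegral_itvB (integrable_continuous_itv cf).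
by move=> /(_ c); rewrite !bnd_simp => <- //; rewrite addrC subrK.
Qed.

Lemma Rintegral_itv_cst c a b : a <= b -> \int_ a ^ b (cst c) = c * (b - a).
Proof.
move=> ab; rewrite Rintegral_cst//= lebesgue_measure_itv/= lte_fin.
by case: ltP => //= ba; rewrite (_ : b = a) ?subrr//; apply/eqP; rewrite eq_le ab ba.
Qed.

Lemma Rintegral_itv_le f a b c : a <= b -> {in `[a, b], continuous f} ->
  (forall t, a <= t <= b -> f t <= c) -> \int_ a ^ b f <= c * (b - a).
Proof.
move=> ab cf fc; rewrite -Rintegral_itv_cst//; apply: le_Rintegral; first exact: measurable_itv.
- exact: integrable_continuous_itv.
- by apply: integrable_continuous_itv => t _; exact: cst_continuous.
- by move=> t; rewrite /= in_itv/= => /fc.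
Qed.

Lemma Rintegral_itv_ge f a b c : a <= b -> {in `[a, b], continuous f} ->
  (forall t, a <= t <= b -> c <= f t) -> c * (b - a) <= \int_ a ^ b f.
Proof.
move=> ab cf fc; rewrite -Rintegral_itv_cst//; apply: le_Rintegral; first exact: measurable_itv.
- by apply: integrable_continuous_itv => t _; exact: cst_continuous.
- exact: integrable_continuous_itv.
- by move=> t; rewrite /= in_itv/= => /fc.
Qed.

Lemma Rintegral_itv_near f a b c e : a <= b -> {in `[a, b], continuous f} ->
  (forall t, a <= t <= b -> `|f t - c| <= e) ->
  `|\int_ a ^ b f - c * (b - a)| <= e * (b - a).
Proof.
move=> ab cf fc; rewrite ler_norml lerBrDr lerBlDr -mulNr -!mulrDl.
apply/andP; split.
  apply: Rintegral_itv_ge => // t /fc.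
  by rewrite ler_norml lerBrDr => /andP[].
apply: Rintegral_itv_le => // t /fc.
by rewrite ler_norml lerBlDr => /andP[].
Qed.

Definition square x y s : set (R * R) :=
  [set z | x <= z.1 <= x + s /\ y <= z.2 <= y + s].

(** The integral of [A dx + B dy] along the positively oriented boundary of
    [square x y s]. *)
Definition boundary_integral A B x y s :=
  \int_ x ^ (x + s) (fun t => A (t, y)) - \int_ x ^ (x + s) (fun t => A (t, y + s))
  + \int_ y ^ (y + s) (fun t => B (x + s, t)) - \int_ y ^ (y + s) (fun t => B (x, t)).

Lemma continuous_horizontal A x y s h : (forall z, square x y s z -> {for z, continuous A}) ->
  y <= h <= y + s -> {in `[x, x + s], continuous (fun t => A (t, h))}.
Proof.
move=> cA yh t; rewrite in_itv/= => xt.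
have ct : {for t, continuous (fun t => (t, h))}.
  exact: (@cvg_pair _ _ _ (nbhs t) (nbhs t) (nbhs h) _ _ _ id (cst h) cvg_id (cvg_cst h)).
by apply: (continuous_comp ct); exact: cA.
Qed.

Lemma continuous_vertical A x y s h : (forall z, square x y s z -> {for z, continuous A}) ->
  x <= h <= x + s -> {in `[y, y + s], continuous (fun t => A (h, t))}.
Proof.
move=> cA xh t; rewrite in_itv/= => yt.
have ct : {for t, continuous (fun t => (h, t))}.
  exact: (@cvg_pair _ _ _ (nbhs t) (nbhs h) (nbhs t) _ _ _ (cst h) id (cvg_cst h) cvg_id).
by apply: (continuous_comp ct); exact: cA.
Qed.

(** The integrals along the four inner sides cancel in pairs. *)
Lemma boundary_integral_quarter A B x y h : 0 <= h ->
  (forall z, square x y (h + h) z -> {for z, continuous A}) ->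
  (forall z, square x y (h + h) z -> {for z, continuous B}) ->
  boundary_integral A B x y (h + h) =
    (boundary_integral A B x y h + boundary_integral A B (x + h) y h) +
    (boundary_integral A B x (y + h) h + boundary_integral A B (x + h) (y + h) h).
Proof.
move=> h0 cA cB; rewrite /boundary_integral.
have hA k : y <= k <= y + (h + h) -> \int_ x ^ (x + (h + h)) (fun t => A (t, k)) =
  \int_ x ^ (x + h) (fun t => A (t, k)) + \int_ (x + h) ^ (x + h + h) (fun t => A (t, k)).
  move=> yk; rewrite -(addrA x); apply: Rintegral_itv_split; first by lra.
  exact: (continuous_horizontal cA).
have hB k : x <= k <= x + (h + h) -> \int_ y ^ (y + (h + h)) (fun t => B (k, t)) =
  \int_ y ^ (y + h) (fun t => B (k, t)) + \int_ (y + h) ^ (y + h + h) (fun t => B (k, t)).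
  move=> xk; rewrite -(addrA y); apply: Rintegral_itv_split; first by lra.
  exact: (continuous_vertical cB).
rewrite !hA ?hB; [|lra..].
rewrite -!(addrA x h h) -!(addrA y h h).
by lra.
Qed.

Lemma boundary_integral_bounded A B x y s M : 0 <= s ->
  (forall z, square x y s z -> {for z, continuous A}) ->
  (forall z, square x y s z -> {for z, continuous B}) ->
  (forall z, square x y s z -> `|A z| <= M) ->
  (forall z, square x y s z -> `|B z| <= M) ->
  `|boundary_integral A B x y s| <= 4 * (M * s).
Proof.
move=> s0 cA cB AM BM.
have small f a : {in `[a, a + s], continuous f} ->
    (forall t, a <= t <= a + s -> `|f t| <= M) -> `|\int_ a ^ (a + s) f| <= M * s.
  move=> cf fM; have := @Rintegral_itv_near f a (a + s) 0 M.
  rewrite mul0r subr0 [a + s - a]addrAC subrr add0r; apply => //; first by rewrite lerDl.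
  by move=> t /fM; rewrite subr0.
have [xl xr] : x <= x <= x + s /\ x <= x + s <= x + s by split; apply/andP; split; rewrite ?lerDl.
have [yl yr] : y <= y <= y + s /\ y <= y + s <= y + s by split; apply/andP; split; rewrite ?lerDl.
have I1 : `|\int_ x ^ (x + s) (fun t => A (t, y))| <= M * s.
  by apply: small; [exact: (continuous_horizontal cA)|move=> t xt; exact: AM].
have I2 : `|\int_ x ^ (x + s) (fun t => A (t, y + s))| <= M * s.
  by apply: small; [exact: (continuous_horizontal cA)|move=> t xt; exact: AM].
have I3 : `|\int_ y ^ (y + s) (fun t => B (x + s, t))| <= M * s.
  by apply: small; [exact: (continuous_vertical cB)|move=> t xt; exact: BM].
have I4 : `|\int_ y ^ (y + s) (fun t => B (x, t))| <= M * s.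
  by apply: small; [exact: (continuous_vertical cB)|move=> t xt; exact: BM].
rewrite /boundary_integral; move: (M * s) I1 I2 I3 I4 => q.
set i1 := \int_ x ^ (x + s) (fun t => A (t, y)).
set i2 := \int_ x ^ (x + s) (fun t => A (t, y + s)).
set i3 := \int_ y ^ (y + s) (fun t => B (x + s, t)).
set i4 := \int_ y ^ (y + s) (fun t => B (x, t)).
by clear; rewrite !ler_norml; lra.
Qed.

(** If the four quarters of a square always add up to it, one of them carries
    at least a quarter of the absolute value; iterating, the squares shrink to a
    point at which [phi] cannot be negligible with respect to the area. *)
Lemma square_bisection (phi : R -> R -> R -> R) x0 y0 s : 0 <= s ->
  (forall x y h, 0 <= h -> square x y (h + h) `<=` square x0 y0 s ->
    phi x y (h + h) = (phi x y h + phi (x + h) y h) +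
                      (phi x (y + h) h + phi (x + h) (y + h) h)) ->
  (forall z, square x0 y0 s z -> forall e : R, 0 < e ->
    exists2 d : R, 0 < d &
    forall x y h, 0 <= h < d -> square x y h z ->
      square x y h `<=` square x0 y0 s -> `|phi x y h| <= e * h ^+ 2) ->
  phi x0 y0 s = 0.
Proof.
move=> s0 phiD phi_small.
pose good (n : nat) (u : R * R) := square u.1 u.2 (s / 2 ^+ n) `<=` square x0 y0 s /\
  `|phi x0 y0 s| <= 4 ^+ n * `|phi u.1 u.2 (s / 2 ^+ n)|.
have halve n : s / 2 ^+ n = s / 2 ^+ n.+1 + s / 2 ^+ n.+1.
  by rewrite exprS invfM; set q := (2 ^+ n)^-1; lra.
have hn0 n : 0 <= s / 2 ^+ n by rewrite divr_ge0 ?exprn_ge0.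
(* the quarter with the largest absolute value, and its position in its parent *)
have step n u : good n u -> exists v, good n.+1 v /\
    (u.1 <= v.1 /\ v.1 + s / 2 ^+ n.+1 <= u.1 + s / 2 ^+ n) /\
    (u.2 <= v.2 /\ v.2 + s / 2 ^+ n.+1 <= u.2 + s / 2 ^+ n).
  move: u => [x y]/= []/=; rewrite halve; set h := s / 2 ^+ n.+1.
  have h0 : 0 <= h by exact: hn0.
  move=> sub; rewrite phiD// => big.
  have sub4 v : (x <= v.1 /\ v.1 + h <= x + (h + h)) ->
      (y <= v.2 /\ v.2 + h <= y + (h + h)) -> square v.1 v.2 h `<=` square x0 y0 s.
    by move=> ? ? z [? ?]; apply: sub; split; lra.
  have le4 (p1 p2 p3 p4 : R) : `|phi x0 y0 s| <= 4 ^+ n * `|p1 + p2 + (p3 + p4)| ->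
      [\/ `|phi x0 y0 s| <= 4 ^+ n.+1 * `|p1|, `|phi x0 y0 s| <= 4 ^+ n.+1 * `|p2|,
      `|phi x0 y0 s| <= 4 ^+ n.+1 * `|p3| | `|phi x0 y0 s| <= 4 ^+ n.+1 * `|p4|].
    move=> /le_trans/(_ (ler_wpM2l (exprn_ge0 n (ler0n R 4))
      (le_trans (ler_normD _ _) (lerD (ler_normD _ _) (ler_normD _ _))))).
    rewrite !mulrDr exprS -!mulrA.
    set q := 4 ^+ n; set c := `|phi _ _ _|.
    set a1 := `|p1|; set a2 := `|p2|; set a3 := `|p3|; set a4 := `|p4| => bd.
    case: (lerP c (4 * (q * a1))) => ?; first by constructor 1.
    case: (lerP c (4 * (q * a2))) => ?; first by constructor 2.
    case: (lerP c (4 * (q * a3))) => ?; first by constructor 3.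
    case: (lerP c (4 * (q * a4))) => ?; first by constructor 4.
    by lra.
  case: (le4 _ _ _ _ big) => ?;
    [exists (x, y)|exists (x + h, y)|exists (x, y + h)|exists (x + h, y + h)];
    (split; [split => //; apply: sub4 => /=; lra|rewrite /=; lra]).
have [F [F0 FS]] : {F : nat -> R * R | F 0%N = (x0, y0) /\ forall n, good n (F n) /\
    ((F n).1 <= (F n.+1).1 /\ (F n.+1).1 + s / 2 ^+ n.+1 <= (F n).1 + s / 2 ^+ n) /\
    ((F n).2 <= (F n.+1).2 /\ (F n.+1).2 + s / 2 ^+ n.+1 <= (F n).2 + s / 2 ^+ n)}.
  apply: cid.
  have /choice[nxt nxtP] : forall nu : nat * (R * R), exists v, good nu.1 nu.2 ->
      good nu.1.+1 v /\
      (nu.2.1 <= v.1 /\ v.1 + s / 2 ^+ nu.1.+1 <= nu.2.1 + s / 2 ^+ nu.1) /\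
      (nu.2.2 <= v.2 /\ v.2 + s / 2 ^+ nu.1.+1 <= nu.2.2 + s / 2 ^+ nu.1).
    move=> [n u]/=; have [/step[v ?]|?] := pselect (good n u); first by exists v.
    by exists u.
  pose fix F n := if n is n'.+1 then nxt (n', F n') else (x0, y0).
  have gF n : good n (F n).
    elim: n => [|n IH]; last by have [] := nxtP (n, F n) IH.
    by split; rewrite /= ?expr0 ?divr1 ?mul1r.
  exists F; split => // n; split; first exact: gF.
  by have [] := nxtP (n, F n) (gF n).
(* the corners converge to a point of all the squares *)
have nested (u : nat -> R) : (forall n, u n <= u n.+1 /\
    u n.+1 + s / 2 ^+ n.+1 <= u n + s / 2 ^+ n) ->
    exists l, forall n, u n <= l <= u n + s / 2 ^+ n.
  move=> uS; have uM m n : (m <= n)%N -> u m <= u n /\ u n <= u m + s / 2 ^+ m.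
    move=> mn; have : u m <= u n /\ u n + s / 2 ^+ n <= u m + s / 2 ^+ m.
      elim: n mn => [|n IH]; first by rewrite leqn0 => /eqP->.
      rewrite leq_eqVlt => /predU1P[->//|]; rewrite ltnS => /IH[].
      by have [] := uS n; lra.
    by have := hn0 n; lra.
  have ub n : ubound (range u) (u n + s / 2 ^+ n).
    move=> _ [m _ <-]; case: (leqP n m) => [/uM[]//|/ltnW/uM[+ _]].
    by have := hn0 n; lra.
  have hs : has_sup (range u).
    by split; [exists (u 0%N); exists 0%N|exists (u 0%N + s / 2 ^+ 0)].
  exists (sup (range u)) => n; apply/andP; split.
    by apply: sup_upper_bound => //; exists n.
  by apply: ge_sup => //; case: hs.
have [lx lxP] := nested (fun n => (F n).1) (fun n => (FS n).2.1).
have [ly lyP] := nested (fun n => (F n).2) (fun n => (FS n).2.2).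
have inS n : square (F n).1 (F n).2 (s / 2 ^+ n) (lx, ly) by split; [exact: lxP|exact: lyP].
have in0 : square x0 y0 s (lx, ly).
  by have := inS 0%N; rewrite F0 expr0 divr1.
apply/eqP; rewrite -normr_le0; apply/ler_addgt0Pr => e e0; rewrite add0r.
have [//|d d0 dP] := phi_small _ in0 (e / (1 + s ^+ 2)).
  by rewrite divr_gt0// ltr_pwDl// sqr_ge0.
have [n nd] : exists n, s / 2 ^+ n < d.
  have /cvgrPdist_lt/(_ d d0)[n _ /(_ n (leqnn n))] :
      (fun n => s * (2^-1) ^+ n) @ \oo --> (0 : R).
    rewrite -[X in _ --> X](mulr0 s); apply: cvgMr; apply: cvg_expr.
    by rewrite ger0_norm ?invf_lt1// ltr1n.
  rewrite sub0r normrN => lt; exists n; rewrite -exprVn.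
  exact: le_lt_trans (ler_norm _) lt.
have [[sub big] _] := FS n.
apply: (le_trans big).
have /(ler_wpM2l (exprn_ge0 n (ler0n R 4))) := dP _ _ _ (introT andP (conj (hn0 n) nd)) (inS n) sub.
move=> /le_trans; apply.
have -> : (4 : R) = 2 ^+ 2 by rewrite expr2 -natrM.
rewrite mulrCA -exprM mulnC exprM -exprMn [2 ^+ n * _]mulrC divfK ?expf_neq0//.
rewrite mulrAC ler_pdivrMr ?ltr_pwDl ?sqr_ge0// ler_pM2l//.
by rewrite lerDr.
Qed.

(** Where [A dx + B dy] is closed in the sense of first derivatives, its
    integral around a square of side [h] is [o(h ^+ 2)], since that of its
    affine approximation vanishes. *)
Theorem goursat A B x0 y0 s : 0 <= s ->
  (forall z, square x0 y0 s z -> {for z, continuous A}) ->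
  (forall z, square x0 y0 s z -> {for z, continuous B}) ->
  (forall z, square x0 y0 s z -> exists a1 a2 b2, forall e : R, 0 < e ->
    exists2 d : R, 0 < d &
    forall w, `|w.1 - z.1| < d -> `|w.2 - z.2| < d ->
     `|A w - A z - (a1 * (w.1 - z.1) + a2 * (w.2 - z.2))| <=
       e * (`|w.1 - z.1| + `|w.2 - z.2|) /\
     `|B w - B z - (a2 * (w.1 - z.1) + b2 * (w.2 - z.2))| <=
       e * (`|w.1 - z.1| + `|w.2 - z.2|)) ->
  boundary_integral A B x0 y0 s = 0.
Proof.
move=> s0 cA cB dAB; apply: square_bisection => // [x y h h0 sub|z /dAB].
  by apply: boundary_integral_quarter => // z /sub; [exact: cA|exact: cB].
move=> [a1 [a2 [b2 zP]]] e e0.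
have [|d d0 dP] := zP (e / 8); first by rewrite divr_gt0.
exists d => // x y h /andP[h0 hd] [zx zy] sub.
have cA' w : square x y h w -> {for w, continuous A} by move=> /sub/cA.
have cB' w : square x y h w -> {for w, continuous B} by move=> /sub/cB.
have nearP w : square x y h w ->
   `|A w - A z - (a1 * (w.1 - z.1) + a2 * (w.2 - z.2))| <= e / 4 * h /\
   `|B w - B z - (a2 * (w.1 - z.1) + b2 * (w.2 - z.2))| <= e / 4 * h.
  move=> [wx wy].
  have n1 : `|w.1 - z.1| <= h by rewrite ler_norml; lra.
  have n2 : `|w.2 - z.2| <= h by rewrite ler_norml; lra.
  have [] := dP w (le_lt_trans n1 hd) (le_lt_trans n2 hd).
  have : e / 8 * (`|w.1 - z.1| + `|w.2 - z.2|) <= e / 4 * h.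
    rewrite [leRHS](_ : _ = e / 8 * (h + h)); last by lra.
    by rewrite ler_pM2l ?divr_gt0// lerD.
  by move=> le /le_trans/(_ le) ? /le_trans/(_ le).
(* opposite sides are compared: the increment of [A] between them is close to
   [a2 * h], that of [B] to the same value, and the two contributions cancel *)
have horiz : `|\int_ x ^ (x + h) (fun t => A (t, y) - A (t, y + h)) + a2 * h * h|
    <= e / 2 * h * h.
  have := @Rintegral_itv_near (fun t => A (t, y) - A (t, y + h)) x (x + h)
    (- (a2 * h)) (e / 2 * h).
  rewrite (_ : x + h - x = h); last by lra.
  rewrite mulNr !opprK; apply; first by rewrite lerDl.
    move=> t tx; apply: cvgB.
      by apply: (continuous_horizontal cA') tx; lra.
    by apply: (continuous_horizontal cA') tx; lra.
  move=> t xt; have [|+ _] := nearP (t, y); first by split => //=; lra.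
  have [|+ _] := nearP (t, y + h); first by split => //=; lra.
  rewrite /= !ler_norml; set u := A (t, y); set v := A (t, y + h).
  by rewrite !mulrBr mulrDr; set k := e / 4 * h; rewrite (_ : e / 2 * h = k + k);
     [lra|rewrite /k; lra].
have vert : `|\int_ y ^ (y + h) (fun t => B (x + h, t) - B (x, t)) - a2 * h * h|
    <= e / 2 * h * h.
  have := @Rintegral_itv_near (fun t => B (x + h, t) - B (x, t)) y (y + h)
    (a2 * h) (e / 2 * h).
  rewrite (_ : y + h - y = h); last by lra.
  apply; first by rewrite lerDl.
    move=> t tx; apply: cvgB.
      by apply: (continuous_vertical cB') tx; lra.
    by apply: (continuous_vertical cB') tx; lra.
  move=> t xt; have [|_ +] := nearP (x, t); first by split => //=; lra.
  have [|_ +] := nearP (x + h, t); first by split => //=; lra.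
  rewrite /= !ler_norml; set u := B (x, t); set v := B (x + h, t).
  by rewrite !mulrBr mulrDr; set k := e / 4 * h; rewrite (_ : e / 2 * h = k + k);
     [lra|rewrite /k; lra].
rewrite /boundary_integral -addrA -RintegralB//; last 2 first.
  - by apply: integrable_continuous_itv; apply: (continuous_horizontal cA'); lra.
  - by apply: integrable_continuous_itv; apply: (continuous_horizontal cA'); lra.
rewrite -RintegralB//; last 2 first.
  - by apply: integrable_continuous_itv; apply: (continuous_vertical cB'); lra.
  - by apply: integrable_continuous_itv; apply: (continuous_vertical cB'); lra.
move: horiz vert; rewrite expr2 mulrA !ler_norml.
set u := \int_ x ^ (x + h) (fun t => A (t, y) - A (t, y + h)).
set v := \int_ y ^ (y + h) (fun t => B (x + h, t) - B (x, t)).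
set p := a2 * h * h; rewrite (_ : e * h * h = e / 2 * h * h + e / 2 * h * h); last by lra.
by set q := e / 2 * h * h; lra.
Qed.

End Goursat.

(** * The modulus and the topology of the complex plane *)

Section ComplexPlane.
Context {R : realType}.
Implicit Types (z w : Cplx R) (u v : R * R).

Definition to_cplx (u : R * R) : Cplx R := Complex u.1 u.2.

Lemma normc_ge0 z : 0 <= normc z.
Proof. by case: z => a b; exact: sqrtr_ge0. Qed.

Lemma normcD z w : normc (z + w) <= normc z + normc w.
Proof. by have := ler_normD z w; rewrite /Num.norm/= -rmorphD/= lecR. Qed.

Lemma normc_sub z w : normc (z - w) = normc (w - z).
Proof. by case: z => a b; case: w => c d /=; rewrite -(opprB c) -(opprB d) !sqrrN. Qed.

Lemma normc_dist z w : `|normc z - normc w| <= normc (z - w).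
Proof.
have := normcD (z - w) w; have := normcD (w - z) z; rewrite !subrK (normc_sub w).
by rewrite ler_norml; lra.
Qed.

Lemma normcX z n : normc (z ^+ n) = normc z ^+ n.
Proof. by elim: n => [|n IH]; rewrite ?expr0 ?normc1// !exprS normcM IH. Qed.

Lemma normc_sqr z : normc z ^+ 2 = complex.Re z ^+ 2 + complex.Im z ^+ 2.
Proof. by case: z => a b; rewrite /= sqr_sqrtr// addr_ge0// sqr_ge0. Qed.

Lemma normc_eq0 z : (normc z == 0) = (z == 0).
Proof. by apply/eqP/eqP => [/eq0_normc//|->]; exact: normc0. Qed.

Lemma normc_gt0 z : (0 < normc z) = (z != 0).
Proof. by rewrite lt_def normc_ge0 andbT normc_eq0. Qed.

Lemma Re_le_normc z : `|complex.Re z| <= normc z.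
Proof.
by case: z => a b /=; rewrite -sqrtr_sqr ler_wsqrtr// lerDl sqr_ge0.
Qed.

Lemma Im_le_normc z : `|complex.Im z| <= normc z.
Proof.
by case: z => a b /=; rewrite -sqrtr_sqr ler_wsqrtr// lerDr sqr_ge0.
Qed.

Lemma normc_le_sum z : normc z <= `|complex.Re z| + `|complex.Im z|.
Proof.
case: z => a b /=; rewrite -[leRHS]ger0_norm ?addr_ge0// -sqrtr_sqr ler_wsqrtr// sqrrD.
by rewrite !real_normK ?num_real// lerD2r lerDl mulrn_wge0// mulr_ge0.
Qed.

Lemma nbhs_normcP z (P : set (Cplx R)) :
  nbhs z P <-> exists2 d : R, 0 < d & forall w, normc (w - z) < d -> P w.
Proof.
split.
  move=> /nbhs_ballP[[d i]]/=; rewrite ltcE/= => /andP[/eqP-> d0] dP.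
  exists d => // w wz; apply: dP; change ((normc (z - w))%:C%C < d%:C%C).
  by rewrite ltcR normc_sub.
move=> [d d0 dP]; apply/nbhs_ballP; exists d%:C%C; first by rewrite /= ltcR.
move=> w wz; apply: dP; rewrite normc_sub -ltcR; exact: wz.
Qed.

Lemma continuous_normc : continuous (@normc R : Cplx R -> R).
Proof.
move=> z P /nbhs_ballP[e /= e0 eP]; apply/nbhs_normcP; exists e => // w wz.
apply: eP; rewrite /ball/=.
by apply: le_lt_trans (normc_dist _ _) _; rewrite normc_sub.
Qed.

Lemma continuous_Re : continuous (@complex.Re R : Cplx R -> R).
Proof.
move=> z P /nbhs_ballP[e /= e0 eP]; apply/nbhs_normcP; exists e => // w wz.
apply: eP; rewrite /ball/=.
apply: le_lt_trans wz; rewrite normc_sub; apply: le_trans (Re_le_normc _).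
by case: z; case: w.
Qed.

Lemma continuous_Im : continuous (@complex.Im R : Cplx R -> R).
Proof.
move=> z P /nbhs_ballP[e /= e0 eP]; apply/nbhs_normcP; exists e => // w wz.
apply: eP; rewrite /ball/=.
apply: le_lt_trans wz; rewrite normc_sub; apply: le_trans (Im_le_normc _).
by case: z; case: w.
Qed.

Lemma continuous_to_cplx : continuous to_cplx.
Proof.
move=> u P /nbhs_normcP[d d0 dP].
have d20 : 0 < d / 2 by rewrite divr_gt0.
exists (ball u.1 (d / 2), ball u.2 (d / 2)) => /=.
  by split; exact: nbhsx_ballx.
move=> v [/= v1 v2]; apply: dP; apply: le_lt_trans (normc_le_sum _) _.
by rewrite [ltRHS]splitr ltrD//= distrC.
Qed.

End ComplexPlane.

(** * Complex differentiability in one variable *)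

(** Complex differentiability of functions of one variable, as an opaque name
    that shields [differentiable] from costly unifications. *)
Definition cdiff {R : realType} (G : Cplx R -> Cplx R) (z : Cplx R) : Prop :=
  differentiable G z.

Section ComplexDifferentiability.
Context {R : realType}.
Implicit Types (G K : Cplx R -> Cplx R) (z : Cplx R).

Lemma cdiff_cst c z : cdiff (fun=> c) z.
Proof. exact: (@differentiable_cst (Cplx R) (Cplx R) (Cplx R) c z). Qed.

Lemma cdiff_id z : cdiff id z.
Proof. by apply/derivable1_diffP; exact: (@derivable_id (Cplx R) (Cplx R) z 1). Qed.

Lemma cdiffD G K z : cdiff G z -> cdiff K z -> cdiff (fun w => G w + K w) z.
Proof. by move=> dG dK; exact: (@differentiableD (Cplx R) (Cplx R) (Cplx R) G K z dG dK). Qed.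

Lemma cdiffB G K z : cdiff G z -> cdiff K z -> cdiff (fun w => G w - K w) z.
Proof. by move=> dG dK; exact: (@differentiableB (Cplx R) (Cplx R) (Cplx R) G K z dG dK). Qed.

Lemma cdiffM G K z : cdiff G z -> cdiff K z -> cdiff (fun w => G w * K w) z.
Proof. by move=> dG dK; exact: (@differentiableM (Cplx R) (Cplx R) G K z dG dK). Qed.

Lemma cdiff_comp G K z : cdiff G z -> cdiff K (G z) -> cdiff (fun w => K (G w)) z.
Proof.
by move=> dG dK; exact: (@differentiable_comp _ (Cplx R) (Cplx R) (Cplx R) G K z dG dK).
Qed.

Lemma cdiffV z : z != 0 -> cdiff (fun w => w^-1) z.
Proof. by move=> z0; exact: (@differentiableV (Cplx R) (Cplx R) id z (cdiff_id z) z0). Qed.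

Lemma cdiffX G n z : cdiff G z -> cdiff (fun w => G w ^+ n) z.
Proof.
move=> dG; elim: n => [|n IH]; first exact: cdiff_cst.
rewrite (_ : (fun w => _) = fun w => G w * G w ^+ n); last first.
  by apply/funext => w; rewrite exprS.
exact: cdiffM.
Qed.

Lemma cdiff_prod (I : Type) (r : seq I) (P : pred I) (F : I -> Cplx R -> Cplx R) z :
  (forall i, P i -> cdiff (F i) z) -> cdiff (fun w => \prod_(i <- r | P i) F i w) z.
Proof.
move=> dF; elim: r => [|i r IH].
  rewrite (_ : (fun w => _) = fun=> 1); first exact: cdiff_cst.
  by apply/funext => w; rewrite big_nil.
rewrite (_ : (fun w => _) = fun w => (if P i then F i w else 1) *
    \prod_(i <- r | P i) F i w); last first.
  by apply/funext => w; rewrite big_cons; case: ifP => //; rewrite mul1r.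
apply: cdiffM IH; case: (P i) (dF i) => [/(_ isT)//|_]; exact: cdiff_cst.
Qed.

Lemma cdiff_near G K z : (\near z, G z = K z) -> cdiff G z -> cdiff K z.
Proof.
move=> GK dG; have dG' := (@derivable1_diffP (Cplx R) (Cplx R) G z).2 dG.
apply: (@derivable1_diffP (Cplx R) (Cplx R) K z).1.
exact: (@near_eq_derivable (Cplx R) (Cplx R) (Cplx R) G K z 1 GK dG').
Qed.

Lemma cdiff_line (V : normedModType (Cplx R)) (g : V -> Cplx R) (a v : V) z :
  differentiable g (a + z *: v) -> cdiff (fun w => g (a + w *: v)) z.
Proof.
move=> dg; have dl : differentiable (fun w : Cplx R => a + w *: v) z.
  apply: (@differentiableD (Cplx R) (Cplx R) V (fun=> a) (fun w => w *: v)).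
    exact: (@differentiable_cst (Cplx R) (Cplx R) V a z).
  exact: (@differentiableZl (Cplx R) (Cplx R) V id v z (cdiff_id z)).
exact: (@differentiable_comp (Cplx R) (Cplx R) V (Cplx R) _ g z dl dg).
Qed.

Lemma cdiff_continuous G z : cdiff G z -> {for z, continuous G}.
Proof. exact: differentiable_continuous. Qed.

Lemma differentiable_normc (k : Cplx R -> Cplx R) z : cdiff k z ->
  exists l : Cplx R, forall e : R, 0 < e -> exists2 d : R, 0 < d &
    forall w, normc (w - z) < d -> normc (k w - k z - l * (w - z)) <= e * normc (w - z).
Proof.
move=> /derivable1_diffP/cvg_ex[/= l kl]; exists l => e e0.
have e0' : 0 < e%:C%C :> Cplx R by rewrite ltcR.
have /nbhs_normcP[d d0 dP] := kl _ (nbhsx_ballx (l : Cplx R) _ e0').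
exists d => // w wz.
have [->|wz0] := eqVneq w z; first by rewrite !subrr mulr0 subrr normc0 mulr0.
have wz' : w - z != 0 by rewrite subr_eq0.
have := dP (w - z); rewrite subr0 => /(_ wz wz')/=.
rewrite /ball/= [_ *: 1]mulr1 subrK ltcR => lt.
rewrite -normc_sub [X in normc X](_ : _ =
   (l - (w - z)^-1 *: (k w - k z)) * (w - z)); last first.
  by rewrite mulrBl /GRing.scale/= mulrAC mulVf// mul1r.
by rewrite normcM ler_wpM2r ?normc_ge0// ltW.
Qed.

(** The real and imaginary parts of the derivative occur as coefficients in the
    form that Goursat's lemma takes for the 1-form [Im k dx + Re k dy], whose
    integral is the imaginary part of that of [k dz]. *)
Lemma cauchy_riemann (k : Cplx R -> Cplx R) z : cdiff k z ->
  exists a b, forall e : R, 0 < e -> exists2 d : R, 0 < d &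
    forall u, `|u.1 - complex.Re z| < d -> `|u.2 - complex.Im z| < d ->
    `|complex.Im (k (to_cplx u)) - complex.Im (k z) -
      (b * (u.1 - complex.Re z) + a * (u.2 - complex.Im z))| <=
      e * (`|u.1 - complex.Re z| + `|u.2 - complex.Im z|) /\
    `|complex.Re (k (to_cplx u)) - complex.Re (k z) -
      (a * (u.1 - complex.Re z) + - b * (u.2 - complex.Im z))| <=
      e * (`|u.1 - complex.Re z| + `|u.2 - complex.Im z|).
Proof.
move=> /differentiable_normc[[a b] lP]; exists a, b => e e0.
have [d d0 dP] := lP e e0; exists (d / 2); first by rewrite divr_gt0.
move=> u u1 u2; have uz := normc_le_sum (to_cplx u - z).
have {}dP : normc (k (to_cplx u) - k z - (a +i* b)%C * (to_cplx u - z)) <=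
    e * (`|u.1 - complex.Re z| + `|u.2 - complex.Im z|).
  apply: (@le_trans _ _ (e * normc (to_cplx u - z))).
    apply: dP; apply: le_lt_trans uz _; rewrite [ltRHS]splitr.
    by move: u1 u2; case: (z) => ? ? /= ? ?; exact: ltrD.
  by rewrite ler_pM2l//; apply: le_trans uz _; case: (z).
split.
  apply: le_trans dP; apply: le_trans (Im_le_normc _).
  move: (k (to_cplx u)) (k z) => [p1 p2] [q1 q2]; case: (z) => x y /=.
  by rewrite le_eqVlt; apply/orP; left; apply/eqP; congr `|_|; ring.
apply: le_trans dP; apply: le_trans (Re_le_normc _).
move: (k (to_cplx u)) (k z) => [p1 p2] [q1 q2]; case: (z) => x y /=.
by rewrite le_eqVlt; apply/orP; left; apply/eqP; congr `|_|; ring.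
Qed.

End ComplexDifferentiability.
#[global] Opaque cdiff.

(** * A Cauchy estimate with an absolute constant *)

Section CrudeCauchy.
Context {R : realType}.
Implicit Types (z w : Cplx R).

(** Of the sixteen squares of side [h] tiling the central square of half-side
    [h + h], the twelve that do not touch the origin contribute nothing. *)
Lemma central_square_halve (b : R -> R -> R -> R) (h : R) : 0 < h ->
  (forall x y r, 0 <= r -> - (h + h) <= x -> - (h + h) <= y ->
     x + (r + r) <= h + h -> y + (r + r) <= h + h ->
     b x y (r + r) = (b x y r + b (x + r) y r) + (b x (y + r) r + b (x + r) (y + r) r)) ->
  (forall x y r, 0 <= r -> - (h + h) <= x -> - (h + h) <= y ->
     x + r <= h + h -> y + r <= h + h ->
     [|| x + r < 0, 0 < x, y + r < 0 | 0 < y] -> b x y r = 0) ->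
  b (- (h + h)) (- (h + h)) (h + h + (h + h)) = b (- h) (- h) (h + h).
Proof.
move=> h0 bD b0.
have e1 : - (h + h) + (h + h) = 0 by rewrite addNr.
have e2 : - (h + h) + h = - h by rewrite opprD subrK.
have e3 : - h + h = 0 by rewrite addNr.
have hle : 0 <= h by exact: ltW.
have hh0 : 0 <= h + h by exact: addr_ge0.
have lx : [/\ - (h + h) <= - (h + h), - (h + h) <= - h, - (h + h) <= 0 & - (h + h) <= h].
  by clear bD b0; split; lra.
have ux : [/\ - (h + h) + h <= h + h, - h + h <= h + h, 0 + h <= h + h & h + h <= h + h].
  by clear bD b0; split; lra.
have uux : [/\ - (h + h) + (h + h + (h + h)) <= h + h,
  - (h + h) + (h + h) <= h + h, - h + (h + h) <= h + h & 0 + (h + h) <= h + h].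
  by clear bD b0 lx ux; split; lra.
have sx : - (h + h) + h < 0 by rewrite e2 oppr_lt0.
case: lx ux uux => ? ? ? ? [? ? ? ?] [? ? ? ?].
rewrite bD// e1 (bD (- (h + h)) (- (h + h)) h)// (bD (- (h + h)) 0 h)//.
rewrite (bD 0 (- (h + h)) h)// (bD 0 0 h)// (bD (- h) (- h) h)// e2 e3 !add0r.
have z y : - (h + h) <= y -> y + h <= h + h -> b (- (h + h)) y h = 0.
  by move=> *; apply: b0 => //; rewrite sx.
have z' y : - (h + h) <= y -> y + h <= h + h -> b h y h = 0.
  by move=> *; apply: b0 => //; rewrite h0 orbT.
have w x : - (h + h) <= x -> x + h <= h + h -> b x (- (h + h)) h = 0.
  by move=> *; apply: b0 => //; rewrite sx !orbT.
have w' x : - (h + h) <= x -> x + h <= h + h -> b x h h = 0.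
  by move=> *; apply: b0 => //; rewrite h0 !orbT.
by rewrite !(z, z', w, w')// !(add0r, addr0).
Qed.

Definition central_square (s : R) : set (Cplx R) :=
  [set z | `|complex.Re z| <= s /\ `|complex.Im z| <= s].

(** The value at the center is controlled by the values on the boundary. With
    [k z = (G z - 1) / z], which extends continuously at [0], the integral of
    [k] around every square avoiding [0] vanishes; hence the one around the
    central square of half-side [s] does not change when [s] is halved, and it
    vanishes too. On the other hand the imaginary part of the integral of [1 / z]
    is at least [4], and the integral of [G z / z] is at most [8 * m]. *)
Lemma crude_cauchy_estimate (G : Cplx R -> Cplx R) (s m : R) : 0 < s ->
  (forall z, central_square s z -> cdiff G z) -> G 0 = 1 ->
  (forall z, central_square s z -> `|complex.Re z| = s \/ `|complex.Im z| = s ->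
    normc (G z) <= m) -> 2^-1 <= m.
Proof.
move=> s0 dG G0 Gm.
have [l lP] : exists l : Cplx R, forall e : R, 0 < e -> exists2 d : R, 0 < d &
    forall w, normc w < d -> normc (G w - 1 - l * w) <= e * normc w.
  have [|l lP] := @differentiable_normc R G 0.
    by apply: dG; split; rewrite /= normr0 ltW.
  exists l => e e0; have [d d0 dP] := lP e e0; exists d => // w.
  by have := dP w; rewrite subr0 G0.
pose k z := if z == 0 then l else (G z - 1) / z.
have dk z : central_square s z -> z != 0 -> cdiff k z.
  move=> /dG dGz z0; apply: (@cdiff_near _ (fun w => (G w - 1) * w^-1)).
    apply/nbhs_normcP; exists (normc z); first by rewrite normc_gt0.
    move=> w wz; rewrite /k; case: eqVneq => // w0.
    by move: wz; rewrite w0 normc_sub subr0 ltxx.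
  by apply: cdiffM; [apply: cdiffB => //; exact: cdiff_cst|exact: cdiffV].
have ck z : central_square s z -> {for z, continuous k}.
  move=> zs; have [->|z0] := eqVneq z 0; last exact/cdiff_continuous/dk.
  move=> P /nbhs_normcP[e e0 eP].
  have [|d d0 dP] := lP (e / 2); first by rewrite divr_gt0.
  apply/nbhs_normcP; exists d => // w; rewrite subr0 => wd; apply: eP.
  rewrite /k eqxx; case: eqVneq => [_|w0]; first by rewrite subrr normc0.
  rewrite -(@ltr_pM2r _ (normc w)) ?normc_gt0// -normcM mulrBl divfK//.
  apply: le_lt_trans (dP _ wd) _.
  by rewrite ltr_pM2r ?normc_gt0//; lra.
pose A u := complex.Im (k (to_cplx u)); pose B u := complex.Re (k (to_cplx u)).
pose in_s (u : R * R) := `|u.1| <= s /\ `|u.2| <= s.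
have cA u : in_s u -> {for u, continuous A}.
  move=> us; have cku : {for to_cplx u, continuous k} by exact: ck.
  apply: (@continuous_comp _ _ _ to_cplx (fun z => complex.Im (k z))).
    exact: continuous_to_cplx.
  exact: (continuous_comp cku (@continuous_Im R _)).
have cB u : in_s u -> {for u, continuous B}.
  move=> us; have cku : {for to_cplx u, continuous k} by exact: ck.
  apply: (@continuous_comp _ _ _ to_cplx (fun z => complex.Re (k z))).
    exact: continuous_to_cplx.
  exact: (continuous_comp cku (@continuous_Re R _)).
have bd0 x y h : 0 <= h -> square x y h `<=` in_s -> ~ square x y h (0, 0) ->
    boundary_integral A B x y h = 0.
  move=> h0 sub n0; apply: goursat => // u uS; [exact/cA/sub|exact/cB/sub|].
  have [|a [b abP]] := @cauchy_riemann _ k (to_cplx u).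
    apply: dk; first exact: sub uS.
    by apply: contra_notN n0 => /eqP[u1 u2]; move: uS; case: (u) u1 u2 => ? ?/= -> ->.
  by exists b, a, (- b) => e /abP.
have bdD x y h : 0 <= h -> square x y (h + h) `<=` in_s ->
  boundary_integral A B x y (h + h) =
    (boundary_integral A B x y h + boundary_integral A B (x + h) y h) +
    (boundary_integral A B x (y + h) h + boundary_integral A B (x + h) (y + h) h).
  by move=> h0 sub; apply: boundary_integral_quarter => // z /sub; [exact: cA|exact: cB].
have sq_in h : 0 < h <= s -> forall x y r, - h <= x -> - h <= y ->
    x + r <= h -> y + r <= h -> square x y r `<=` in_s.
  clear; move=> /andP[h0 hs] x y r ? ? ? ? u [? ?].
  by split; rewrite ler_norml; apply/andP; split; lra.
pose bd := boundary_integral A B.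
have halve h : 0 < h -> h + h <= s ->
    bd (- (h + h)) (- (h + h)) (h + h + (h + h)) = bd (- h) (- h) (h + h).
  move=> h0 hs; apply: central_square_halve => // x y r r0 ? ? ? ?.
    by apply: bdD => //; apply: (sq_in (h + h)) => //; rewrite hs andbT addr_gt0.
  move=> out; apply: bd0 => //; first by apply: (sq_in (h + h)) => //; rewrite hs andbT addr_gt0.
  by move: out; clear => /or4P[] ? [/= /andP[? ?] /andP[? ?]]; lra.
have halves n : bd (- (s / 2 ^+ n)) (- (s / 2 ^+ n)) (s / 2 ^+ n + s / 2 ^+ n) =
    bd (- s) (- s) (s + s).
  elim: n => [|n <-]; first by rewrite expr0 divr1.
  have sE : s / 2 ^+ n = s / 2 ^+ n.+1 + s / 2 ^+ n.+1.
    by rewrite exprS invfM; set q := (2 ^+ n)^-1; clear; lra.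
  rewrite [in RHS]sE halve -?sE//; first by rewrite divr_gt0// exprn_gt0.
  by rewrite ler_pdivrMr ?exprn_gt0// ler_peMr ?(ltW s0)// exprn_ege1// ler1n.
(* [k] is bounded by some [M] near [0], so the integral around the central square
   of half-side [s / 2 ^+ n] tends to [0] *)
have bdQ0 : bd (- s) (- s) (s + s) = 0.
  pose M := normc l + 1; have M0 : 0 <= M by rewrite addr_ge0// normc_ge0.
  have [d d0 dM] : exists2 d : R, 0 < d & forall u, `|u.1| < d -> `|u.2| < d ->
      `|A u| <= M /\ `|B u| <= M.
    have c0 : central_square s 0 by split; rewrite /= normr0 ltW.
    have /nbhs_normcP[d d0 dP] : nbhs (0 : Cplx R) (fun w => normc (k w - k 0) < 1).
      apply: (ck _ c0 (fun w => normc (w - k 0) < 1)).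
      by apply/nbhs_normcP; exists 1.
    exists (d / 2); first by rewrite divr_gt0.
    move=> u u1 u2; have : normc (k (to_cplx u)) <= M.
      rewrite -[k _](subrK (k 0)); apply: le_trans (normcD _ _) _.
      have -> : k 0 = l by rewrite /k eqxx.
      rewrite /M addrC lerD2l; have <- : k 0 = l by rewrite /k eqxx.
      rewrite ltW// dP// subr0.
      by apply: le_lt_trans (normc_le_sum _) _; rewrite [ltRHS]splitr ltrD.
    move=> kM; split; apply: le_trans kM; [exact: Im_le_normc|exact: Re_le_normc].
  have small h : 0 < h <= s -> h < d -> `|bd (- h) (- h) (h + h)| <= 8 * M * h.
    move=> hs hd; have h0 : 0 < h by case/andP: hs.
    have hin : square (- h) (- h) (h + h) `<=` in_s.
      by apply: (sq_in h hs); rewrite // addrA addNr add0r.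
    have hdM u : square (- h) (- h) (h + h) u -> `|A u| <= M /\ `|B u| <= M.
      rewrite /square/= addrA addNr add0r -!ler_norml => -[u1 u2].
      by apply: dM; [exact: le_lt_trans u1 hd|exact: le_lt_trans u2 hd].
    apply: (@le_trans _ _ (4 * (M * (h + h)))); last by clear; lra.
    apply: boundary_integral_bounded; first by rewrite addr_ge0 ?ltW.
    - by move=> u /hin/cA.
    - by move=> u /hin/cB.
    - by move=> u /hdM[].
    - by move=> u /hdM[].
  apply/eqP; rewrite -normr_le0; apply/ler_addgt0Pr => e e0; rewrite add0r.
  have [n ns] : exists n, s / 2 ^+ n < Num.min d (e / (8 * M + 1)).
    have /cvgrPdist_lt/(_ (Num.min d (e / (8 * M + 1))))[|n _ /(_ n (leqnn n))] :
        (fun n => s * (2^-1) ^+ n) @ \oo --> (0 : R).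
    - rewrite -[X in _ --> X](mulr0 s); apply: cvgMr; apply: cvg_expr.
      by rewrite ger0_norm ?invf_lt1// ltr1n.
    - by rewrite lt_min d0 divr_gt0// ltr_wpDl// mulr_ge0.
    - rewrite sub0r normrN => lt; exists n; rewrite -exprVn.
      exact: le_lt_trans (ler_norm _) lt.
  rewrite -(halves n); move: ns; rewrite lt_min => /andP[nd ne].
  have sn0 : 0 < s / 2 ^+ n by rewrite divr_gt0// exprn_gt0.
  apply: le_trans (small _ _ nd) _.
    by rewrite sn0 ler_pdivrMr ?exprn_gt0// ler_peMr ?(ltW s0)// exprn_ege1// ler1n.
  apply: le_trans (_ : (8 * M + 1) * (s / 2 ^+ n) <= e).
    by rewrite ler_wpM2r ?(ltW sn0)// lerDl.
  by rewrite mulrC -ler_pdivlMr ?(ltW ne)// ltr_wpDl// mulr_ge0.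
(* with [q = (normc z ^+ 2)^-1] the number [z^-1] has real part [Re z * q] and
   imaginary part [- Im z * q], and [k z] is [G z / z] minus it *)
have kest z : central_square s z -> `|complex.Re z| = s \/ `|complex.Im z| = s ->
    exists2 q, (2 * s)^-1 <= s * q & `|complex.Im (k z) - complex.Im z * q| <= m / s /\
      `|complex.Re (k z) + complex.Re z * q| <= m / s.
  move=> zs zb; have zn : s <= normc z.
    by case: zb => <-; [exact: Re_le_normc|exact: Im_le_normc].
  have z0 : z != 0 by rewrite -normc_gt0; exact: lt_le_trans zn.
  have Gz : normc (G z / z) <= m / s.
    rewrite normcM normcV; apply: ler_pM (Gm _ zs zb) _; rewrite ?normc_ge0//.
      by rewrite invr_ge0 normc_ge0.
    by rewrite lef_pV2 ?posrE ?normc_gt0.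
  have kz : k z + z^-1 = G z / z.
    by rewrite /k (negbTE z0) mulrBl mul1r subrK.
  exists (normc z ^+ 2)^-1.
    have N0 : 0 < normc z ^+ 2 by rewrite exprn_gt0// normc_gt0.
    have N2 : normc z ^+ 2 <= 2 * s ^+ 2.
      have [zs1 zs2] := zs; rewrite normc_sqr mulrDl mul1r.
      by rewrite lerD// -(@real_normK _ (_ z)) ?num_real// lerXn2r ?nnegrE ?(ltW s0).
    have s20 : 0 < 2 * s ^+ 2 by rewrite mulr_gt0// exprn_gt0.
    by rewrite -ler_pdivrMl// -invfM mulrCA -expr2 lef_pV2.
  split; apply: le_trans Gz; rewrite -kz.
    apply: le_trans (Im_le_normc _); rewrite normc_sqr.
    by move: (k z) => [? ?]; case: (z) => a b /=.
  apply: le_trans (Re_le_normc _); rewrite normc_sqr.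
  by move: (k z) => [? ?]; case: (z) => a b /=.
have kest_s z : central_square s z -> `|complex.Re z| = s \/ `|complex.Im z| = s ->
    [/\ complex.Im z = - s -> complex.Im (k z) <= m / s - (2 * s)^-1,
        complex.Im z = s -> (2 * s)^-1 - m / s <= complex.Im (k z),
        complex.Re z = s -> complex.Re (k z) <= m / s - (2 * s)^-1 &
        complex.Re z = - s -> (2 * s)^-1 - m / s <= complex.Re (k z)].
  move=> zs zb; have [q] := kest z zs zb; set c := (2 * s)^-1; set c' := m / s.
  move: (complex.Re (k z)) (complex.Im (k z)) (complex.Re z) (complex.Im z) => a b x y.
  by clear => qs []; rewrite !ler_norml => H1 H2; split => e; move: H1 H2; rewrite e => H1 H2; lra.
have side t : - s <= t <= - s + (s + s) -> `|t| <= s.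
  by rewrite ler_norml addrA addNr add0r.
have ns : `|- s| = s by rewrite normrN gtr0_norm.
have ps : `|s| = s by rewrite gtr0_norm.
have ends : - s + (s + s) = s by rewrite addrA addNr add0r.
have in_sq u : square (- s) (- s) (s + s) u -> in_s u.
  by move=> [/side u1 /side u2]; split.
have cAs u : square (- s) (- s) (s + s) u -> {for u, continuous A} by move=> /in_sq/cA.
have cBs u : square (- s) (- s) (s + s) u -> {for u, continuous B} by move=> /in_sq/cB.
have s'0 : - s <= - s + (s + s) by rewrite lerDl addr_ge0 ?ltW.
have ll : - s <= - s <= - s + (s + s) by rewrite lexx.
have lr : - s <= - s + (s + s) <= - s + (s + s) by rewrite s'0 lexx.
pose c := m / s - (2 * s)^-1.
have I1 := Rintegral_itv_le s'0 (continuous_horizontal cAs ll).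
have I2 := Rintegral_itv_ge s'0 (continuous_horizontal cAs lr).
have I3 := Rintegral_itv_le s'0 (continuous_vertical cBs lr).
have I4 := Rintegral_itv_ge s'0 (continuous_vertical cBs ll).
have b1 t : - s <= t <= - s + (s + s) -> A (t, - s) <= c.
  move=> /side ts; have [||+ _ _ _] := kest_s (to_cplx (t, - s)); last exact.
    by split; rewrite //= ns.
  by right.
have b2 t : - s <= t <= - s + (s + s) -> - c <= A (t, - s + (s + s)).
  move=> /side ts; rewrite opprB ends; have [||_ + _ _] := kest_s (to_cplx (t, s)); last exact.
    by split; rewrite //= ps.
  by right.
have b3 t : - s <= t <= - s + (s + s) -> B (- s + (s + s), t) <= c.
  move=> /side ts; rewrite ends; have [||_ _ + _] := kest_s (to_cplx (s, t)); last exact.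
    by split; rewrite //= ps.
  by left.
have b4 t : - s <= t <= - s + (s + s) -> - c <= B (- s, t).
  move=> /side ts; rewrite opprB; have [||_ _ _ +] := kest_s (to_cplx (- s, t)); last exact.
    by split; rewrite //= ns.
  by left.
have {b1}I1 := I1 c b1; have {b2}I2 := I2 (- c) b2.
have {b3}I3 := I3 c b3; have {b4}I4 := I4 (- c) b4.
have sc : 0 <= s * c.
  move: bdQ0 I1 I2 I3 I4; rewrite /bd /boundary_integral.
  set i1 := Rintegral _ _ _; set i2 := Rintegral _ _ _.
  set i3 := Rintegral _ _ _; set i4 := Rintegral _ _ _.
  rewrite [_ - - s](_ : _ = s + s); last by clear; lra.
  by rewrite !mulNr !(mulrDr c) (mulrC c) !opprD; move: (s * c) => q; clear; lra.
move: sc; rewrite pmulr_rge0// /c invfM -mulrBl pmulr_lge0 ?invr_gt0//.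
by rewrite subr_ge0.
Qed.

End CrudeCauchy.

(** * The maximum modulus principle on a disc *)

Section MaximumModulus.
Context {R : realType}.
Implicit Types (z w a : Cplx R) (G : Cplx R -> Cplx R).

(** The crude estimate, whose constant is absolute, applied to all the powers of
    [G / G a]: a gap [q < 1] between the center and the boundary would be
    amplified into a contradiction. *)
Lemma square_maximum_modulus G a (s q : R) : 0 < s -> 0 <= q < 1 ->
  (forall z, central_square s (z - a) -> cdiff G z) ->
  (forall z, central_square s (z - a) ->
     `|complex.Re (z - a)| = s \/ `|complex.Im (z - a)| = s ->
     normc (G z) <= q * normc (G a)) -> G a = 0.
Proof.
move=> s0 /andP[q0 q1] dG Gq; apply/eqP; apply/negPn/negP => Ga0.
have [N qN] : exists N, q ^+ N < 2^-1.
  have /cvgrPdist_lt/(_ 2^-1)[|N _ /(_ N (leqnn N))] : (fun n => q ^+ n) @ \oo --> (0 : R).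
  - by apply: cvg_expr; rewrite ger0_norm.
  - by rewrite invr_gt0.
  - by rewrite sub0r normrN => lt; exists N; exact: le_lt_trans (ler_norm _) lt.
have ag0 : 0 < normc (G a) by rewrite normc_gt0.
have sub_a w : a + w - a = w by rewrite addrAC subrr add0r.
have : 2^-1 <= q ^+ N.
  apply: (@crude_cauchy_estimate R (fun w => (G (a + w) / G a) ^+ N) s) => // [z zs||z zs zb].
  - apply: cdiffX; apply: cdiffM; last exact: cdiff_cst.
    apply: (@cdiff_comp _ (fun w => a + w) G).
      by apply: cdiffD; [exact: cdiff_cst|exact: cdiff_id].
    by apply: dG; rewrite sub_a.
  - by rewrite addr0 divff// expr1n.
  - rewrite normcX normcM normcV lerXn2r ?nnegrE ?mulr_ge0 ?invr_ge0 ?normc_ge0//.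
    by rewrite ler_pdivrMr// Gq// sub_a.
by rewrite leNgt qN.
Qed.

Definition disc (r : R) : set (R * R) := [set u | u.1 ^+ 2 + u.2 ^+ 2 <= r ^+ 2].

Lemma discE r u : 0 <= r -> disc r u <-> normc (to_cplx u) <= r.
Proof.
move=> r0; rewrite /disc/= -[X in X <= _](normc_sqr (to_cplx u)).
by rewrite ler_sqr ?nnegrE ?normc_ge0.
Qed.

Lemma compact_disc r : 0 <= r -> compact (disc r).
Proof.
move=> r0; apply: (@subclosed_compact _ _ (`[- r, r] `*` `[- r, r])).
- have cf : continuous (fun u : R * R => normc (to_cplx u)).
    move=> u; apply: continuous_comp; first exact: continuous_to_cplx.
    exact: continuous_normc.
  rewrite (_ : disc r = (fun u : R * R => normc (to_cplx u)) @^-1` [set x | x <= r]).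
    by apply: closed_comp; [move=> u _; exact: cf|exact: closed_le].
  by apply/seteqP; split => u; rewrite /= discE.
- by apply: compact_setX; exact: segment_compact.
- move=> u /(discE _ r0) ur; split; rewrite /= in_itv/= -ler_norml; apply: le_trans ur.
    exact: (Re_le_normc (to_cplx u)).
  exact: (Im_le_normc (to_cplx u)).
Qed.

Lemma continuous_at_mul (T : topologicalType) (f g : T -> R) x :
  {for x, continuous f} -> {for x, continuous g} ->
  {for x, continuous (fun y => f y * g y)}.
Proof. by move=> cf cg; exact: cvgM. Qed.

Lemma continuous_at_add (T : topologicalType) (f g : T -> R) x :
  {for x, continuous f} -> {for x, continuous g} ->
  {for x, continuous (fun y => f y + g y)}.
Proof. by move=> cf cg; exact: cvgD. Qed.

Lemma continuous_at_cst (T : topologicalType) (c : R) (x : T) :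
  {for x, continuous (fun=> c)}.
Proof. exact: cvg_cst. Qed.

(** At an interior maximum [a] of [normc (G z) ^+ 2 * (1 + e * normc z ^+ 2)],
    the holomorphic function [G z * (1 + e * z * conj a)] has a strict local maximum
    of its modulus, by the strict case of the Cauchy-Schwarz inequality. This is
    excluded on a small square, unless [G a = 0]; letting [e] tend to [0] gives
    the bound. *)
Theorem maximum_modulus_disc G (r m : R) : 0 <= r ->
  (forall z, normc z <= r -> cdiff G z) ->
  (forall z, normc z = r -> normc (G z) <= m) ->
  forall a, normc a <= r -> normc (G a) <= m.
Proof.
move=> r0 dG Gm b br.
have m0 : 0 <= m.
  apply: le_trans (normc_ge0 _) (Gm (Complex r 0) _).
  by rewrite /= expr0n/= addr0 sqrtr_sqr ger0_norm.
suff: normc (G b) ^+ 2 <= m ^+ 2 by rewrite ler_sqr ?nnegrE ?normc_ge0.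
apply/ler_addgt0Pr => e' e'0.
pose e := e' / (m ^+ 2 * r ^+ 2 + 1).
have mr0 : 0 <= m ^+ 2 * r ^+ 2 by rewrite mulr_ge0 ?sqr_ge0.
have e0 : 0 < e by rewrite divr_gt0// ltr_wpDl.
have e1 (x : R) : 0 < 1 + e * x ^+ 2 by rewrite ltr_pwDl// mulr_ge0 ?(ltW e0)// sqr_ge0.
pose Phi u := normc (G (to_cplx u)) ^+ 2 * (1 + e * normc (to_cplx u) ^+ 2).
have D0 : disc r !=set0 by exists (0, 0); rewrite /disc/= expr0n/= addr0 sqr_ge0.
have cPhi : {within disc r, continuous Phi}.
  apply: continuous_in_subspaceT => u; rewrite inE => /(discE _ r0) ur.
  have c1 : {for u, continuous (fun u : R * R => normc (to_cplx u))}.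
    apply: continuous_comp; first exact: continuous_to_cplx.
    exact: continuous_normc.
  have c2 : {for u, continuous (fun u : R * R => normc (G (to_cplx u)))}.
    apply: (@continuous_comp _ _ _ to_cplx (fun z => normc (G z))).
      exact: continuous_to_cplx.
    apply: (@continuous_comp _ _ _ G (@normc R)); last exact: continuous_normc.
    exact/cdiff_continuous/dG.
  have c3 := continuous_at_mul c1 c1.
  have c4 := continuous_at_mul (@continuous_at_cst _ e u) c3.
  exact: (continuous_at_mul (continuous_at_mul c2 c2)
            (continuous_at_add (@continuous_at_cst _ 1 u) c4)).
have [u uD uP] := compact_EVT_max D0 (compact_disc r0) cPhi.
set a := to_cplx u.
have ar : normc a <= r by apply/(discE _ r0); rewrite inE in uD.
have {}uP z : normc z <= r ->
    normc (G z) ^+ 2 * (1 + e * normc z ^+ 2) <= normc (G a) ^+ 2 * (1 + e * normc a ^+ 2).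
  move: z => [x y] zr; have := uP (x, y); apply.
  by rewrite inE; apply/(discE _ r0).
have Gle z : normc z <= r -> normc (G z) ^+ 2 <= normc (G a) ^+ 2 * (1 + e * normc a ^+ 2).
  move=> zr; apply: le_trans (uP z zr); rewrite ler_peMr ?sqr_ge0// lerDl.
  by rewrite mulr_ge0 ?sqr_ge0// ltW.
move: ar; rewrite le_eqVlt => /predU1P[ar|ar].
  apply: le_trans (Gle b br) _; rewrite ar.
  apply: (@le_trans _ _ (m ^+ 2 * (1 + e * r ^+ 2))).
    rewrite ler_wpM2r ?(ltW (e1 _))// lerXn2r ?nnegrE ?normc_ge0//.
    exact: Gm.
  rewrite mulrDr mulr1 lerD2l /e mulrCA -mulrAC ler_pdivrMr ?ltr_wpDl//.
  by rewrite ler_pM2l// lerDl.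
suff Ga0 : G a = 0.
  apply: le_trans (Gle b br) _; rewrite Ga0 normc0 expr0n/= mul0r.
  by rewrite addr_ge0 ?sqr_ge0 ?ltW.
pose s := (r - normc a) / 2.
have s0 : 0 < s by rewrite divr_gt0// subr_gt0.
have rpos : 0 < r by exact: le_lt_trans (normc_ge0 _) ar.
pose ca : Cplx R := Complex u.1 (- u.2).
pose K z := G z * (1 + e%:C%C * z * ca).
(* the relative loss of the modulus of [K] on the boundary of the square of
   half-side [s] around [a] *)
pose k := e * s ^+ 2 / (1 + e * r ^+ 2) ^+ 2.
have sr : s <= r.
  by rewrite /s ler_pdivrMr//; have := normc_ge0 a; clear -rpos; lra.
have k1 : k <= 1.
  rewrite ler_pdivrMr ?exprn_gt0// mul1r.
  apply: (@le_trans _ _ (1 + e * r ^+ 2)).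
    rewrite ler_wpDl// ler_pM2l// lerXn2r ?nnegrE ?(ltW s0)//.
  by rewrite expr2 ler_peMl ?(ltW (e1 _))// lerDl mulr_ge0 ?sqr_ge0 ?ltW.
have k0 : 0 < k by rewrite divr_gt0 ?exprn_gt0// mulr_gt0// exprn_gt0.
have aca : normc (1 + e%:C%C * a * ca) ^+ 2 = (1 + e * normc a ^+ 2) ^+ 2.
  by rewrite !normc_sqr /=; ring.
have zca z : normc (1 + e%:C%C * z * ca) ^+ 2 =
    (1 + e * normc z ^+ 2) * (1 + e * normc a ^+ 2) - e * normc (z - a) ^+ 2.
  by rewrite !normc_sqr; case: z => x y /=; ring.
have square_in z : central_square s (z - a) -> normc z <= r.
  move=> [z1 z2]; rewrite -[z](subrK a); apply: le_trans (normcD _ _) _.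
  have := le_trans (normc_le_sum (z - a)) (lerD z1 z2).
  by rewrite /s; clear; lra.
suff: K a = 0.
  rewrite /K => /eqP; rewrite mulf_eq0 => /orP[/eqP//|].
  rewrite -normc_eq0 -(@sqrf_eq0 _ (normc _)) aca sqrf_eq0.
  by rewrite gt_eqF.
apply: (@square_maximum_modulus K a s (Num.sqrt (1 - k))) => // [|z zs|z zs zb].
- by rewrite sqrtr_ge0 -[ltRHS]sqrtr1 ltr_sqrt// ltrBlDr ltrDl k0.
- apply: (@cdiffM _ G (fun z => 1 + e%:C%C * z * ca)); first exact/dG/square_in.
  apply: (@cdiffD _ (fun=> 1) (fun z => e%:C%C * z * ca)); first exact: cdiff_cst.
  apply: (@cdiffM _ (fun z => e%:C%C * z) (fun=> ca)); last exact: cdiff_cst.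
  by apply: (@cdiffM _ (fun=> e%:C%C) id); [exact: cdiff_cst|exact: cdiff_id].
- have zr := square_in z zs.
  have za : s ^+ 2 <= normc (z - a) ^+ 2.
    rewrite lerXn2r ?nnegrE ?normc_ge0 ?(ltW s0)//.
    by case: zb => <-; [exact: Re_le_normc|exact: Im_le_normc].
  rewrite -ler_sqr ?nnegrE ?mulr_ge0 ?normc_ge0 ?sqrtr_ge0//.
  rewrite exprMn sqr_sqrtr ?subr_ge0// /K !normcM !exprMn aca zca.
  have := uP z zr.
  set X := normc (G z) ^+ 2; set Y := normc (G a) ^+ 2.
  have X0 : 0 <= X by exact: sqr_ge0.
  have Y0 : 0 <= Y by exact: sqr_ge0.
  set p := 1 + e * normc z ^+ 2; set q := 1 + e * normc a ^+ 2 => XY.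
  have p0 : 0 < p by exact: e1. have q0 : 0 < q by exact: e1.
  rewrite -(ler_pM2l p0) (mulrA p X) (mulrC p X).
  apply: (@le_trans _ _ (Y * q * (p * q - e * normc (z - a) ^+ 2))).
    apply: ler_wpM2r XY; rewrite -zca; exact: sqr_ge0.
  rewrite [leRHS](_ : _ = Y * q * (p * q - k * (p * q))); last by ring.
  apply: ler_wpM2l; first by rewrite mulr_ge0 ?(ltW q0).
  rewrite lerD2l lerN2.
  apply: (@le_trans _ _ (e * s ^+ 2)); last by rewrite ler_pM2l.
  rewrite /k mulrAC ler_pdivrMr ?exprn_gt0//.
  apply: ler_wpM2l; first by rewrite mulr_ge0 ?sqr_ge0 ?(ltW e0).
  rewrite expr2; apply: ler_pM; rewrite ?(ltW p0) ?(ltW q0)// lerD2l ler_pM2l//.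
    by rewrite lerXn2r ?nnegrE ?normc_ge0.
  by rewrite lerXn2r ?nnegrE ?normc_ge0// ltW.
Qed.

End MaximumModulus.

(** * The maximum principle for sums of powers of moduli *)

Section SumMaximumPrinciple.
Context {R : realType}.
Implicit Types (z a : Cplx R).

Lemma powRX (x p : R) n : 0 <= x -> (x ^+ n) `^ p = (x `^ p) ^+ n.
Proof.
move=> x0; elim: n => [|n IH]; first by rewrite !expr0 powR1.
by rewrite !exprS powRM ?exprn_ge0// IH.
Qed.

Lemma normc_prod_powR (I : finType) (P : pred I) (F : I -> Cplx R) (m : I -> nat) (p : R) :
  normc (\prod_(i | P i) F i ^+ m i) `^ p = \prod_(i | P i) (normc (F i) `^ p) ^+ m i.
Proof.
elim/big_rec2: _ => [|i y z _ <-]; first by rewrite normc1 powR1.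
by rewrite normcM powRM ?normc_ge0// normcX powRX ?normc_ge0.
Qed.

(** Subharmonicity of sums of powers [normc G `^ p], reduced to the maximum
    modulus principle for one holomorphic function: a product of powers of the
    summands with exponents proportional to their values at [a]. For these
    weights the inequality between the geometric and arithmetic means, in the form
    [x <= expR (x - 1)], is an equality at [a]. *)
Theorem sum_maximum_principle (I : finType) (G : I -> Cplx R -> Cplx R) (p r m : R) :
  0 < p -> 0 <= r ->
  (forall i z, normc z <= r -> cdiff (G i) z) ->
  (forall z, normc z = r -> \sum_i normc (G i z) `^ p <= m) ->
  forall a, normc a <= r -> \sum_i normc (G i a) `^ p <= m.
Proof.
move=> p0 r0 dG Gm a ar; rewrite leNgt; apply/negP => mS.
have m0 : 0 <= m.
  apply: le_trans (Gm (Complex r 0) _); first by apply: sumr_ge0 => i _; exact: powR_ge0.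
  by rewrite /= expr0n/= addr0 sqrtr_sqr ger0_norm.
pose v i := normc (G i a) `^ p.
pose P := [pred i | 0 < v i].
have SP : \sum_i normc (G i a) `^ p = \sum_(i | P i) v i.
  rewrite [RHS]big_mkcond/=; apply: eq_bigr => i _; rewrite -/(v i); case: ltP => // vi.
  by apply/eqP; rewrite eq_le vi powR_ge0.
rewrite SP in mS; set S := \sum_(i | P i) v i in mS.
pose c := \sum_(i | P i) (v i)^-1.
(* the exponents [n i] approximate [K * v i], and [K] is so large that rounding
   costs less than the gap between [S] and [m] *)
pose K := (c * m + 1) / (S - m).
have Sm : 0 < S - m by rewrite subr_gt0.
have c0 : 0 <= c by apply: sumr_ge0 => i /= /ltW; rewrite invr_ge0.
have K0 : 0 <= K by rewrite divr_ge0 ?(ltW Sm)// addr_ge0// mulr_ge0.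
pose n i := (Num.truncn (K * v i)).+1.
have nP i : K * v i <= (n i)%:R <= K * v i + 1.
  have /truncn_itv/andP[t1 t2] : 0 <= K * v i by rewrite mulr_ge0// powR_ge0.
  by rewrite (ltW t2) /n -natr1 lerD2r t1.
pose H z := \prod_(i | P i) G i z ^+ n i.
pose W := \prod_(i | P i) v i ^+ n i.
have W0 : 0 < W by apply: prodr_gt0 => i /= vi; rewrite exprn_gt0.
have Ha : normc (H a) `^ p = W by rewrite normc_prod_powR.
have Hz z : normc z = r -> normc (H z) `^ p <= W * expR (- 1).
  move=> zr; rewrite normc_prod_powR.
  pose y i := normc (G i z) `^ p.
  have y0 i : 0 <= y i by exact: powR_ge0.
  have ym i : y i <= m.
    apply: le_trans (Gm z zr); rewrite (bigD1 i)//= lerDl.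
    by apply: sumr_ge0 => j _; exact: powR_ge0.
  have sy : \sum_(i | P i) y i <= m.
    apply: le_trans (Gm z zr); rewrite [leRHS](bigID P)/= lerDl.
    by apply: sumr_ge0 => i _; exact: y0.
  apply: (@le_trans _ _ (W * expR (\sum_(i | P i) (n i)%:R * (y i / v i - 1)))).
    rewrite expR_sum /W -big_split/=; apply: ler_prod => i vi.
    have vi0 : 0 < v i by [].
    have -> : normc (G i z) `^ p = v i * (y i / v i) by rewrite mulrC divfK// lt0r_neq0.
    have q0 : 0 <= y i / v i by rewrite divr_ge0 ?(ltW vi0).
    apply/andP; split; first by apply: exprn_ge0; apply: mulr_ge0 => //; exact: ltW.
    rewrite exprMn.
    apply: ler_wpM2l; first by rewrite exprn_ge0 ?(ltW vi0).
    rewrite expRM_natl.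
    rewrite lerXn2r ?nnegrE ?expR_ge0//.
    by have := expR_ge1Dx (y i / v i - 1); rewrite addrCA subrr addr0.
  rewrite ler_wpM2l ?(ltW W0)// ler_expR.
  apply: (@le_trans _ _ (\sum_(i | P i) (K * y i + m / v i - K * v i))).
    apply: ler_sum => i vi; rewrite mulrBr mulr1.
    have /andP[n1 n2] := nP i; apply: lerB n1.
    apply: (@le_trans _ _ ((K * v i + 1) * (y i / v i))).
      by rewrite ler_wpM2r ?divr_ge0 ?(ltW vi).
    rewrite mulrDl mul1r mulrA (mulrAC K) -mulrA mulrA [_ * (v i) / v i]mulfK ?gt_eqF//.
    by rewrite lerD2l ler_wpM2r ?invr_ge0 ?(ltW vi).
  rewrite sumrB big_split/= -!mulr_sumr -/S -/c.
  have : K * (\sum_(i | P i) y i) <= K * m by rewrite ler_wpM2l.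
  have : K * (S - m) = c * m + 1 by rewrite divfK// gt_eqF.
  by rewrite mulrBr (mulrC m c); clear; lra.
have dH z : normc z <= r -> cdiff H z.
  by move=> zr; apply: cdiff_prod => i _; apply: cdiffX; exact: dG.
have We0 : 0 <= W * expR (- 1) by rewrite mulr_ge0 ?expR_ge0 ?ltW.
have pK (x : R) : 0 <= x -> (x `^ p) `^ p^-1 = x.
  by move=> x0; rewrite -powRrM mulfV ?gt_eqF// powRr1.
have Hz' z : normc z = r -> normc (H z) <= (W * expR (- 1)) `^ p^-1.
  move=> /Hz h; rewrite -[leLHS]pK ?normc_ge0//.
  by apply: ge0_ler_powR; rewrite ?invr_ge0 ?(ltW p0)// nnegrE ?powR_ge0.
have := maximum_modulus_disc r0 dH Hz' ar.
move=> /(ge0_ler_powR (ltW p0)); rewrite !nnegrE powR_ge0 normc_ge0 => /(_ isT isT).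
rewrite Ha -powRrM mulVf ?gt_eqF// powRr1// ler_pMr//.
by rewrite leNgt expR_lt1 oppr_lt0 ltr01.
Qed.

End SumMaximumPrinciple.

(** * Plane area under dilations, shears and rotations *)

Section PlaneMeasure.
Context {R : realType}.
Local Open Scope ereal_scope.

Local Notation M := (measurableTypeR R).
Local Notation lambda := (@lebesgue_measure R).
Local Notation area := (@area_measure R).
Implicit Types (f : M * M -> \bar R).

Lemma measurable_affine (s c : R) : measurable_fun setT (fun x : M => (s * x + c)%R : M).
Proof.
apply: measurable_funD; last exact: measurable_cst.
by apply: measurable_funM; [exact: measurable_cst|exact: measurable_id].
Qed.

(** Intervals have the same length for Lebesgue measure as for [s] times its image
    under the affine map, hence both measures agree. *)
Lemma integral_affine (s c : R) (s0 : (0 < s)%R) (f : M -> \bar R) :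
  measurable_fun setT f -> (forall x, 0 <= f x) ->
  s%:E * \int[lambda]_x f (s * x + c)%R = \int[lambda]_x f x.
Proof.
move=> mf f0; pose phi (x : M) : M := (s * x + c)%R.
have mphi : measurable_fun setT phi by exact: measurable_affine.
unshelve epose (nu := mscale (NngNum (ltW s0)) (pushforward lambda phi) :
  {measure set M -> \bar R}); first exact: mphi.
have nuE A : measurable A -> lambda A = nu A.
  move=> mA; apply: lebesgue_measure_unique => // _ [[a b]] _ <-.
  change (lambda `]a, b]%classic = s%:E * lambda (phi @^-1` `]a, b]%classic)).
  have -> : phi @^-1` `]a, b]%classic = `]((a - c) / s)%R, ((b - c) / s)%R]%classic.
    apply/seteqP; split => x /=; rewrite /phi !in_itv/= ltr_pdivrMr// ler_pdivlMr//.
      by rewrite ltrBlDr lerBrDr (mulrC x).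
    by rewrite ltrBlDr lerBrDr (mulrC x).
  rewrite !lebesgue_measure_itv/= !lte_fin ltr_pM2r ?invr_gt0// ltrD2r.
  case: ltP => _; last by rewrite mule0.
  rewrite -EFinD -EFinM; congr EFin.
  by rewrite -mulrBl opprD addrACA subrr addr0 mulrC divfK// gt_eqF.
rewrite [RHS](eq_measure_integral nu); last by move=> A mA _; exact: nuE.
by rewrite ge0_integral_mscale// ge0_integral_pushforward.
Qed.

Lemma integral_shift (c : R) (f : M -> \bar R) :
  measurable_fun setT f -> (forall x, 0 <= f x) ->
  \int[lambda]_x f (x + c)%R = \int[lambda]_x f x.
Proof.
move=> mf f0; rewrite -(integral_affine c ltr01 mf f0) mul1e.
by apply: eq_integral => x _; rewrite mul1r.
Qed.

Lemma integral_shear1 (h : M -> M) f : measurable_fun setT h -> measurable_fun setT f ->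
  (forall z, 0 <= f z) ->
  \int[area]_z f ((z.1 + h z.2)%R, z.2) = \int[area]_z f z.
Proof.
move=> mh mf f0.
have mfh : measurable_fun setT (fun z : M * M => f ((z.1 + h z.2)%R, z.2)).
  apply: (measurableT_comp mf); apply: measurable_fun_pair; last exact: measurable_snd.
  by apply: measurable_funD; [exact: measurable_fst|exact: measurableT_comp mh measurable_snd].
rewrite [LHS](fubini_tonelli2 _ mfh (fun z => f0 _)) [RHS](fubini_tonelli2 _ mf f0).
apply: eq_integral => y _; rewrite /fubini_G/=.
apply: (@integral_shift (h y) (fun x => f (x, y))) => //.
exact: measurableT_comp mf (measurable_pair2 _).
Qed.

Lemma integral_shear2 (h : M -> M) f : measurable_fun setT h -> measurable_fun setT f ->
  (forall z, 0 <= f z) ->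
  \int[area]_z f (z.1, (z.2 + h z.1)%R) = \int[area]_z f z.
Proof.
move=> mh mf f0.
have mfh : measurable_fun setT (fun z : M * M => f (z.1, (z.2 + h z.1)%R)).
  apply: (measurableT_comp mf); apply: measurable_fun_pair; first exact: measurable_fst.
  by apply: measurable_funD; [exact: measurable_snd|exact: measurableT_comp mh measurable_fst].
rewrite [LHS](fubini_tonelli1 _ mfh (fun z => f0 _)) [RHS](fubini_tonelli1 _ mf f0).
apply: eq_integral => x _; rewrite /fubini_F/=.
apply: (@integral_shift (h x) (fun y => f (x, y))) => //.
exact: measurableT_comp mf (measurable_pair1 _).
Qed.

Definition rotate (b : M * M) (c s : R) (z : M * M) : M * M :=
  ((b.1 + (c * (z.1 - b.1) - s * (z.2 - b.2)))%R,
   (b.2 + (s * (z.1 - b.1) + c * (z.2 - b.2)))%R).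

(** A rotation with [s != 0] is the product of three shears, and Fubini's theorem
    makes the invariance under a shear that of the line under translations. *)
Lemma integral_rotate b (c s : R) f : (c ^+ 2 + s ^+ 2 = 1)%R -> (s != 0)%R ->
  measurable_fun setT f -> (forall z, 0 <= f z) ->
  \int[area]_z f (rotate b c s z) = \int[area]_z f z.
Proof.
move=> cs s0 mf f0; pose t := ((1 - c) / s)%R.
pose h1 (y : M) : M := (- t * y + t * b.2)%R.
pose h2 (x : M) : M := (s * x + - s * b.1)%R.
have mh1 : measurable_fun setT h1 by exact: measurable_affine.
have mh2 : measurable_fun setT h2 by exact: measurable_affine.
have ms1 : measurable_fun setT (fun z : M * M => ((z.1 + h1 z.2)%R : M, z.2)).
  apply: measurable_fun_pair; last exact: measurable_snd.
  by apply: measurable_funD; [exact: measurable_fst|exact: measurableT_comp mh1 measurable_snd].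
have ms2 : measurable_fun setT (fun z : M * M => (z.1, (z.2 + h2 z.1)%R : M)).
  apply: measurable_fun_pair; first exact: measurable_fst.
  by apply: measurable_funD; [exact: measurable_snd|exact: measurableT_comp mh2 measurable_fst].
rewrite -[RHS](integral_shear1 mh1 mf f0).
have mf1 := measurableT_comp mf ms1.
rewrite -[RHS](integral_shear2 mh2 mf1 (fun z => f0 _)).
have mf2 := measurableT_comp mf1 ms2.
rewrite -[RHS](integral_shear1 mh1 mf2 (fun z => f0 _)).
apply: eq_integral => -[x y] _ /=; congr f.
have st : (s * t = 1 - c)%R by rewrite /t mulrC divfK.
have tc : (t * (1 + c) = s)%R.
  apply: (mulfI s0); rewrite mulrA st -expr2.
  by move: cs; clear; lra.
rewrite /rotate/= /h1 /h2; congr pair; last first.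
  by rewrite -[in LHS](subKr 1%R c) -st; ring.
transitivity (b.1 + ((1 - s * t) * (x - b.1) - t * (1 + c) * (y - b.2)))%R.
  by rewrite st tc; ring.
by rewrite -[in LHS](subKr 1%R c) -st; ring.
Qed.

Definition bdisc (b : M * M) (r : R) : set (M * M) :=
  [set u | ((u.1 - b.1) ^+ 2 + (u.2 - b.2) ^+ 2 <= r ^+ 2)%R].

Lemma measurable_bdisc b r : measurable (bdisc b r).
Proof.
rewrite -[X in measurable X]setTI.
have : measurable_fun setT (fun u : M * M => ((u.1 - b.1) ^+ 2 + (u.2 - b.2) ^+ 2)%R : M).
  by apply: measurable_funD; apply: measurable_funX; apply: measurable_funB;
    rewrite //; exact: measurable_cst.
move=> /(_ measurableT _ (measurable_itv `]-oo, (r ^+ 2)%R])).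
by rewrite (_ : _ @^-1` _ = bdisc b r)//;
   apply/seteqP; split => u; rewrite /bdisc/= in_itv.
Qed.

Lemma area_bdisc_half b (r : R) :
  area (bdisc b (Num.sqrt 2 * r)) = 2%:E * area (bdisc b r).
Proof.
pose s : R := Num.sqrt 2; have s0 : (0 < s)%R by rewrite sqrtr_gt0.
pose phi (z : M * M) : M * M := ((s * z.1 + (b.1 - s * b.1))%R,
  (s * z.2 + (b.2 - s * b.2))%R).
pose f z := (\1_(bdisc b (Num.sqrt 2 * r)) z)%:E : \bar R.
have mf : measurable_fun setT f.
  by apply/measurable_EFinP; exact: measurable_indic (measurable_bdisc _ _).
have f0 z : 0 <= f z by rewrite lee_fin.
have mphi : measurable_fun setT phi.
  apply: measurable_fun_pair.
    exact: measurableT_comp (measurable_affine _ _) measurable_fst.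
  exact: measurableT_comp (measurable_affine _ _) measurable_snd.
have mfphi := measurableT_comp mf mphi.
have int_f : \int[area]_z f z = area (bdisc b (Num.sqrt 2 * r)).
  by rewrite integral_indic ?setIT//; exact: measurable_bdisc.
have int_fphi : \int[area]_z f (phi z) = area (bdisc b r).
  rewrite -[bdisc b r]setIT -integral_indic//; last exact: measurable_bdisc.
  apply: eq_integral => z _; rewrite /f !indicE; congr (_%:R%:E).
  congr nat_of_bool.
  have sq (x y : R) : ((s * x + (y - s * y) - y) ^+ 2 = 2 * (x - y) ^+ 2)%R.
    have ss : (s ^+ 2 = 2)%R by rewrite sqr_sqrtr.
    by rewrite -ss; ring.
  apply/idP/idP; rewrite !inE /bdisc/= !sq exprMn sqr_sqrtr//.
    by rewrite -mulrDr ler_pM2l.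
  by rewrite -mulrDr ler_pM2l.
rewrite -int_f -int_fphi [in LHS](fubini_tonelli2 _ mf f0).
rewrite [in RHS](fubini_tonelli2 _ mfphi (fun z => f0 _)).
pose F y := \int[lambda]_x f (x, y).
have mF : measurable_fun setT F by exact: measurable_fun_fubini_tonelli_G.
have F0 y : 0 <= F y by exact: integral_ge0.
transitivity (\int[lambda]_y F y); first by [].
rewrite -(integral_affine (b.2 - s * b.2)%R s0 mF F0).
have s22 : 2%:E = s%:E * s%:E :> \bar R.
  by rewrite -EFinM -expr2 /= sqr_sqrtr.
rewrite s22 -muleA; congr (_ * _).
rewrite -ge0_integralZl//; last 3 first.
- exact: (measurable_fun_fubini_tonelli_G _ mfphi (fun z => f0 _)).
- by move=> y _; apply: integral_ge0 => x _; exact: f0.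
- by rewrite lee_fin ltW.
apply: eq_integral => y _; rewrite /fubini_G/=.
rewrite /F -(integral_affine (b.1 - s * b.1)%R s0
  (f := fun x => f (x, (s * y + (b.2 - s * b.2))%R)))//.
exact: measurableT_comp mf (measurable_pair2 _).
Qed.

End PlaneMeasure.

(** * Averages over equally spaced rotations *)

Section RootsOfUnity.
Context {R : realType}.
Implicit Types (z w : Cplx R) (a t : R).

Definition cis t : Cplx R := Complex (cos t) (sin t).

Lemma cisD a t : cis (a + t) = cis a * cis t.
Proof. by rewrite /cis cosD sinD; congr Complex; rewrite addrC. Qed.

Lemma normc_cis t : normc (cis t) = 1.
Proof. by rewrite /= cos2Dsin2 sqrtr1. Qed.

Lemma cisD2pi a : cis (a + pi *+ 2) = cis a.
Proof. by rewrite cisD /cis cos2pi sin2pi mulr1. Qed.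

Lemma cis_surj w : normc w = 1 -> exists2 t, 0 <= t & w = cis t.
Proof.
move=> w1; have := normc_sqr w; rewrite w1 expr1n.
case: w {w1} => x y /= xy.
have x1 : -1 <= x <= 1.
  by rewrite -ler_norml -(@ler_sqr _ `|x|) ?nnegrE// real_normK ?num_real// expr1n xy lerDl sqr_ge0.
have y2 : 1 - x ^+ 2 = y ^+ 2 by rewrite xy addrAC subrr add0r.
have [y0|y0] := leP 0 y.
  exists (acos x); first exact: acos_ge0.
  by rewrite /cis acosK ?in_itv// sin_acos// y2 sqrtr_sqr ger0_norm.
exists (pi *+ 2 - acos x).
  have := acos_lepi x1; have := @pi_ge0 R; rewrite mulr2n; clear; lra.
rewrite /cis cosB sinB cos2pi sin2pi mul1r !mul0r addr0 sub0r acosK ?in_itv//.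
by rewrite sin_acos// y2 sqrtr_sqr ltr0_norm// mul1r opprK.
Qed.

Lemma cis_near1 (d : R) : 0 < d -> exists2 e : R, 0 < e &
  forall t, 0 <= t < e -> normc (cis t - 1) < d.
Proof.
move=> d0; have d2 : 0 < d / 2 by rewrite divr_gt0.
have /(_ _ (nbhsx_ballx _ _ d2))/nbhs_ballP[e1 e10 e1P] := @continuous_cos R 0.
have /(_ _ (nbhsx_ballx _ _ d2))/nbhs_ballP[e2 e20 e2P] := @continuous_sin R 0.
exists (Num.min e1 e2); first by rewrite lt_min e10 e20.
move=> t /andP[t0]; rewrite lt_min => /andP[t1 t2].
have c1 : `|cos t - 1| < d / 2.
  have /e1P : ball 0 e1 t by rewrite /ball/= sub0r normrN ger0_norm.
  by rewrite /ball/= cos0 distrC.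
have s1 : `|sin t| < d / 2.
  have /e2P : ball 0 e2 t by rewrite /ball/= sub0r normrN ger0_norm.
  by rewrite /ball/= sin0 sub0r normrN.
apply: le_lt_trans (normc_le_sum _) _; rewrite [ltRHS]splitr ltrD//=.
by rewrite subr0.
Qed.

Lemma sum_shift_periodic (V : nmodType) (F : nat -> V) N j :
  (forall k, F (k + N)%N = F k) -> \sum_(k < N) F (k + j)%N = \sum_(k < N) F k.
Proof.
move=> FN; elim: j => [|j <-]; first by apply: eq_bigr => k _; rewrite addn0.
case: N FN => [|N] FN; first by rewrite !big_ord0.
rewrite big_ord_recr [RHS]big_ord_recl /= addrC; congr (_ + _).
  by rewrite add0n addnC -[RHS]FN addnS addSn.
by apply: eq_bigr => k _; rewrite /bump leq0n add1n addSnnS.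
Qed.

(** The average of [u] over [N] equally spaced rotations is almost rotation
    invariant when [u] is uniformly continuous and [N] is large. *)
Lemma rotation_average_osc (u : Cplx R -> R) (r e : R) : 0 <= r ->
  (exists2 d : R, 0 < d & forall z w, normc z <= r -> normc w <= r ->
     normc (z - w) < d -> u z <= u w + e) ->
  exists2 N, (2 < N)%N & forall z w, normc z = normc w -> normc w <= r ->
    \sum_(k < N) u (cis (k%:R * (pi *+ 2 / N%:R)) * z) <=
    \sum_(k < N) u (cis (k%:R * (pi *+ 2 / N%:R)) * w) + N%:R * e.
Proof.
move=> r0 [d d0 dP].
have r1 : 0 < r + 1 by rewrite ltr_wpDl.
have [|e' e'0 e'P] := @cis_near1 (d / (r + 1)); first by rewrite divr_gt0.
have pi2 : 0 < pi *+ 2 :> R by rewrite mulrn_wgt0// pi_gt0.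
(* at least three rotations, so that the angle is less than [pi] *)
pose N := (Num.truncn (pi *+ 2 / e')).+3.
have N0 : 0 < N%:R :> R by rewrite ltr0n.
pose t : R := pi *+ 2 / N%:R.
have t0 : 0 < t by rewrite divr_gt0.
have te : t < e'.
  rewrite ltr_pdivrMr// mulrC -ltr_pdivrMr//.
  have /truncn_itv/andP[_ lt] : 0 <= pi *+ 2 / e' by rewrite divr_ge0// ltW.
  by apply: lt_le_trans lt _; rewrite ler_nat /N ltnS ltnW.
exists N => // z w zw wr; rewrite -/t.
have [w0|w0] := eqVneq w 0.
  have -> : z = w by rewrite w0; apply: eq0_normc; rewrite zw w0 normc0.
  rewrite lerDl mulr_ge0//; last by have := dP 0 0; rewrite subrr normc0 lerDl; exact.
have [|phi phi0 wphi] := @cis_surj (z / w).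
  by rewrite normcM normcV zw divff// normc_eq0.
(* [z] is [w] turned by [j] steps, which permute the terms of the sum, and by an
   angle [alpha] smaller than a step *)
pose j := Num.truncn (phi / t); pose alpha := phi - j%:R * t.
have alpha_t : 0 <= alpha < t.
  have /truncn_itv : 0 <= phi / t by rewrite divr_ge0// ltW.
  rewrite -/j ler_pdivlMr// ltr_pdivrMr// /alpha -natr1 mulrDl mul1r.
  by clear; lra.
have zE : z = cis (j%:R * t) * (cis alpha * w).
  by rewrite mulrA -cisD /alpha addrC subrK -wphi divfK.
pose F k := u (cis (k%:R * t) * w).
have FN k : F (k + N)%N = F k.
  by rewrite /F natrD mulrDl [N%:R * t]mulrC divfK ?gt_eqF// cisD2pi.
rewrite -(sum_shift_periodic j FN) /F.
have -> : N%:R * e = \sum_(k < N) e by rewrite sumr_const card_ord mulr_natl.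
rewrite -big_split/=; apply: ler_sum => k _.
have norm_cis s v : normc (cis s * v) = normc v by rewrite normcM normc_cis mul1r.
apply: dP; rewrite ?norm_cis ?zw//.
have -> : cis (k%:R * t) * z - cis ((k + j)%:R * t) * w =
    cis (k%:R * t) * (cis (j%:R * t) * ((cis alpha - 1) * w)).
  by rewrite natrD mulrDl cisD zE; ring.
rewrite !norm_cis normcM; apply: (@le_lt_trans _ _ (normc (cis alpha - 1) * (r + 1))).
  rewrite ler_wpM2l ?normc_ge0//; apply: le_trans wr _; by rewrite lerDl.
by rewrite -ltr_pdivlMr//; apply: e'P; case/andP: alpha_t => -> /lt_trans/(_ te).
Qed.

End RootsOfUnity.

Section RotationInvariance.
Context {R : realType}.
Local Notation M := (measurableTypeR R).
Local Notation area := (@area_measure R).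
Implicit Types (b : M * M).

Lemma uniform_continuity_disc (u : Cplx R -> R) (r e : R) : 0 <= r -> 0 < e ->
  (forall z, normc z <= r -> {for z, continuous u}) ->
  exists2 d : R, 0 < d & forall z w, normc z <= r -> normc w <= r ->
    normc (z - w) < d -> u z <= u w + e.
Proof.
move=> r0 e0 cu.
pose P (d : R) (x : R * R) := disc r x -> forall w, normc w <= r ->
  normc (to_cplx x - w) < d -> `|u (to_cplx x) - u w| <= e.
have cover : near_covering (disc r) by apply/compact_near_coveringP/compact_disc.
have nearP : \forall d \near 0^'+, disc r `<=` P d.
  apply: cover => x xr.
  have zr : normc (to_cplx x) <= r by apply/(discE _ r0).
  have e2 : 0 < e / 2 by rewrite divr_gt0.
  have /nbhs_normcP[d d0 dP] := cu _ zr _ (nbhsx_ballx _ _ e2).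
  have d2 : 0 < d / 2 by rewrite divr_gt0.
  exists ([set x' | normc (to_cplx x' - to_cplx x) < d / 2], [set d' | d' < d / 2]) => /=.
    split.
      apply: (@continuous_to_cplx R x (fun z => normc (z - to_cplx x) < d / 2)).
      by apply/nbhs_normcP; exists (d / 2).
    exact: nbhs_right_lt.
  move=> [x' d'] /= [xx' d'd] _ w wr ww.
  have xw : normc (w - to_cplx x) < d.
    rewrite -(subrKA (to_cplx x')); apply: le_lt_trans (normcD _ _) _.
    rewrite [ltRHS]splitr ltrD// normc_sub; exact: lt_trans ww d'd.
  have xx'd : normc (to_cplx x' - to_cplx x) < d.
    by apply: lt_trans xx' _; rewrite ltr_pdivrMr// ltr_pMr// ltr1n.
  have := dP _ xw; have := dP _ xx'd; rewrite /ball/= => u1 u2.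
  rewrite -(subrKA (u (to_cplx x))); apply: le_trans (ler_normD _ _) _.
  by rewrite [leRHS]splitr lerD// ltW// distrC.
have [d [dP d0]] : exists d : R, (disc r `<=` P d) /\ 0 < d.
  apply: (@filter_ex _ (0 : R)^'+); apply: filterI => //.
  exact: nbhs_right_gt.
exists d => // -[x y] w zr wr zw.
have zD : disc r (x, y) by apply/(discE _ r0).
have := dP (x, y) zD zD w wr zw.
by rewrite ler_norml => /andP[_]; rewrite lerBlDl.
Qed.

Definition centered b (x : M * M) : Cplx R := to_cplx (x.1 - b.1, x.2 - b.2).

Lemma centered_rotate b t x :
  centered b (rotate b (cos t) (sin t) x) = cis t * centered b x.
Proof.
rewrite /centered /rotate /cis /to_cplx /=.
by congr Complex; rewrite addrAC subrr add0r// addrC.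
Qed.

Lemma bdiscE b r x : 0 <= r -> bdisc b r x <-> normc (centered b x) <= r.
Proof.
move=> r0; rewrite -(discE (x.1 - b.1, x.2 - b.2) r0); by [].
Qed.

Lemma rotate_cisD b a t x : rotate b (cos a) (sin a) (rotate b (cos t) (sin t) x) =
  rotate b (cos (a + t)) (sin (a + t)) x.
Proof.
rewrite /rotate /= cosD sinD; congr pair; ring.
Qed.

Lemma measurable_rotate b (c s : R) : measurable_fun setT (rotate b c s).
Proof.
have mc : measurable_fun setT (fun z : M * M => (z.1 - b.1 : M)).
  by apply: measurable_funB; [exact: measurable_fst|exact: measurable_cst].
have ms : measurable_fun setT (fun z : M * M => (z.2 - b.2 : M)).
  by apply: measurable_funB; [exact: measurable_snd|exact: measurable_cst].
have mk (k : R) (h : M * M -> M) : measurable_fun setT h ->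
    measurable_fun setT (fun z => k * h z : M).
  by move=> mh; apply: measurable_funM => //; exact: measurable_cst.
apply: measurable_fun_pair; (apply: measurable_funD; first exact: measurable_cst).
  by apply: measurable_funB; exact: mk.
by apply: measurable_funD; exact: mk.
Qed.

(** The general rotation is an iterate of the one by the angle [t], because
    [integral_rotate] only deals with a nonzero sine. *)
Lemma integral_rotate_iter b (t : R) (D : set (M * M)) (f : M * M -> \bar R) k :
  sin t != 0 -> measurable D ->
  (forall s x, D (rotate b (cos s) (sin s) x) <-> D x) ->
  measurable_fun D f -> (forall x, D x -> 0 <= f x)%E ->
  measurable_fun D (fun x => f (rotate b (cos (k%:R * t)) (sin (k%:R * t)) x)) /\
  (\int[area]_(x in D) f (rotate b (cos (k%:R * t)) (sin (k%:R * t)) x) =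
   \int[area]_(x in D) f x)%E.
Proof.
move=> s0 mD rotD mf f0; rewrite [in X in _ /\ X]integral_mkcond [RHS]integral_mkcond.
pose g := f \_ D.
have mg : measurable_fun setT g by apply/(measurable_restrictT _ mD).
have g0 x : (0 <= g x)%E by apply: erestrict_ge0.
have gE s x : ((fun x => f (rotate b (cos s) (sin s) x)) \_ D) x =
    g (rotate b (cos s) (sin s) x).
  rewrite /g /patch; congr (if _ then _ else _).
  by apply/idP/idP; rewrite !inE rotD.
have {gE}gE s : (fun x => f (rotate b (cos s) (sin s) x)) \_ D =
    g \o rotate b (cos s) (sin s) by apply/funext => x; exact: gE.
split.
  apply/(measurable_restrictT _ mD); rewrite gE.
  by apply: measurableT_comp => //; exact: measurable_rotate.
rewrite gE; elim: k => [|k <-].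
  rewrite mul0r cos0 sin0; apply: eq_integral => x _ /=; congr g.
  by case: x => x y; rewrite /rotate/=; congr pair; ring.
rewrite -[RHS](@integral_rotate R b (cos t) (sin t))//; last 3 first.
- exact: cos2Dsin2.
- by apply: measurableT_comp => //; exact: measurable_rotate.
- by move=> z; exact: g0.
by apply: eq_integral => x _ /=; rewrite rotate_cisD -natr1 mulrDl mul1r.
Qed.

End RotationInvariance.

(** * A disc against an annulus of the same area *)

Section DiscInequality.
Context {R : realType}.
Local Notation M := (measurableTypeR R).
Local Notation area := (@area_measure R).
Implicit Types (b : M * M).

Lemma bdisc_finite b (r : R) : 0 <= r -> (area (bdisc b r) < +oo)%E.
Proof.
move=> r0.
apply: (@le_lt_trans _ _ (area (`[b.1 - r, b.1 + r] `*` `[b.2 - r, b.2 + r]))).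
  apply: le_measure; rewrite ?inE.
  - exact: measurable_bdisc.
  - by apply: measurableX; exact: measurable_itv.
  - move=> x /(bdiscE _ _ r0) xr; split; rewrite /= in_itv/= -ler_distl; apply: le_trans xr.
      exact: (Re_le_normc (centered b x)).
    exact: (Im_le_normc (centered b x)).
rewrite [X in (X < _)%E](@product_measure1E _ _ _ _ R lebesgue_measure lebesgue_measure)//.
rewrite lte_mul_pinfty//=; rewrite !lebesgue_measure_itv/= ?lte_fin.
  by case: ifP => _; rewrite -?EFinD.
by case: ifP => _; rewrite -?EFinD ltry.
Qed.

Lemma area_annulus b (r : R) : 0 <= r ->
  area (bdisc b (Num.sqrt 2 * r) `\` bdisc b r) = area (bdisc b r).
Proof.
move=> r0; have r20 : 0 <= Num.sqrt 2 * r :> R by rewrite mulr_ge0.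
have sub : bdisc b r `<=` bdisc b (Num.sqrt 2 * r).
  move=> x; rewrite /bdisc/= exprMn sqr_sqrtr// => /le_trans; apply.
  by rewrite ler_peMl ?sqr_ge0// ler1n.
transitivity (area (bdisc b (Num.sqrt 2 * r)) - area (bdisc b r))%E.
  rewrite [LHS]measureD//; [|exact: measurable_bdisc|exact: measurable_bdisc|exact: bdisc_finite].
  by rewrite setIidr.
rewrite area_bdisc_half.
have : area (bdisc b r) \is a fin_num by rewrite ge0_fin_numE// bdisc_finite.
by move=> /fineK <-; rewrite -EFinM -EFinB; congr EFin; clear; lra.
Qed.

(** The zeros of [f] need a separate argument, since [powR] is not differentiable
    at [0] for small exponents. *)
Lemma continuous_powR_ge0 (T : topologicalType) (f : T -> R) (p : R) x : 0 < p ->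
  (forall y, 0 <= f y) -> {for x, continuous f} ->
  {for x, continuous (fun y => f y `^ p)}.
Proof.
move=> p0 f0 cf; have [fx0|fx0] := eqVneq (f x) 0; last first.
  have fx_gt0 : 0 < f x by rewrite lt_def fx0 f0.
  have cp : {for f x, continuous (@powR R ^~ p)}.
    apply: differentiable_continuous.
    apply: (@derivable1_diffP R R^o (@powR R ^~ p) (f x)).1.
    by apply: derivable_powR; rewrite in_itv/= fx_gt0.
  exact: (continuous_comp cf cp).
move=> P /nbhs_ballP[e /= e0 eP].
have e'0 : 0 < e `^ p^-1 by exact: powR_gt0.
have cfP : nbhs x (f @^-1` ball (f x) (e `^ p^-1)).
  exact: (cf _ (nbhsx_ballx _ _ e'0)).
apply: (filterS _ cfP) => y.
rewrite /ball/= fx0 sub0r normrN ger0_norm// => fy; apply: eP.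
rewrite /ball/= fx0 powR0 ?gt_eqF// sub0r normrN ger0_norm ?powR_ge0//.
have := gt0_ltr_powR p0 (f0 y) (ltW e'0) fy.
by rewrite -powRrM mulVf ?gt_eqF// powRr1// ltW.
Qed.

Lemma sum_cst_ge0 (x : \bar R) n : (0 <= x -> \sum_(k < n) x = n%:R%:E * x)%E.
Proof.
move=> x0; elim: n => [|n IH]; first by rewrite big_ord0 mul0e.
by rewrite big_ord_recr/= IH -natr1 EFinD ge0_muleDl ?lee_fin// mul1e.
Qed.

(** The discs [bdisc b r] and [bdisc b (Num.sqrt 2 * r)] bound an annulus with the
    area of the smaller disc. Averaging over many rotations makes [normc G `^ p]
    nearly a function of the radius, and the maximum principle makes this function
    nondecreasing. *)
Theorem disc_inequality b (r p : R) (G : Cplx R -> Cplx R) : 0 < p -> 0 < r ->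
  (forall z, normc z <= Num.sqrt 2 * r -> cdiff G z) ->
  measurable_fun (bdisc b (Num.sqrt 2 * r)) (fun x => (normc (G (centered b x)) `^ p)%:E) ->
  (\int[area]_(x in bdisc b r) (normc (G (centered b x)) `^ p)%:E <=
   \int[area]_(x in bdisc b (Num.sqrt 2 * r) `\` bdisc b r)
      (normc (G (centered b x)) `^ p)%:E)%E.
Proof.
move=> p0 r0 dG mG; set r' := Num.sqrt 2 * r in dG mG *.
have rr' : r < r' by rewrite /r' ltr_pMl// -[ltLHS]sqrtr1 ltr_sqrt// ltr1n.
have r'0 : 0 <= r' by exact: le_trans (ltW r0) (ltW rr').
pose u z := normc (G z) `^ p.
pose F := bdisc b r; pose E := bdisc b r' `\` bdisc b r.
have mF : measurable F by exact: measurable_bdisc.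
have mE : measurable E by apply: measurableD; exact: measurable_bdisc.
have FE : area E = area F by rewrite /E /F area_annulus// ltW.
have Ffin : area F \is a fin_num by rewrite ge0_fin_numE// bdisc_finite// ltW.
have Fr' : F `<=` bdisc b r'.
  by move=> x /(bdiscE _ _ (ltW r0)) xr; apply/(bdiscE _ _ r'0); exact: le_trans (ltW rr').
have mu_F : measurable_fun F (fun x => (u (centered b x))%:E).
  by apply: measurable_funS mG => //; exact: measurable_bdisc.
have mu_E : measurable_fun E (fun x => (u (centered b x))%:E).
  by apply: measurable_funS mG; [exact: measurable_bdisc|exact: subDsetl].
have rotB s rho x : 0 <= rho ->
    bdisc b rho (rotate b (cos s) (sin s) x) <-> bdisc b rho x.
  by move=> rho0; rewrite !bdiscE// centered_rotate normcM normc_cis mul1r.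
have rotF s x : F (rotate b (cos s) (sin s) x) <-> F x by apply: rotB; exact: ltW.
have rotE s x : E (rotate b (cos s) (sin s) x) <-> E x.
  by rewrite /E /setD/= (rotB s r' x r'0) (rotB s r x (ltW r0)).
have cu z : normc z <= r' -> {for z, continuous u}.
  move=> zr; have c1 : {for z, continuous (fun z => normc (G z))}.
    apply: (@continuous_comp _ _ _ G (@normc R)); last exact: continuous_normc.
    exact/cdiff_continuous/dG.
  exact: (@continuous_powR_ge0 _ (fun z => normc (G z)) p z p0 (fun w => normc_ge0 (G w)) c1).
apply/lee_addgt0Pr => e' e'0.
pose A := fine (area F); have A0 : 0 <= A by exact: fine_ge0.
pose e := e' / (A + 1); have e0 : 0 < e by rewrite divr_gt0// ltr_wpDl.
have [N N2 Nosc] := rotation_average_osc r'0 (uniform_continuity_disc r'0 e0 cu).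
set t := pi *+ 2 / N%:R in Nosc.
have N0 : 0 < N%:R :> R by rewrite ltr0n; exact: leq_trans N2.
have st : sin t != 0.
  rewrite gt_eqF//; apply: sin_gt0_pi; apply/andP; split.
    by rewrite divr_gt0// mulrn_wgt0// pi_gt0.
  by rewrite ltr_pdivrMr// -[pi *+ 2]mulr_natr ltr_pM2l ?pi_gt0// ltr_nat.
pose V x := \sum_(k < N) u (cis (k%:R * t) * centered b x).
have V0 x : 0 <= V x by apply: sumr_ge0 => k _; exact: powR_ge0.
(* the maximum principle on the circle through [y], on which [V] almost takes a
   single value *)
have VFE x y : F x -> E y -> V x <= V y + N%:R * e.
  move=> /(bdiscE _ _ (ltW r0)) xr [/(bdiscE _ _ r'0) yr' yr].
  have xy : normc (centered b x) <= normc (centered b y).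
    apply: le_trans xr _; rewrite leNgt; apply/negP => lt; apply: yr.
    by apply/(bdiscE _ _ (ltW r0)); exact: ltW.
  have norm_cis s v : normc (cis s * v) = normc v :> R by rewrite normcM normc_cis mul1r.
  apply: (@sum_maximum_principle R 'I_N (fun k z => G (cis (k%:R * t) * z)) p
    (normc (centered b y))) => // [|k z zy|z zy]; first exact: normc_ge0.
    apply: (@cdiff_comp _ (fun z => cis (k%:R * t) * z) G).
      by apply: cdiffM; [exact: cdiff_cst|exact: cdiff_id].
    by apply: dG; rewrite norm_cis; exact: le_trans yr'.
  exact: Nosc.
pose C := inf [set V y | y in E].
have E0 : E !=set0.
  exists (b.1 + r', b.2); split; rewrite /bdisc/= addrAC subrr add0r subrr expr0n/= addr0//.
  by apply/negP; rewrite -ltNge ltrXn2r// ltW.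
have hC : has_inf [set V y | y in E].
  split; first by case: E0 => y Ey; exists (V y); exists y.
  by exists 0 => _ [y _ <-].
have VC x : F x -> V x <= C + N%:R * e.
  move=> Fx; rewrite -lerBlDr; apply: lb_le_inf; first by case: hC.
  by move=> _ [y Ey <-]; rewrite lerBlDr; exact: VFE.
have CV y : E y -> C <= V y.
  by move=> Ey; apply: ge_inf; [by case: hC|exists y].
have intV (D : set (M * M)) : measurable D ->
    (forall s x, D (rotate b (cos s) (sin s) x) <-> D x) ->
    measurable_fun D (fun x => (u (centered b x))%:E) ->
    measurable_fun D (fun x => (V x)%:E) /\
    (\int[area]_(x in D) (V x)%:E = N%:R%:E * \int[area]_(x in D) (u (centered b x))%:E)%E.
  move=> mD rotD mu_D.
  have uk0 x : D x -> (0 <= (u (centered b x))%:E)%E by rewrite lee_fin powR_ge0.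
  have kP (k : nat) := integral_rotate_iter k st mD rotD mu_D
    (fun x _ => (powR_ge0 _ _ : (0 <= (u (centered b x))%:E)%E)).
  have VE : (fun x => (V x)%:E) = (fun x => \sum_(k < N)
      (u (centered b (rotate b (cos (k%:R * t)) (sin (k%:R * t)) x)))%:E)%E.
    apply/funext => x; rewrite sumEFin; congr EFin; apply: eq_bigr => k _.
    by rewrite centered_rotate.
  rewrite VE; split.
    by apply: emeasurable_sum => k; case: (kP k).
  rewrite ge0_integral_sum//; last 2 first.
  - by move=> k; case: (kP k).
  - by move=> k x _; rewrite lee_fin powR_ge0.
  rewrite (eq_bigr (fun=> \int[area]_(x in D) (u (centered b x))%:E)%E); last first.
    by move=> k _; case: (kP k).
  exact: sum_cst_ge0 (integral_ge0 _ uk0).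
have [mVF intF] := intV F mF rotF mu_F; have [mVE intE] := intV E mE rotE mu_E.
have FleC : (N%:R%:E * \int[area]_(x in F) (u (centered b x))%:E <= (C + N%:R * e)%:E * area F)%E.
  rewrite -intF -integral_cst//; apply: ge0_le_integral => //.
  by move=> x _; rewrite lee_fin.
have CleE : (C%:E * area F <= N%:R%:E * \int[area]_(x in E) (u (centered b x))%:E)%E.
  rewrite -intE -FE -integral_cst//; apply: ge0_le_integral => //.
  by move=> x Ex; rewrite lee_fin; apply: lb_le_inf; [case: hC|move=> _ [y _ <-]].
have AE : area F = A%:E by rewrite /A fineK.
rewrite AE in FleC CleE; move: FleC CleE.
have : (0 <= \int[area]_(x in E) (u (centered b x))%:E)%E.
  by apply: integral_ge0 => x _; rewrite lee_fin powR_ge0.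
rewrite -/F -/E -/u; move: (\int[area]_(x in F) _)%E (\int[area]_(x in E) _)%E => X Y Y0.
rewrite -!EFinM mulrDl => FleC CleE; rewrite -(@lee_pmul2l _ N%:R%:E)//.
apply: le_trans FleC _; rewrite ge0_muleDr ?lee_fin ?(ltW e'0)// EFinD.
apply: leeD => //; rewrite -EFinM lee_fin -mulrA ler_pM2l// /e mulrAC ler_pdivrMr ?ltr_wpDl//.
by rewrite ler_pM2l// lerDl.
Qed.

End DiscInequality.

(** * Boxes and Lebesgue measure in several variables *)

Section BoxesCn.
Context {R : realType} {n : nat}.
Local Notation M := (measurableTypeR R).
Local Notation Cn := 'rV[Cplx R]_n.
Implicit Types (t s : Cn) (S : 'I_n -> set (M * M)).

Definition coord (j : 'I_n) t : M * M := (complex.Re (t 0 j), complex.Im (t 0 j)).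

Lemma coord_Cn_of_real (x : n.-tuple (M * M)) j : coord j (Cn_of_real x) = tnth x j.
Proof. by rewrite /coord mxE; case: (tnth x j). Qed.

Definition box S : set Cn := [set t | forall j, S j (coord j t)].

(** Comparing real coordinates strictly defines the topology of the sup norm, and
    is easier to handle than moduli of complex coordinates. *)
Definition near_coord (r : R) t s := forall j,
  `|(coord j s).1 - (coord j t).1| < r /\ `|(coord j s).2 - (coord j t).2| < r.

Lemma ball_near_coord (r : R) t s : ball t r%:C%C s -> near_coord r t s.
Proof.
move=> [_ ts] j; have := ts 0 j.
change ((normc (t 0 j - s 0 j))%:C%C < r%:C%C -> `|(coord j s).1 - (coord j t).1| < r /\
  `|(coord j s).2 - (coord j t).2| < r); rewrite ltcR normc_sub => ts'.
split; apply: le_lt_trans ts'; rewrite /coord/=.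
  by apply: le_trans (Re_le_normc _); case: (t 0 j) (s 0 j) => a b [c d].
by apply: le_trans (Im_le_normc _); case: (t 0 j) (s 0 j) => a b [c d].
Qed.

Lemma nbhs_Cn t (U : set Cn) :
  nbhs t U <-> exists2 r : R, 0 < r & forall s, near_coord r t s -> U s.
Proof.
split.
  move=> /nbhs_ballP[e e0 eU]; move: e e0 eU => [r i]; rewrite /= ltcE/= => /andP[/eqP-> r0] eU.
  exists (r / 2); first by rewrite divr_gt0.
  move=> s st; apply: eU; split => [|i' j]; first by rewrite ltcR.
  change (`|t i' j - s i' j| < r%:C%C); rewrite (ord1 i').
  change ((normc (t 0 j - s 0 j))%:C%C < r%:C%C); rewrite ltcR normc_sub.
  apply: le_lt_trans (normc_le_sum _) _; have [s1 s2] := st j.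
  rewrite [ltRHS]splitr; move: s1 s2; rewrite /coord/=.
  by case: (t 0 j) (s 0 j) => a b [c d] /= ? ?; exact: ltrD.
move=> [r r0 rU]; apply/nbhs_ballP; exists r%:C%C; first by rewrite /= ltcR.
by move=> s /ball_near_coord; exact: rU.
Qed.

Lemma open_CnP (U : set Cn) : open U <->
  forall t, U t -> exists2 r : R, 0 < r & forall s, near_coord r t s -> U s.
Proof.
rewrite openE; split => oU t Ut.
  by apply/nbhs_Cn; exact: oU.
by apply/nbhs_Cn; exact: oU.
Qed.

Lemma measurable_fun_open_preimages (f : Cn -> M) :
  (forall a, open (f @^-1` `]a, +oo[)) -> measurable_fun setT f.
Proof.
move=> fo; apply: (measurability _ (RGenOInfty.measurableE R)) => _ [_ [a ->] <-].
by rewrite setTI; exact: open_measurable_Cn.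
Qed.

Lemma measurable_coord j : measurable_fun setT (coord j).
Proof.
apply: measurable_fun_pair; apply: measurable_fun_open_preimages => a; apply/open_CnP => t.
  rewrite /= in_itv/= andbT => at'; exists (complex.Re (t 0 j) - a); first by rewrite subr_gt0.
  move=> s /(_ j)[]; rewrite /= in_itv/= andbT ltr_norml => /andP[+ _] _.
  by clear; lra.
rewrite /= in_itv/= andbT => at'; exists (complex.Im (t 0 j) - a); first by rewrite subr_gt0.
move=> s /(_ j)[_]; rewrite /= in_itv/= andbT ltr_norml => /andP[+ _].
by clear; lra.
Qed.

Lemma measurable_box S : (forall j, measurable (S j)) -> measurable (box S).
Proof.
move=> mS; rewrite (_ : box S = \bigcap_(j in [set: 'I_n]) (coord j @^-1` S j)).
  apply: fin_bigcap_measurable => // j _; rewrite -[X in measurable X]setTI.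
  exact: measurable_coord.
by apply/seteqP; split => t tS j; [move=> _; exact: tS|exact: tS].
Qed.

End BoxesCn.

Section BoxMeasure.
Context {R : realType}.
Local Notation M := (measurableTypeR R).
Local Notation area := (@area_measure R).

Lemma product_power_box n (S : 'I_n -> set (M * M)) : (forall j, measurable (S j)) ->
  product_power area n [set x | forall j, S j (tnth x j)] = (\prod_j area (S j))%E.
Proof.
elim: n S => [|n IH] S mS.
  rewrite big_ord0 /= /dirac indicE mem_set//.
  by case.
transitivity ((area \x product_power area n)%E
  (S ord0 `*` [set x | forall j, S (lift ord0 j) (tnth x j)])).
  rewrite /= /tcons_measure /pushforward; congr (_ _).
  apply/seteqP; split => -[z x]/=.
    move=> h; split; first exact: (h ord0).
    by move=> j /=; have := h (lift ord0 j); rewrite tnthS.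
  move=> [z0 h] j; case: (unliftP ord0 j) => [i|] ->; last by rewrite tnth0.
  by rewrite tnthS; exact: h.
rewrite product_measure1E//; first by rewrite (IH (fun j => S (lift ord0 j)))// big_ord_recl.
rewrite (_ : [set x | _] = \bigcap_(j in [set: 'I_n])
  ((fun x : n.-tuple (M * M) => tnth x j) @^-1` S (lift ord0 j))).
  apply: fin_bigcap_measurable => // j _; rewrite -[X in measurable X]setTI.
  exact: measurable_tnth.
by apply/seteqP; split => t tS j; [move=> _; exact: tS|exact: tS].
Qed.

Lemma lebesgue_Cn_box n (S : 'I_n -> set (M * M)) : (forall j, measurable (S j)) ->
  lebesgue_Cn (box S) = (\prod_j area (S j))%E.
Proof.
move=> mS; rewrite -product_power_box// /lebesgue_Cn /pushforward; congr (_ _).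
by apply/seteqP; split => x /= h j; [rewrite -coord_Cn_of_real|rewrite coord_Cn_of_real].
Qed.

Lemma integral_Cn n (f : 'rV[Cplx R]_n.+1 -> \bar R) :
  measurable_fun setT f -> (forall t, 0 <= f t)%E ->
  (\int[lebesgue_Cn]_t f t = \int[product_power area n]_x \int[area]_z
     f (Cn_of_real (tcons (z, x))))%E.
Proof.
move=> mf f0; rewrite [LHS]ge0_integral_pushforward//; last exact: measurable_Cn_of_real.
have mf1 := measurableT_comp mf (@measurable_Cn_of_real R n.+1).
have mt : measurable_fun setT (@tcons _ (M * M)%type n) by exact: measurable_tcons.
have mf2 := measurableT_comp mf1 mt.
rewrite preimage_setT.
transitivity (\int[(area \x product_power area n)%E]_z f (Cn_of_real (tcons z)))%E.
  by rewrite [LHS]ge0_integral_pushforward// => x _; exact: f0.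
by rewrite (fubini_tonelli2 _ mf2 (fun z => f0 _)).
Qed.

End BoxMeasure.

(** * Balanced sets *)

Section PowerMeasurability.
Context {d} {T : measurableType d} {R : realType}.

Lemma measurable_normc_powR (D : set T) (p : R) (f : T -> Cplx R) :
  cmeasurable_fun D f -> measurable_fun D (fun x => (normc (f x) `^ p)%:E).
Proof.
move=> [mRe mIm]; apply/measurable_EFinP.
apply: (measurableT_comp (measurable_powR p)).
rewrite (_ : (fun x => _) = fun x =>
  Num.sqrt (complex.Re (f x) ^+ 2 + complex.Im (f x) ^+ 2)); last first.
  by apply/funext => x; case: (f x).
apply: measurableT_comp; last by apply: measurable_funD; exact: measurable_funX.
by apply: continuous_measurable_fun; exact: sqrt_continuous.
Qed.

End PowerMeasurability.

Section Balanced.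
Context {R : realType} {n : nat}.
Local Notation Cn := 'rV[Cplx R]_n.
Local Notation mu := (@lebesgue_Cn R n).
Variables (Omega : set Cn) (p : R).
Implicit Types (P : set Cn).

(** The complement [P `\` E] is the inner half and [E] the outer one: the model is
    a disc cut into a concentric disc and an annulus. Once [Omega] itself is
    balanced, the indicator function of [E] has two best approximations. *)
Definition balanced P := [/\ measurable P, P `<=` Omega & exists E,
  [/\ measurable E, E `<=` P, mu E = mu (P `\` E) &
      forall g, holomorphic_on Omega g -> cmeasurable_fun Omega g ->
        (int_pow mu (P `\` E) p g <= int_pow mu E p g)%E]].

Hypothesis mOmega : measurable Omega.

Lemma measurable_pow_sub (P : set Cn) g : measurable P -> P `<=` Omega ->
  cmeasurable_fun Omega g -> measurable_fun P (fun x => (normc (g x) `^ p)%:E).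
Proof.
by move=> mP PO /(measurable_normc_powR p) mg; exact: measurable_funS mg.
Qed.

Lemma balanced_null P : measurable P -> P `<=` Omega -> mu P = 0%E -> balanced P.
Proof.
move=> mP PO P0; split=> //; exists set0; split=> //.
- by rewrite setD0 P0 measure0.
- move=> g _ mg; rewrite setD0 /int_pow integral_set0 null_set_integral//.
  exact: measurable_pow_sub.
Qed.

Lemma balanced_bigcup (P : (set Cn)^nat) : trivIset setT P ->
  (forall i, balanced (P i)) -> balanced (\bigcup_i P i).
Proof.
move=> tP bP; have mP i : measurable (P i) by case: (bP i).
have PO i : P i `<=` Omega by case: (bP i).
split; [exact: bigcupT_measurable|by apply: bigcup_sub => i _|].
have /choice[E EP] i : exists E, [/\ measurable E, E `<=` P i, mu E = mu (P i `\` E) &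
      forall g, holomorphic_on Omega g -> cmeasurable_fun Omega g ->
        (int_pow mu (P i `\` E) p g <= int_pow mu E p g)%E] by case: (bP i).
have mE i : measurable (E i) by case: (EP i).
have EsubP i : E i `<=` P i by case: (EP i).
have mD i : measurable (P i `\` E i) by exact: measurableD.
have trivIset_sub (Q : (set Cn)^nat) : (forall i, Q i `<=` P i) -> trivIset setT Q.
  move=> QP i j _ _ [x [Qi Qj]]; apply: (tP i j) => //.
  by exists x; split; exact: QP.
have tE : trivIset setT E by exact: trivIset_sub.
have tD : trivIset setT (fun i => P i `\` E i) by apply: trivIset_sub => i; exact: subDsetl.
have DE : (\bigcup_i P i) `\` (\bigcup_i E i) = \bigcup_i (P i `\` E i).
  apply/seteqP; split => [x [[i _ Pix] nE]|x [i _ [Pix nEi]]].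
    by exists i => //; split => // Eix; apply: nE; exists i.
  split; first by exists i.
  move=> [j _ Ejx]; have ij : i = j.
    by apply: (tP i j) => //; exists x; split => //; exact: EsubP.
  by apply: nEi; rewrite ij.
exists (\bigcup_i E i); split.
- exact: bigcupT_measurable.
- by move=> x [i _ Eix]; exists i => //; exact: EsubP.
- rewrite DE !measure_semi_bigcup//; [|exact: bigcupT_measurable|exact: bigcupT_measurable].
  by apply: eq_eseriesr => i _; case: (EP i).
- move=> g hg mg; rewrite DE /int_pow !ge0_integral_bigcup//.
  + apply: lee_nneseries => [i _ _|i _]; last by case: (EP i) => _ _ _; exact.
    by apply: integral_ge0 => x _; rewrite lee_fin powR_ge0.
  + apply: measurable_pow_sub mg; first exact: bigcupT_measurable.
    by apply: bigcup_sub => i _; apply: subset_trans (PO i).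
  + by move=> x _; rewrite lee_fin powR_ge0.
  + apply: measurable_pow_sub mg; first exact: bigcupT_measurable.
    by apply: bigcup_sub => i _; apply: subset_trans (PO i); exact: subDsetl.
  + by move=> x _; rewrite lee_fin powR_ge0.
Qed.

End Balanced.

Section BalancedTile.
Context {R : realType} {n : nat}.
Local Notation M := (measurableTypeR R).
Local Notation area := (@area_measure R).
Local Notation Cn := 'rV[Cplx R]_n.+1.
Local Notation mu := (@lebesgue_Cn R n.+1).
Implicit Types (X Y : set (M * M)) (S : 'I_n.+1 -> set (M * M)).

Definition set_first X S : 'I_n.+1 -> set (M * M) :=
  fun j => if j == ord0 then X else S j.

Lemma measurable_set_first X S : measurable X -> (forall j, measurable (S j)) ->
  forall j, measurable (set_first X S j).
Proof. by move=> mX mS j; rewrite /set_first; case: ifP. Qed.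

Lemma box_set_firstP X S z (x : n.-tuple (M * M)) :
  box (set_first X S) (Cn_of_real (tcons (z, x))) <->
  X z /\ forall i, S (lift ord0 i) (tnth x i).
Proof.
split => [h|[Xz h] j].
  split; first by have := h ord0; rewrite /set_first eqxx coord_Cn_of_real tnth0.
  by move=> i; have := h (lift ord0 i); rewrite /set_first coord_Cn_of_real tnthS.
rewrite coord_Cn_of_real /set_first; case: (unliftP ord0 j) => [i|] ->.
  by rewrite tnthS; exact: h.
by rewrite eqxx tnth0.
Qed.

(** By Fubini's theorem, an inequality between integrals over two regions of the
    first coordinate, for all values of the others, integrates to one in [Cn]. *)
Lemma integral_box_first_le X Y S (f : Cn -> \bar R) :
  measurable X -> measurable Y -> (forall j, measurable (S j)) ->
  measurable_fun (box (set_first X S)) f -> measurable_fun (box (set_first Y S)) f ->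
  (forall t, 0 <= f t)%E ->
  (forall x : n.-tuple (M * M), (forall i, S (lift ord0 i) (tnth x i)) ->
    (\int[area]_(z in X) f (Cn_of_real (tcons (z, x))) <=
     \int[area]_(z in Y) f (Cn_of_real (tcons (z, x))))%E) ->
  (\int[mu]_(t in box (set_first X S)) f t <= \int[mu]_(t in box (set_first Y S)) f t)%E.
Proof.
move=> mX mY mS mfX mfY f0 XY.
have mbox Z : measurable Z -> measurable (box (set_first Z S)).
  by move=> mZ; apply: measurable_box; exact: measurable_set_first.
have mpatch Z : measurable Z -> measurable_fun (box (set_first Z S)) f ->
    measurable_fun setT (f \_ (box (set_first Z S))).
  by move=> mZ mfZ; apply/(measurable_restrictT _ (mbox _ mZ)).
have patch0 Z t : (0 <= (f \_ (box (set_first Z S))) t)%E by apply: erestrict_ge0.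
have mtC : measurable_fun setT (fun u : (M * M) * n.-tuple (M * M) => Cn_of_real (tcons u)).
  by apply: measurableT_comp; [exact: measurable_Cn_of_real|exact: measurable_tcons].
have mint Z : measurable Z -> measurable_fun (box (set_first Z S)) f ->
    measurable_fun setT
      (fun x => \int[area]_z (f \_ (box (set_first Z S))) (Cn_of_real (tcons (z, x))))%E.
  move=> mZ mfZ; have mZ' := measurableT_comp (mpatch _ mZ mfZ) mtC.
  exact: (measurable_fun_fubini_tonelli_G
    (fun u => (f \_ (box (set_first Z S))) (Cn_of_real (tcons u))) mZ' (fun u => patch0 _ _)).
have inner Z x : (\int[area]_z (f \_ (box (set_first Z S))) (Cn_of_real (tcons (z, x))) =
    if `[< forall i, S (lift ord0 i) (tnth x i) >] then
      \int[area]_(z in Z) f (Cn_of_real (tcons (z, x))) else 0)%E.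
  case: asboolP => Sx.
    rewrite [RHS]integral_mkcond; apply: eq_integral => z _.
    rewrite /patch; congr (if _ then _ else _); apply/idP/idP; rewrite !inE.
      by move=> /box_set_firstP[].
    by move=> Zz; apply/box_set_firstP.
  apply: integral0_eq => z _; rewrite /patch ifF//; apply/negP; rewrite inE.
  by move=> /box_set_firstP[].
rewrite integral_mkcond [leRHS]integral_mkcond !integral_Cn//; [|exact: mpatch..].
apply: ge0_le_integral => //.
- by move=> x _; apply: integral_ge0.
- exact: mint.
- exact: mint.
- by move=> x _; rewrite !inner; case: asboolP => // /XY.
Qed.

Lemma coord_lineE b z (x : n.-tuple (M * M)) : Cn_of_real (tcons (z, x)) =
  Cn_of_real (tcons (b, x)) + centered b z *: delta_mx 0 ord0 :> Cn.
Proof.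
apply/rowP => j; rewrite !mxE eqxx /=; case: (unliftP ord0 j) => [i|] ->.
  by rewrite !tnthS/= mulr0 addr0.
rewrite !tnth0/= mulr1 /centered /to_cplx; case: z => z1 z2; case: b => b1 b2 /=.
by congr Complex; rewrite addrC subrK.
Qed.

(** Fixing the other coordinates leaves a holomorphic function of the first one, to
    which the comparison of a disc with an annulus applies. *)
Lemma balanced_tile (Omega : set Cn) (p r : R) b S : measurable Omega -> 0 < p -> 0 < r ->
  (forall j, measurable (S j)) ->
  box (set_first (bdisc b (Num.sqrt 2 * r)) S) `<=` Omega ->
  balanced Omega p (box (set_first (bdisc b (Num.sqrt 2 * r)) S)).
Proof.
move=> mO p0 r0 mS TO; set D := bdisc b _ in TO *.
pose F := bdisc b r; pose A := D `\` F.
have mD : measurable D by exact: measurable_bdisc.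
have mF : measurable F by exact: measurable_bdisc.
have mA : measurable A by exact: measurableD.
have FD : F `<=` D.
  move=> z; rewrite /F /D /bdisc/= exprMn sqr_sqrtr// => /le_trans; apply.
  by rewrite ler_peMl ?sqr_ge0// ler1n.
have mono X Y : X `<=` Y -> box (set_first X S) `<=` box (set_first Y S).
  by move=> XY t h j; have := h j; rewrite /set_first; case: ifP => // _ /XY.
have mbox Z : measurable Z -> measurable (box (set_first Z S)).
  by move=> mZ; apply: measurable_box; exact: measurable_set_first.
have DA : box (set_first D S) `\` box (set_first A S) = box (set_first F S).
  apply/seteqP; split => t.
    move=> [h nA] j; have := h j; rewrite /set_first; case: eqP => // j0 Dj.
    apply: contrapT => nF; apply: nA => i; have := h i; rewrite /set_first.
    by case: eqP => // -> Di; split => //; rewrite -j0.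
  move=> h; split; first exact: mono FD _ h.
  by move=> /(_ ord0); have := h ord0; rewrite /set_first eqxx => Fx [_].
split=> //; first exact: mbox.
exists (box (set_first A S)); split.
- exact: mbox.
- by apply: mono; exact: subDsetl.
- rewrite DA !lebesgue_Cn_box; [|exact: measurable_set_first..].
  rewrite !big_ord_recl /set_first eqxx; congr (_ * _)%E.
  by rewrite /A /D area_annulus// ltW.
- move=> g hg mg; rewrite DA /int_pow.
  apply: integral_box_first_le => //.
  + by apply: measurable_pow_sub mg => //; [exact: mbox|exact: subset_trans (mono _ _ FD) TO].
  + apply: measurable_pow_sub mg => //; [exact: mbox|].
    by apply: subset_trans (mono _ _ _) TO; exact: subDsetl.
  + by move=> t; rewrite lee_fin powR_ge0.
  move=> x Sx.
  pose G (w : Cplx R) := g (Cn_of_real (tcons (b, x)) + w *: delta_mx 0 ord0).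
  have GE z : G (centered b z) = g (Cn_of_real (tcons (z, x))) by rewrite /G -coord_lineE.
  under eq_integral do rewrite -GE; under [leRHS]eq_integral do rewrite -GE.
  apply: disc_inequality => //.
    move=> w wr; apply: cdiff_line; apply: hg; apply: TO.
    pose z : M * M := (b.1 + complex.Re w, b.2 + complex.Im w).
    have zw : centered b z = w.
      rewrite /centered /to_cplx /z /=; case: (w) => w1 w2 /=.
      by congr Complex; rewrite addrAC subrr add0r.
    rewrite -zw -coord_lineE; apply/box_set_firstP; split => //.
    by apply/bdiscE; [rewrite mulr_ge0// ltW|rewrite zw].
  rewrite (_ : (fun z => _) = (fun t => (normc (g t) `^ p)%:E) \o
     (fun z => Cn_of_real (tcons (z, x)))); last by apply/funext => z /=; rewrite GE.
  have mline : measurable_fun setT (fun z : M * M => Cn_of_real (tcons (z, x))).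
    apply: measurableT_comp; first exact: measurable_Cn_of_real.
    by apply: measurableT_comp; [exact: measurable_tcons|exact: measurable_pair2].
  apply: (measurable_comp mO) (measurable_normc_powR p mg) _.
    by move=> _ [z Dz <-]; apply: TO; apply/box_set_firstP.
  exact: measurable_funTS.
Qed.

End BalancedTile.

(** * The tiles of a grid *)

Section Grid.
Context {R : realType} {n : nat}.
Local Notation M := (measurableTypeR R).
Local Notation area := (@area_measure R).
Local Notation Cn := 'rV[Cplx R]_n.
Local Notation mu := (@lebesgue_Cn R n).
Local Notation index := {ffun 'I_n -> int * int}.
Implicit Types (h : R) (q : index) (t s : Cn).

Definition cell_side h (i : int) : set M := `[i%:~R * h, (i + 1)%:~R * h[.

Definition cell h q : set Cn :=
  box (fun j => cell_side h (q j).1 `*` cell_side h (q j).2).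

Definition cell_center h q (j : 'I_n) : M * M :=
  (((q j).1%:~R + 2^-1) * h, ((q j).2%:~R + 2^-1) * h).

(** The margin to the boundary of the cell makes the tiles of the grid a locally
    finite family of closed sets. *)
Definition tile h q : set Cn := box (fun j => bdisc (cell_center h q j) (h / 4)).

Lemma cell_sideP h (i : int) (x : R) : 0 < h -> cell_side h i x <-> Num.floor (x / h) = i.
Proof.
move=> h0; rewrite /cell_side /= in_itv/= -ler_pdivlMr// -ltr_pdivrMr//.
by rewrite -floor_eq; split => /eqP.
Qed.

Lemma cell_index h t : 0 < h -> exists q, cell h q t.
Proof.
move=> h0; exists [ffun j => (Num.floor ((coord j t).1 / h), Num.floor ((coord j t).2 / h))].
by move=> j; rewrite ffunE; split; apply/cell_sideP.
Qed.

Lemma cell_inj h q q' t : 0 < h -> cell h q t -> cell h q' t -> q = q'.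
Proof.
move=> h0 tq tq'; apply/ffunP => j; have [/= a1 a2] := tq j; have [/= b1 b2] := tq' j.
move: a1 a2 b1 b2 => /(cell_sideP _ _ h0)/= a1 /(cell_sideP _ _ h0)/= a2.
move=> /(cell_sideP _ _ h0)/= b1 /(cell_sideP _ _ h0)/= b2.
by move: a1 a2 b1 b2; case: (q j) (q' j) => ? ? [? ?] /= -> -> -> ->.
Qed.

Lemma cell_near h q t s : cell h q t -> cell h q s -> near_coord h t s.
Proof.
move=> tq sq j; have [/= t1 t2] := tq j; have [/= s1 s2] := sq j.
rewrite /cell_side/= !in_itv/= !intrD !mulrDl !mul1r in t1 t2 s1 s2.
by rewrite !ltr_norml; clear -t1 t2 s1 s2; split; apply/andP; split; lra.
Qed.

(** The discs of a tile keep a margin [h / 4] to the boundary of the cell. *)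
Lemma tile_near_cell h q t s : 0 < h -> tile h q t -> near_coord (h / 4) t s -> cell h q s.
Proof.
move=> h0 tq ts j; have h40 : 0 <= h / 4 by rewrite divr_ge0 ?ltW.
have /(bdiscE _ _ h40) tj := tq j; have [s1 s2] := ts j.
have := le_trans (Re_le_normc _) tj; have := le_trans (Im_le_normc _) tj.
rewrite /centered /to_cplx/= !ler_norml => t2 t1.
rewrite !ltr_norml /= in s1 s2.
split; rewrite /cell_side/= in_itv/= intrD mulrDl mul1r.
  by clear -h0 t1 s1; apply/andP; split; lra.
by clear -h0 t2 s2; apply/andP; split; lra.
Qed.

Lemma tile_sub_cell h q : 0 < h -> tile h q `<=` cell h q.
Proof.
move=> h0 t tq; apply: (tile_near_cell h0 tq) => j.
by rewrite !subrr normr0 divr_gt0.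
Qed.

Lemma measurable_cell_side h i : measurable (cell_side h i).
Proof. exact: measurable_itv. Qed.

Lemma measurable_cell h q : measurable (cell h q).
Proof.
by apply: measurable_box => j; apply: measurableX; exact: measurable_cell_side.
Qed.

Lemma measurable_tile h q : measurable (tile h q).
Proof. by apply: measurable_box => j; exact: measurable_bdisc. Qed.

Lemma area_rect (a b c d : R) : a <= b -> c <= d -> forall s1 s2 s3 s4 : bool,
  area ([set` Interval (BSide s1 a) (BSide s2 b)] `*` [set` Interval (BSide s3 c) (BSide s4 d)])
  = ((b - a) * (d - c))%:E.
Proof.
move=> ab cd s1 s2 s3 s4.
transitivity (lebesgue_measure [set` Interval (BSide s1 a) (BSide s2 b)] *
  lebesgue_measure [set` Interval (BSide s3 c) (BSide s4 d)])%E.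
  by rewrite -product_measure1E//; exact: measurable_itv.
rewrite !lebesgue_measure_itv/= !lte_fin.
have -> : (if (a < b)%R then b%:E - a%:E else 0)%E = (b - a)%:E.
  by case: ltP => // ba; rewrite (_ : b = a) ?subrr//; apply/eqP; rewrite eq_le ba.
have -> : (if (c < d)%R then d%:E - c%:E else 0)%E = (d - c)%:E.
  by case: ltP => // dc; rewrite (_ : d = c) ?subrr//; apply/eqP; rewrite eq_le dc.
by rewrite EFinM.
Qed.

Lemma measure_cell h q : 0 < h -> mu (cell h q) = (\prod_(j < n) (h ^+ 2))%:E.
Proof.
move=> h0; rewrite lebesgue_Cn_box; last first.
  by move=> j; apply: measurableX; exact: measurable_cell_side.
rewrite -prodEFin; apply: eq_bigr => j _; rewrite /cell_side.
rewrite area_rect; [|by rewrite ler_pM2r// ler_int lerDl..].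
by congr EFin; rewrite !intrD; ring.
Qed.

(** A disc of radius [h / 4] contains a square of side [h / 4]. *)
Lemma measure_tile_ge h q : 0 < h ->
  (((16 ^- 1) ^+ n)%:E * mu (cell h q) <= mu (tile h q))%E.
Proof.
move=> h0; rewrite measure_cell// lebesgue_Cn_box; last by move=> j; exact: measurable_bdisc.
have h40 : 0 <= h / 4 by rewrite divr_ge0 ?ltW.
have fin j : area (bdisc (cell_center h q j) (h / 4)) \is a fin_num.
  by rewrite ge0_fin_numE// bdisc_finite.
rewrite (eq_bigr (fun j => (fine (area (bdisc (cell_center h q j) (h / 4))))%:E)); last first.
  by move=> j _; rewrite fineK.
rewrite prodEFin -EFinM lee_fin.
have -> : (16 ^- 1) ^+ n = \prod_(j < n) (16 ^- 1 : R) by rewrite prodr_const card_ord.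
rewrite -big_split/=; apply: ler_prod => j _.
rewrite mulr_ge0 ?sqr_ge0 ?invr_ge0 ?exprn_ge0//=.
rewrite -lee_fin fineK//; move: (cell_center h q j) => c.
have -> : 16 ^- 1 * h ^+ 2 = ((c.1 + h / 8) - (c.1 - h / 8)) * ((c.2 + h / 8) - (c.2 - h / 8)).
  by field.
have h8 : 0 < h / 8 by rewrite divr_gt0.
rewrite -(@area_rect _ _ _ _ _ _ true false true false); [|by clear -h8; lra..].
apply: le_measure; rewrite ?inE.
- by apply: measurableX; exact: measurable_itv.
- exact: measurable_bdisc.
move=> u [/=]; rewrite !in_itv/= => u1 u2; rewrite /bdisc/=.
have sq (x : R) : - (h / 8) <= x <= h / 8 -> x ^+ 2 <= (h / 8) ^+ 2.
  rewrite -ler_norml -[x ^+ 2]real_normK ?num_real// => xh.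
  by rewrite lerXn2r ?nnegrE ?normr_ge0 ?(ltW h8).
have v1 : (u.1 - c.1) ^+ 2 <= (h / 8) ^+ 2.
  by apply: sq; clear -u1; apply/andP; split; lra.
have v2 : (u.2 - c.2) ^+ 2 <= (h / 8) ^+ 2.
  by apply: sq; clear -u2; apply/andP; split; lra.
apply: le_trans (lerD v1 v2) _.
rewrite [(h / 4) ^+ 2](_ : _ = 4 * (h / 8) ^+ 2); last by field.
have := sqr_ge0 (h / 8); set w := (h / 8) ^+ 2; clear; lra.
Qed.

Lemma tile_open_compl h q t : 0 < h -> ~ tile h q t ->
  exists2 r : R, 0 < r & forall s, near_coord r t s -> ~ tile h q s.
Proof.
move=> h0 nt; have h40 : 0 <= h / 4 by rewrite divr_ge0 ?ltW.
have [j tj] : exists j, ~ bdisc (cell_center h q j) (h / 4) (coord j t).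
  by apply/existsNP => th; apply: nt => j; exact: th.
have {}tj : h / 4 < normc (centered (cell_center h q j) (coord j t)).
  by rewrite ltNge; apply/negP => le; apply: tj; apply/(bdiscE _ _ h40).
set c := cell_center h q j in tj *.
exists ((normc (centered c (coord j t)) - h / 4) / 2).
  by rewrite divr_gt0// subr_gt0.
move=> s /(_ j) [s1 s2] /(_ j)/(bdiscE _ _ h40); rewrite -/c => sj.
have : normc (centered c (coord j t)) <= normc (centered c (coord j s)) +
    (`|(coord j s).1 - (coord j t).1| + `|(coord j s).2 - (coord j t).2|).
  rewrite -{1}[centered c (coord j t)](subrK (centered c (coord j s))) addrC.
  apply: le_trans (normcD _ _) _; rewrite lerD2l normc_sub.
  apply: le_trans (normc_le_sum _) _; rewrite /centered /to_cplx/=.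
  have e (a b d : R) : a - d - (b - d) = a - b by clear; lra.
  by rewrite !e.
move: s1 s2 sj; clear; lra.
Qed.

End Grid.

(** * Packing an open set with balanced tiles *)

Section Packing.
Context {R : realType} {m : nat}.
Local Notation n := m.+1.
Local Notation Cn := 'rV[Cplx R]_n.
Local Notation mu := (@lebesgue_Cn R n).
Local Notation index := {ffun 'I_n -> int * int}.
Implicit Types (t s : Cn) (U : set Cn).

(** A cell of mesh [h] that meets the inner part lies in [U]. *)
Definition inner_part U (h : R) : set Cn := [set t | forall s, near_coord h t s -> U s].

Lemma inner_part_sub U h : 0 < h -> inner_part U h `<=` U.
Proof. by move=> h0 t; apply => j; rewrite !subrr normr0. Qed.

Lemma measurable_inner_part U h : measurable (inner_part U h).
Proof.
rewrite -[inner_part U h]setCK; apply: measurableC; apply: open_measurable_Cn.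
apply/open_CnP => t /existsNP[s /not_implyP[ts nUs]].
pose f j := Num.min (h - `|(coord j s).1 - (coord j t).1|) (h - `|(coord j s).2 - (coord j t).2|).
exists (\big[Num.min/1]_j f j).
  apply: lt_bigmin => // j _; have [? ?] := ts j.
  by rewrite lt_min !subr_gt0; apply/andP.
move=> t' tt' /(_ s) t's; apply: nUs; apply: t's => j.
have [t1 t2] := tt' j; have := bigmin_le 1 j f; rewrite {2}/f le_min => /andP[f1 f2].
have {}t1 := lt_le_trans t1 f1; have {}t2 := lt_le_trans t2 f2.
split.
  have := ler_distD (coord j t).1 (coord j s).1 (coord j t').1.
  by rewrite (distrC (coord j t).1); clear -t1; lra.
have := ler_distD (coord j t).2 (coord j s).2 (coord j t').2.
by rewrite (distrC (coord j t).2); clear -t2; lra.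
Qed.

Lemma near_coord_le h h' t s : h <= h' -> near_coord h t s -> near_coord h' t s.
Proof. by move=> hh ts j; have [t1 t2] := ts j; split; exact: lt_le_trans hh. Qed.

(** [U] is the increasing union of its inner parts. *)
Lemma inner_part_half U : open U -> (0 < mu U)%E -> (mu U < +oo)%E ->
  exists2 h : R, 0 < h & (2^-1%:E * mu U <= mu (inner_part U h))%E.
Proof.
move=> oU U0 Ufin; apply: contrapT => noh.
pose W k := inner_part U (2^-1 ^+ k).
have h0 k : 0 < 2^-1 ^+ k :> R by rewrite exprn_gt0.
have mU : measurable U by exact: open_measurable_Cn.
have UW : \bigcup_k W k = U.
  apply/seteqP; split => [t [k _]|t Ut]; first exact: inner_part_sub.
  have /open_CnP/(_ _ Ut)[r r0 rU] := oU.
  have /cvgrPdist_lt/(_ r r0)[k _ /(_ k (leqnn k))] : (fun k => 2^-1 ^+ k) @ \oo --> (0 : R).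
    by apply: cvg_expr; rewrite ger0_norm ?invf_lt1// ltr1n.
  rewrite sub0r normrN ger0_norm ?(ltW (h0 _))// => kr.
  by exists k => // s ts; apply: rU; apply: near_coord_le ts; exact: ltW.
have ndW : nondecreasing_seq W.
  move=> i j ij; apply/subsetPset => t Wt s ts; apply: Wt; apply: near_coord_le ts.
  by apply: ler_wiXn2l; rewrite // ?invr_ge0// invf_le1// ler1n.
have cW : mu \o W @ \oo --> mu U.
  rewrite -UW; apply: nondecreasing_cvg_mu => //; last by rewrite UW.
  by move=> k; exact: measurable_inner_part.
have le_half : (mu U <= 2^-1%:E * mu U)%E.
  rewrite -{1}(cvg_lim _ cW)//; apply: lime_le; first by apply/cvg_ex; exists (mu U).
  apply: nearW => k; rewrite leNgt; apply/negP => lt; apply: noh.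
  by exists (2^-1 ^+ k) => //; exact: ltW.
have Ufn : mu U \is a fin_num by rewrite ge0_fin_numE.
move: le_half U0; rewrite -(fineK Ufn) -EFinM lee_fin lte_fin.
by clear; lra.
Qed.

(** The radius [h / 4] is written as [Num.sqrt 2] times that of the inner disc. *)
Lemma balanced_tile_grid (Omega : set Cn) (p h : R) (q : index) : measurable Omega ->
  0 < p -> 0 < h -> tile h q `<=` Omega -> balanced Omega p (tile h q).
Proof.
move=> mO p0 h0; pose S j := bdisc (cell_center h q j) (h / 4).
have s2 : 0 < Num.sqrt 2 :> R by rewrite sqrtr_gt0.
have -> : tile h q = box (set_first (bdisc (cell_center h q ord0)
    (Num.sqrt 2 * (h / 4 / Num.sqrt 2))) S).
  rewrite mulrC divfK ?gt_eqF//; congr box; apply/funext => j.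
  by rewrite /set_first; case: eqP => // ->.
apply: balanced_tile => //; first by rewrite !divr_gt0.
by move=> j; exact: measurable_bdisc.
Qed.

(** On a fine grid, the cells contained in [U] have at least half of its measure, and
    a tile takes up the share [16 ^- 1 ^+ n] of its cell. The remainder is open since
    a point is close to no tile except possibly that of its own cell. *)
Lemma packing_step (Omega : set Cn) (p : R) U : measurable Omega -> 0 < p ->
  open U -> U `<=` Omega -> (mu U < +oo)%E ->
  exists P, [/\ balanced Omega p P, P `<=` U, open (U `\` P) &
    (mu (U `\` P) <= (1 - 2^-1 * (16 ^- 1) ^+ n)%:E * mu U)%E].
Proof.
move=> mO p0 oU UO Ufin; have mU : measurable U by exact: open_measurable_Cn.
have [U0|U0] := eqVneq (mu U) 0%E.
  exists set0; rewrite setD0 U0 mule0; split => //.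
  by apply: balanced_null => //; rewrite measure0.
have {}U0 : (0 < mu U)%E by rewrite lt_def U0 measure_ge0.
have [h h0 Wh] := inner_part_half oU U0 Ufin.
(* the cells or tiles of the grid cells contained in [U], as a sequence *)
pose sel (A : index -> set Cn) i := if @pickle_inv index i is Some q then
  (if `[< cell h q `<=` U >] then A q else set0) else set0.
have selP (A : index -> set Cn) i t : sel A i t -> exists q,
    [/\ pickle_inv i = Some q, cell h q `<=` U & A q t].
  rewrite /sel; case: pickle_inv => // q; case: asboolP => // qU Aqt.
  by exists q.
have msel (A : index -> set Cn) : (forall q, measurable (A q)) ->
    forall i, measurable (sel A i).
  by move=> mA i; rewrite /sel; case: pickle_inv => // q; case: ifP.
have tsel (A : index -> set Cn) : (forall q, A q `<=` cell h q) -> trivIset setT (sel A).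
  move=> Ac i j _ _ [t [/selP[q [iq _ /Ac qt]] /selP[q' [jq' _ /Ac q't]]]].
  have qq' := cell_inj h0 qt q't.
  by have := @pickle_invK index i; have := @pickle_invK index j; rewrite iq jq' qq' /= => -> ->.
have mtile q : measurable (tile h q) by exact: measurable_tile.
have mcell q : measurable (cell h q) by exact: measurable_cell.
have tt : trivIset setT (sel (tile h)) by apply: tsel => q; exact: tile_sub_cell.
have tc : trivIset setT (sel (cell h)) by apply: tsel => q.
pose P := \bigcup_i sel (tile h) i.
have PU : P `<=` U.
  by move=> t [i _ /selP[q [_ qU /(tile_sub_cell h0)/qU]]].
have mP : measurable P by apply: bigcupT_measurable; exact: msel.
exists P; split => //.
- apply: balanced_bigcup => // i; rewrite /sel; case: pickle_inv => [q|]; last first.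
    by apply: balanced_null => //; rewrite measure0.
  case: asboolP => qU; last by apply: balanced_null => //; rewrite measure0.
  apply: balanced_tile_grid => //.
  exact: subset_trans (tile_sub_cell h0) (subset_trans qU UO).
- apply/open_CnP => t [Ut nPt].
  have /open_CnP/(_ _ Ut)[r r0 rU] := oU.
  have [q qt] := cell_index t h0.
  have h40 : 0 < h / 4 by rewrite divr_gt0.
  (* a point of a tile close to [t] belongs to the tile of the cell of [t] *)
  have PE s : near_coord (h / 4) t s -> P s -> cell h q `<=` U /\ tile h q s.
    move=> ts [i _ /selP[q' [_ q'U q's]]].
    have q't : cell h q' t.
      apply: (tile_near_cell h0 q's) => j; have [t1 t2] := ts j.
      by rewrite distrC t1 distrC t2.
    by rewrite (cell_inj h0 qt q't).
  have [qU|nqU] := pselect (cell h q `<=` U); last first.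
    exists (Num.min r (h / 4)); first by rewrite lt_min r0.
    move=> s ts; split.
      by apply: rU; apply: near_coord_le ts; rewrite ge_min lexx.
    by move=> /PE[]//; apply: near_coord_le ts; rewrite ge_min lexx orbT.
  have [|r' r'0 r'P] := @tile_open_compl R n h q t h0.
    move=> qt'; apply: nPt; exists (pickle q) => //.
    by rewrite /sel pickleK_inv asboolT.
  exists (Num.min r (Num.min r' (h / 4))); first by rewrite !lt_min r0 r'0.
  move=> s ts; split.
    by apply: rU; apply: near_coord_le ts; rewrite ge_min lexx.
  move=> /PE[|_].
    by apply: near_coord_le ts; rewrite !ge_min lexx !orbT.
  by apply: r'P; apply: near_coord_le ts; rewrite !ge_min lexx !orbT.
- have cover : inner_part U h `<=` \bigcup_i sel (cell h) i.
    move=> t tU; have [q qt] := cell_index t h0.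
    exists (pickle q) => //; rewrite /sel pickleK_inv asboolT// => s qs.
    by apply: tU; exact: cell_near qt qs.
  have mC : measurable (\bigcup_i sel (cell h) i) by apply: bigcupT_measurable; exact: msel.
  have c0 : 0 <= (16 ^- 1) ^+ n :> R by rewrite exprn_ge0// invr_ge0 exprn_ge0.
  have PC : (((16 ^- 1) ^+ n)%:E * mu (\bigcup_i sel (cell h) i) <= mu P)%E.
    rewrite /P !measure_semi_bigcup//; [|exact: msel|exact: msel].
    rewrite -nneseriesZl//; apply: lee_nneseries => [i _ _|i _].
      by rewrite mule_ge0.
    rewrite /sel; case: pickle_inv => [q|]; last by rewrite measure0 mule0.
    by case: ifP => _; [exact: measure_tile_ge|rewrite measure0 mule0].
  have {}PC : (((16 ^- 1) ^+ n)%:E * (2^-1%:E * mu U) <= mu P)%E.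
    apply: le_trans PC; apply: lee_wpmul2l; first by rewrite lee_fin.
    apply: le_trans Wh _; apply: le_measure => //; rewrite ?inE//.
    exact: measurable_inner_part.
  have Ufn : mu U \is a fin_num by rewrite ge0_fin_numE.
  have Pfn : mu P \is a fin_num.
    rewrite ge0_fin_numE//; apply: le_lt_trans Ufin; apply: le_measure => //; by rewrite inE.
  have -> : mu (U `\` P) = (mu U - mu P)%E by rewrite measureD// setIidr.
  move: PC; rewrite -(fineK Ufn) -(fineK Pfn) -!EFinM -EFinB !lee_fin mulrBl mul1r.
  by rewrite lerD2l lerN2 mulrCA mulrA.
Qed.

End Packing.

(** * Open sets of finite volume are balanced *)

Section Exhaustion.
Context {R : realType} {m : nat}.
Local Notation n := m.+1.
Local Notation Cn := 'rV[Cplx R]_n.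
Local Notation mu := (@lebesgue_Cn R n).
Implicit Types (U : set Cn).

(** Each packing step multiplies the measure of the rest by at most the fixed factor
    [k < 1], so that a null set remains in the limit. *)
Theorem balanced_open (Omega : set Cn) (p : R) : open Omega -> 0 < p ->
  (mu Omega < +oo)%E -> balanced Omega p Omega.
Proof.
move=> oO p0 Ofin; have mO : measurable Omega by exact: open_measurable_Cn.
pose k : R := 1 - 2^-1 * (16 ^- 1) ^+ n.
have k01 : 0 <= k < 1.
  have c0 : 0 < (16 ^- 1) ^+ n :> R by rewrite exprn_gt0// invr_gt0 exprn_gt0.
  have c1 : (16 ^- 1) ^+ n <= 1 :> R.
    by rewrite exprn_ile1 ?invr_ge0 ?exprn_ge0// expr1 invf_le1// ler1n.
  by rewrite /k; move: c0 c1; set c := _ ^+ n; clear; lra.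
have fin_sub U : open U -> U `<=` Omega -> (mu U < +oo)%E.
  move=> oU UO; apply: le_lt_trans Ofin; apply: le_measure => //; rewrite inE//.
  exact: open_measurable_Cn.
have /choice[pack packP] : forall U, exists P, open U -> U `<=` Omega ->
    [/\ balanced Omega p P, P `<=` U, open (U `\` P) & (mu (U `\` P) <= k%:E * mu U)%E].
  move=> U; have [[oU UO]|nU] := pselect (open U /\ U `<=` Omega).
    have [P PP] := packing_step mO p0 oU UO (fin_sub U oU UO).
    by exists P.
  by exists set0 => oU UO; exfalso; apply: nU.
pose fix rest i := if i is i'.+1 then rest i' `\` pack (rest i') else Omega.
have restP i : open (rest i) /\ rest i `<=` Omega.
  elim: i => [|i [oi iO]]; first by split.
  have [_ _ ? _] := packP _ oi iO; split => //.
  by apply: subset_trans iO; exact: subDsetl.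
pose P i := pack (rest i).
have PP i := packP _ (restP i).1 (restP i).2.
have bP i : balanced Omega p (P i) by case: (PP i).
have PR i : P i `<=` rest i by case: (PP i).
have rest_nonincr i j : (i <= j)%N -> rest j `<=` rest i.
  elim: j => [|j IH]; first by rewrite leqn0 => /eqP->.
  rewrite leq_eqVlt => /predU1P[->//|]; rewrite ltnS => /IH; apply: subset_trans.
  exact: subDsetl.
have disj i j : (i < j)%N -> P i `&` P j = set0.
  move=> ij; apply/seteqP; split => // t [Pi Pj].
  by have /= [_] := rest_nonincr _ _ ij _ (PR j _ Pj).
have tP : trivIset setT P.
  move=> i j _ _ [t [Pi Pj]]; have [ij|ji|//] := ltngtP i j.
    by have := disj _ _ ij => /seteqP[+ _] => /(_ t)[].
  by have := disj _ _ ji => /seteqP[+ _] => /(_ t)[].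
have mP i : measurable (P i) by case: (bP i).
pose N := Omega `\` \bigcup_i P i.
have mN : measurable N by apply: measurableD => //; exact: bigcupT_measurable.
have Nrest i : N `<=` rest i.
  elim: i => [|i IH] t Nt; first by case: Nt.
  by split; [exact: IH|case: Nt => _ nP Pit; apply: nP; exists i].
have mu_rest i : (mu (rest i) <= (k ^+ i)%:E * mu Omega)%E.
  elim: i => [|i IH]; first by rewrite expr0 mul1e.
  have [_ _ _ le] := PP i; apply: le_trans le _.
  rewrite exprS EFinM -muleA; apply: lee_wpmul2l => //.
  by rewrite lee_fin; case/andP: k01.
have N0 : mu N = 0%E.
  have Ofn : mu Omega \is a fin_num by rewrite ge0_fin_numE.
  have Nle i : (mu N <= (k ^+ i * fine (mu Omega))%:E)%E.
    rewrite EFinM fineK//; apply: le_trans (mu_rest i); apply: le_measure; rewrite ?inE//.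
    by apply: open_measurable_Cn; case: (restP i).
  apply/eqP; rewrite eq_le measure_ge0 andbT; apply/lee_addgt0Pr => e e0; rewrite add0e.
  have /cvgrPdist_lt/(_ e e0)[i _ /(_ i (leqnn i))] :
      (fun i => k ^+ i * fine (mu Omega)) @ \oo --> (0 : R).
    rewrite -[X in _ --> X](mul0r (fine (mu Omega))); apply: cvgMl; apply: cvg_expr.
    by rewrite ger0_norm; case/andP: k01.
  rewrite sub0r normrN => lt; apply: le_trans (Nle i) _; rewrite lee_fin.
  exact: le_trans (ler_norm _) (ltW lt).
(* the null set [N] joins the sequence as its first term *)
pose Q i := if i is i'.+1 then P i' else N.
have QE : \bigcup_i Q i = Omega.
  apply/seteqP; split => [t [[|i] _ /=]|t Ot].
  - by case.
  - by move=> /PR; exact: (restP i).2.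
  - have [[i _ Pit]|nP] := pselect ((\bigcup_i P i) t); first by exists i.+1.
    by exists 0%N.
have tQ : trivIset setT Q.
  move=> [|i] [|j] _ _ [t []] //=.
  - by move=> [_ nP] Pjt; exfalso; apply: nP; exists j.
  - by move=> Pit [_ nP]; exfalso; apply: nP; exists i.
  - by move=> Pit Pjt; congr S; apply: (tP i j) => //; exists t.
have bQ i : balanced Omega p (Q i).
  by case: i => [|i] //=; apply: balanced_null => // t [].
by rewrite -{2}QE; exact: balanced_bigcup.
Qed.

End Exhaustion.

(** * Volumes of bounded sets and of open sets *)

Section VolumeBounds.
Context {R : realType} {m : nat}.
Local Notation n := m.+1.
Local Notation M := (measurableTypeR R).
Local Notation Cn := 'rV[Cplx R]_n.
Local Notation mu := (@lebesgue_Cn R n).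
Implicit Types (U : set Cn).

Lemma bounded_set_near_coord U : bounded_set U ->
  exists2 r : R, 0 < r & U `<=` near_coord r 0.
Proof.
move=> [[a b] [ab_real Ub]].
have b0 : b = 0.
  by move: ab_real; rewrite realE !lecE/= => /orP[]/andP[/eqP].
exists (Num.max a 0 + 2); first by rewrite ltr_pwDr// le_max lexx orbT.
move=> t Ut; apply: ball_near_coord; rewrite -ball_normE /= sub0r normrN.
have lt2 : (Num.max a 0 + 1)%:C%C < (Num.max a 0 + 2)%:C%C :> Cplx R.
  by rewrite ltcR ltrD2l ltr1n.
apply: le_lt_trans lt2; apply: Ub => //.
by rewrite b0 ltcR ltr_pwDr// le_max lexx.
Qed.

Definition cube (t : Cn) (r : R) : 'I_n -> set (M * M) := fun j =>
  `[(coord j t).1 - r, (coord j t).1 + r]%classic `*`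
  `[(coord j t).2 - r, (coord j t).2 + r]%classic.

Lemma lebesgue_Cn_cube t r : 0 <= r ->
  mu (box (cube t r)) = (\prod_(j < n) ((r + r) * (r + r)))%:E.
Proof.
move=> r0; rewrite lebesgue_Cn_box; last by move=> j; exact: measurableX.
rewrite -prodEFin; apply: eq_bigr => j _.
have e (x : R) : x + r - (x - r) = r + r by clear; lra.
by rewrite area_rect ?e// lerD2l; move: r0; clear; lra.
Qed.

Lemma measurable_cube t r : measurable (box (cube t r)).
Proof. by apply: measurable_box => j; exact: measurableX. Qed.

Lemma lebesgue_Cn_bounded U : measurable U -> bounded_set U -> (mu U < +oo)%E.
Proof.
move=> mU /bounded_set_near_coord[r r0 Ur].
apply: (@le_lt_trans _ _ (mu (box (cube 0 r)))).
  apply: le_measure; rewrite ?inE//; first exact: measurable_cube.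
  move=> t /Ur tr j; have [] := tr j; rewrite !ltr_distl => /andP[a b] /andP[c d].
  by split; rewrite /= in_itv/= !ltW.
by rewrite lebesgue_Cn_cube ?(ltW r0)// ltry.
Qed.

Lemma lebesgue_Cn_open_gt0 U : open U -> U !=set0 -> (0 < mu U)%E.
Proof.
move=> oU [t Ut]; have [r r0 rU] := (open_CnP U).1 oU t Ut.
have h0 : 0 < r / 2 by rewrite divr_gt0.
apply: (@lt_le_trans _ _ (mu (box (cube t (r / 2))))).
  by rewrite lebesgue_Cn_cube ?(ltW h0)// lte_fin prodr_gt0// => _ _; rewrite mulr_gt0// addr_gt0.
apply: le_measure; rewrite ?inE//; [exact: measurable_cube|exact: open_measurable_Cn|].
move=> s st; apply: rU => j; have [] := st j; rewrite /= !in_itv/= => /andP[a b] /andP[c d].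
by rewrite !ltr_distl; move: a b c d r0; clear; move=> *; split; lra.
Qed.

End VolumeBounds.

(** * Distances between classes of functions *)

Section PowerInequality.
Context {R : realType}.
Variable p : R.
Hypothesis p01 : 0 < p <= 1.

(** [x `^ p] is at least [(a + b) `^ p] times the share [x / (a + b)], and the
    shares of [a] and [b] add up to [1]. *)
Lemma powR_subadditive (a b : R) : 0 <= a -> 0 <= b -> (a + b) `^ p <= a `^ p + b `^ p.
Proof.
have /andP[p0 p1] := p01; move=> a0 b0; have [ab0|ab0] := eqVneq (a + b) 0.
  by rewrite ab0 powR0 ?gt_eqF// addr_ge0// powR_ge0.
have {}ab0 : 0 < a + b by rewrite lt_def ab0 addr_ge0.
have share (x : R) : 0 <= x -> x <= a + b ->
    (a + b) `^ p * (x / (a + b)) <= x `^ p.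
  rewrite le_eqVlt => /predU1P[<- _|x0 xab]; first by rewrite mul0r mulr0 powR_ge0.
  have y0 : 0 < x / (a + b) by rewrite divr_gt0.
  have {2}-> : x = (a + b) * (x / (a + b)) by rewrite mulrC divfK// gt_eqF.
  rewrite powRM ?(ltW ab0) ?(ltW y0)//; apply: ler_wpM2l; first exact: powR_ge0.
  by rewrite ger1_powR ?y0 ?ler_pdivrMr ?mul1r.
apply: le_trans (lerD (share a a0 _) (share b b0 _)); rewrite ?lerDl ?lerDr//.
by rewrite -mulrDr -mulrDl divff ?mulr1// gt_eqF.
Qed.

Lemma le1_normc_powR (z : Cplx R) : 1 <= normc (1 - z) `^ p + normc z `^ p.
Proof.
have /andP[p0 p1] := p01.
apply: le_trans (powR_subadditive (normc_ge0 _) (normc_ge0 _)).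
have n1 : normc (1 : Cplx R) = 1 by exact: normc1.
rewrite (_ : 1 = 1 `^ p); last by rewrite powR1.
apply: ge0_ler_powR; rewrite ?nnegrE ?addr_ge0 ?normc_ge0 ?(ltW p0)//.
by rewrite -{1}n1 -{1}(subrK z 1); exact: normcD.
Qed.

End PowerInequality.

Section LpClasses.
Local Open Scope quotient_scope.
Context {d} {T : measurableType d} {R : realType}.
Variables (mu : {measure set T -> \bar R}) (D : set T) (p : R).
Hypotheses (mD : measurable D) (p01 : 0 < p <= 1).
Implicit Types (f g : LpFun mu D p).
Local Notation cls f := (\pi_(Lp mu mD p01) f).

Lemma cmeasurable_funB (f g : T -> Cplx R) : cmeasurable_fun D f ->
  cmeasurable_fun D g -> cmeasurable_fun D (fun x => f x - g x).
Proof.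
move=> [mRf mIf] [mRg mIg]; split.
- rewrite (_ : (fun x => _) = fun x => complex.Re (f x) - complex.Re (g x)).
    exact: measurable_funB.
  by apply/funext => x; case: (f x) => a b; case: (g x).
- rewrite (_ : (fun x => _) = fun x => complex.Im (f x) - complex.Im (g x)).
    exact: measurable_funB.
  by apply/funext => x; case: (f x) => a b; case: (g x).
Qed.

Lemma int_pow_sub_fin (f g : T -> Cplx R) : cmeasurable_fun D f ->
  cmeasurable_fun D g -> (int_pow mu D p f < +oo)%E -> (int_pow mu D p g < +oo)%E ->
  int_pow mu D p (fun x => f x - g x) \is a fin_num.
Proof.
have /andP[p0 _] := p01; move=> mf mg ff gf.
have pow0 h : (forall x, D x -> 0 <= (normc (h x) `^ p)%:E)%E.
  by move=> ? _; rewrite lee_fin powR_ge0.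
rewrite ge0_fin_numE; last exact: integral_ge0 (pow0 _).
apply: le_lt_trans (lte_add_pinfty ff gf).
rewrite /int_pow -ge0_integralD//; [|exact: pow0|exact: measurable_normc_powR|
  exact: pow0|exact: measurable_normc_powR].
apply: ge0_le_integral => //.
- exact: pow0.
- by apply: measurable_normc_powR; exact: cmeasurable_funB.
- by apply: emeasurable_funD; exact: measurable_normc_powR.
move=> x _; rewrite -EFinD lee_fin.
apply: le_trans (powR_subadditive p01 (normc_ge0 _) (normc_ge0 _)).
apply: ge0_ler_powR; rewrite ?nnegrE ?addr_ge0 ?normc_ge0 ?(ltW p0)//.
have <- : normc (- g x) = normc (g x) by rewrite -[in LHS]sub0r normc_sub subr0.
exact: normcD.
Qed.

(** The distance is defined from chosen representatives, which agree almost
    everywhere with [f] and [g]. *)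
Lemma mdist_pi f g : mdist (cls f) (cls g) =
  fine (int_pow mu D p (fun x => f x - g x)).
Proof.
have /eqmodP/asboolP ff : (repr (cls f) = f %[mod (Lp mu mD p01)]) by rewrite reprK.
have /eqmodP/asboolP gg : (repr (cls g) = g %[mod (Lp mu mD p01)]) by rewrite reprK.
change (fine (int_pow mu D p (fun x => repr (cls f) x - repr (cls g) x)) =
  fine (int_pow mu D p (fun x => f x - g x))).
congr fine; apply: ae_eq_integral => //.
- by apply: measurable_normc_powR; apply: cmeasurable_funB; exact: LpFun_measurable.
- by apply: measurable_normc_powR; apply: cmeasurable_funB; exact: LpFun_measurable.
by apply: filterS2 ff gg => x fx gx Dx; rewrite fx// gx.
Qed.

End LpClasses.

(** * Two best approximations of an indicator function *)

Section NotChebyshev.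
Local Open Scope quotient_scope.
Context {d} {T : measurableType d} {R : realType}.
Variables (mu : {measure set T -> \bar R}) (D E : set T) (p : R).
Hypotheses (mD : measurable D) (p01 : 0 < p <= 1) (mE : measurable E).
Hypotheses (ED : E `<=` D) (Dfin : (mu D < +oo)%E).

Let p0 : 0 < p. Proof. by case/andP: p01. Qed.

Definition indic_Cplx (x : T) : Cplx R := to_cplx (\1_E x, 0).

Lemma cmeasurable_indic : cmeasurable_fun D indic_Cplx.
Proof. by split => /=; [exact: measurable_indic|exact: measurable_cst]. Qed.

Lemma cmeasurable_cst (c : Cplx R) : cmeasurable_fun D (fun=> c).
Proof. by split; exact: measurable_cst. Qed.

Lemma int_pow_cst (A : set T) (c : Cplx R) : measurable A ->
  int_pow mu A p (fun=> c) = ((normc c `^ p)%:E * mu A)%E.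
Proof. by move=> mA; rewrite /int_pow integral_cst. Qed.

Lemma int_pow_indic_sub (h : T -> Cplx R) : cmeasurable_fun D h ->
  int_pow mu D p (fun x => indic_Cplx x - h x) =
  (int_pow mu E p (fun x => 1 - h x)%R + int_pow mu (D `\` E) p h)%E.
Proof.
move=> mh; pose k x := (normc (indic_Cplx x - h x) `^ p)%:E.
have mDE : measurable (D `\` E) by exact: measurableD.
have mk : measurable_fun (E `|` (D `\` E)) k.
  rewrite setDUK//; apply: measurable_normc_powR; apply: cmeasurable_funB => //.
  exact: cmeasurable_indic.
transitivity (\int[mu]_(x in E `|` (D `\` E)) k x)%E; first by rewrite setDUK.
have k0 x : (E `|` (D `\` E)) x -> (0 <= k x)%E by rewrite lee_fin powR_ge0.
have disj : [disjoint E & D `\` E]%classic by apply/disj_setPS => x [Ex [_]].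
rewrite (ge0_integral_setU mu mE mDE mk k0 disj).
apply: (congr2 (fun a b => a + b)%E); apply: eq_integral => x; rewrite inE /k /indic_Cplx indicE.
  by move=> Ex; rewrite mem_set.
by move=> -[_ Ex]; rewrite memNset// -normc_sub subr0.
Qed.

Lemma int_pow_indic : int_pow mu D p indic_Cplx = mu E.
Proof.
transitivity (int_pow mu D p (fun x => indic_Cplx x - 0)).
  by apply: eq_integral => x _; rewrite subr0.
rewrite int_pow_indic_sub; last exact: cmeasurable_cst.
rewrite subr0 !int_pow_cst//; last exact: measurableD.
by rewrite normc1 powR1 mul1e normc0 powR0 ?gt_eqF// mul0e adde0.
Qed.

Lemma int_pow_indic_fin : (int_pow mu D p indic_Cplx < +oo)%E.
Proof.
by rewrite int_pow_indic; apply: le_lt_trans Dfin; apply: le_measure; rewrite ?inE.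
Qed.

Lemma int_pow_cst_fin (c : Cplx R) : (int_pow mu D p (fun=> c) < +oo)%E.
Proof. by rewrite int_pow_cst// lte_mul_pinfty// lee_fin powR_ge0. Qed.

Definition LpFun_indic := MkLpFun cmeasurable_indic int_pow_indic_fin.
Definition LpFun_cst c := MkLpFun (cmeasurable_cst c) (int_pow_cst_fin c).

Local Notation cls f := (\pi_(Lp mu mD p01) f).

(** The constants [0] and [1] both have distance [mu E] to the indicator function of
    [E]. For [G] in [Y], the hypothesis moves the integral of [normc (1 - g) `^ p]
    from [E] to [D `\` E], where [normc (1 - g) `^ p + normc g `^ p] is at least
    [1]; hence no element of [Y] is closer. *)
Lemma not_chebyshev_of_halves (Y : set (Lp mu mD p01)) :
  (0 < mu D)%E -> mu E = mu (D `\` E) ->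
  Y (cls (LpFun_cst 0)) -> Y (cls (LpFun_cst 1)) ->
  (forall G, Y G -> exists2 g : LpFun mu D p, G = cls g &
    (int_pow mu (D `\` E) p (fun x => 1 - g x)%R <= int_pow mu E p (fun x => 1 - g x)%R)%E) ->
  ~ chebyshev_set Y.
Proof.
move=> D0 Ehalf Y0 Y1 Yhalf.
pose F : Lp mu mD p01 := cls LpFun_indic.
have mDE : measurable (D `\` E) by exact: measurableD.
have dist (g : LpFun mu D p) : mdist F (cls g) =
    fine (int_pow mu E p (fun x => 1 - g x)%R + int_pow mu (D `\` E) p g).
  by rewrite mdist_pi int_pow_indic_sub//; exact: LpFun_measurable.
have d0 : mdist F (cls (LpFun_cst 0)) = fine (mu E).
  rewrite dist /= subr0 !int_pow_cst// normc1 powR1 mul1e normc0.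
  by rewrite powR0 ?gt_eqF// mul0e adde0.
have d1 : mdist F (cls (LpFun_cst 1)) = fine (mu E).
  rewrite dist /= subrr !int_pow_cst// normc1 powR1 mul1e normc0.
  by rewrite powR0 ?gt_eqF// mul0e add0e Ehalf.
have lower G : Y G -> fine (mu E) <= mdist F G.
  move=> /Yhalf[g -> gE].
  have gm := LpFun_measurable g.
  have m1g : cmeasurable_fun D (fun x => 1 - g x).
    by apply: cmeasurable_funB => //; exact: cmeasurable_cst.
  have mpow h : cmeasurable_fun D h ->
      measurable_fun (D `\` E) (fun x => (normc (h x) `^ p)%:E).
    by move=> mh; apply: measurable_funS (measurable_normc_powR p mh).
  have fin : int_pow mu D p (fun x => indic_Cplx x - g x) \is a fin_num.
    apply: int_pow_sub_fin => //; [exact: cmeasurable_indic|exact: int_pow_indic_fin|].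
    exact: LpFun_finite.
  have -> : mdist F (cls g) = fine (int_pow mu D p (fun x => indic_Cplx x - g x)).
    exact: mdist_pi.
  have finE : mu E \is a fin_num.
    rewrite ge0_fin_numE//; apply: le_lt_trans Dfin.
    by apply: le_measure; rewrite ?inE.
  apply: (fine_le finE fin).
  rewrite (int_pow_indic_sub gm); apply: le_trans (leeD2r _ gE).
  rewrite Ehalf -[leLHS]mul1e -integral_cst// -ge0_integralD//.
  - apply: ge0_le_integral => //.
    + by apply: emeasurable_funD; exact: mpow.
    + by move=> x _; rewrite -EFinD lee_fin; exact: le1_normc_powR.
  - by move=> x _; rewrite lee_fin powR_ge0.
  - exact: mpow.
  - by move=> x _; rewrite lee_fin powR_ge0.
  - exact: mpow.
have Einf : inf [set mdist F z | z in Y] = fine (mu E).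
  apply/eqP; rewrite eq_le; apply/andP; split.
    rewrite -d0; apply: ge_inf; last by exists (cls (LpFun_cst 0)).
    by exists (fine (mu E)) => _ [G YG <-]; exact: lower.
  apply: lb_le_inf; first (exists (fine (mu E)), (cls (LpFun_cst 0)); [exact: Y0|exact: d0]).
  by move=> _ [G YG <-]; exact: lower.
move=> chebY; have [y yE] := chebY F.
have b0 : best_approximations Y F (cls (LpFun_cst 0)).
  by split; [exact: Y0|exact: etrans d0 (esym Einf)].
have b1 : best_approximations Y F (cls (LpFun_cst 1)).
  by split; [exact: Y1|exact: etrans d1 (esym Einf)].
move: b0 b1; rewrite yE => /= y0 y1.
have : cls (LpFun_cst 0) = cls (LpFun_cst 1) by rewrite y0.
move=> /eqmodP/asboolP ae01.
suff : mu D = 0%E by move=> Dz; rewrite Dz ltxx in D0.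
apply: measure_negligible => //; apply: negligibleS ae01 => x Dx /= /(_ Dx)/eqP.
by rewrite eq_sym oner_eq0.
Qed.

End NotChebyshev.

(** * The Bergman space *)

Theorem theorem1p11 (R : realType) (n : nat) (n_gt0 : (0 < n)%N)
    (Omega : set 'rV[Cplx R]_n) (Omega_neq0 : Omega !=set0)
    (Omega_open : open Omega) (Omega_connected : connected Omega)
    (Omega_bounded : bounded_set Omega)
    (p : R) (p01 : 0 < p <= 1) :
  ~ chebyshev_set (Ap Omega_open p01) /\
  ~ (exists Pi : LpOmega Omega_open p01 -> LpOmega Omega_open p01,
       forall f, best_approximations (Ap Omega_open p01) f = [set Pi f]).
Proof.
suff notC : ~ chebyshev_set (Ap Omega_open p01).
  by split=> // -[Pi PiP]; apply: notC => f; exists (Pi f).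
case: n n_gt0 Omega Omega_neq0 Omega_open Omega_connected Omega_bounded => // m _.
move=> Omega Omega_neq0 Omega_open _ Omega_bounded.
have p0 : 0 < p by case/andP: p01.
pose mO := open_measurable_Cn Omega_open.
have Ofin := lebesgue_Cn_bounded mO Omega_bounded.
have [_ _ [E [mE EO Ehalf Ele]]] := balanced_open Omega_open p0 Ofin.
have hcst c : holomorphic_on Omega (fun=> c) by move=> z _; exact: differentiable_cst.
have O0 : (0 < lebesgue_Cn Omega)%E by exact: lebesgue_Cn_open_gt0.
apply: (@not_chebyshev_of_halves _ _ _ _ _ _ _ mO
  p01 mE EO Ofin (Ap Omega_open p01) O0 Ehalf).
- by exists (LpFun_cst p mO Ofin 0).
- by exists (LpFun_cst p mO Ofin 1).
move=> _ [g hg ->]; exists g => //; apply: Ele.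
  by move=> z Oz; apply: differentiableB; [exact: hcst|exact: hg].
by apply: cmeasurable_funB; [exact: cmeasurable_cst|exact: LpFun_measurable].
Qed.
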